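(* Let $d\ge2$, $0<\alpha<1$ and $\beta>1$. Let $\{X_{\mathbf k},\mathbf k\in\mathbb Z_+^d\}$ be i.i.d. copies of $X$ with $\mathbb EX=0$, $\operatorname{Var}X=\sigma^2<\infty$ and $\mathbb E\big(|X|^{2/\alpha}(\log^+|X|)^{d-1-1/\alpha}\big)<\infty$. Let $B=\{\mathbf n\in\mathbb Z_+^d: |\mathbf n|=\lfloor i^{\beta/(1-\alpha)}\rfloor\text{ for some integer }i\ge1\}$. Then $$\limsup_{\mathbf n\to\infty,\ \mathbf n\in B}\frac{\max_{\mathbf 0\le\mathbf k\le\mathbf n^\alpha}T_{\mathbf n,\mathbf n+\mathbf k}}{\sqrt{2|\mathbf n|^\alpha\log|\mathbf n|}}=\sigma\sqrt{\frac{1-\alpha}{\beta}}\quad\text{a.s.}$$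
   Context: $\mathbb Z_+^d$ is the set of $d$-tuples of positive integers with the coordinatewise partial order $\le$; $\mathbf k$ ranges over $\mathbb Z_{\ge0}^d$. $|\mathbf n|=\prod_{k=1}^d n_k$; $\mathbf n\to\infty$ means every coordinate tends to infinity. $\mathbf n^\alpha=(\lfloor n_1^\alpha\rfloor,\dots,\lfloor n_d^\alpha\rfloor)$. $T_{\mathbf n,\mathbf n+\mathbf k}=\sum X_{\mathbf j}$ over all $\mathbf j\in\mathbb Z_+^d$ with $n_i<j_i\le n_i+k_i$ for every $i$. $\log^+x=\max\{\log x,1\}$. *)

(* Defs.v *)
From HB Require Import structures.
From mathcomp Require Import all_boot all_order all_algebra.
From mathcomp Require Import all_classical all_reals all_analysis.
Set Implicit Arguments. Unset Strict Implicit. Unset Printing Implicit Defensive.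
Import Order.TTheory GRing.Theory Num.Theory.
Local Open Scope classical_set_scope.
Local Open Scope ring_scope.

(* Multi-indices in Z_{>=0}^d are finite functions 'I_d -> nat;
   Z_+^d is the subset of those with all coordinates positive. *)
Definition idx (d : nat) := {ffun 'I_d -> nat}.

Definition pos_idx d (j : idx d) : Prop := forall i, (0 < j i)%N.

Definition idx_size d (n : idx d) : nat := (\prod_(i < d) n i)%N.

Definition idx_pow (R : realType) d (n : idx d) (alpha : R) : idx d :=
  [ffun i => `| Num.floor ((n i)%:R `^ alpha) |%N].

(* T_{n,n+k} = sum of X_j over n_i < j_i <= n_i + k_i, i.e. j = n + t + 1
   with 0 <= t_i < k_i. *)
Definition Tsum (R : realType) (T : Type) d (X : idx d -> T -> R)
    (n k : idx d) (w : T) : R :=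
  \sum_(t : {ffun 'I_d -> 'I_(\max_(i < d) k i).+1} | [forall i, (t i < k i)%N])
     X [ffun i => (n i + t i).+1]%N w.

(* max over 0 <= k <= m (coordinatewise) of T_{n,n+k}; k = 0 gives 0,
   so the initial value 0 of the fold does not matter. *)
Definition maxT (R : realType) (T : Type) d (X : idx d -> T -> R)
    (n m : idx d) (w : T) : R :=
  \big[Num.max/0]_(k : {ffun 'I_d -> 'I_(\max_(i < d) m i).+1}
                    | [forall i, (k i <= m i)%N])
     Tsum X n [ffun i => nat_of_ord (k i)] w.

Definition limsup_in (R : realType) d (S : set (idx d)) (f : idx d -> R)
    : \bar R :=
  ereal_inf [set ereal_sup [set (f n)%:E | n in [set n | S n /\ forall i, (m <= n i)%N]]
            | m in [set: nat]].

Definition iid_copies (R : realType) dT (T : measurableType dT)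
    (P : probability T R) d (S : set (idx d)) (X : idx d -> T -> R)
    (Y : T -> R) : Prop :=
  [/\ (forall j, S j -> measurable_fun setT (X j)),
      (forall j, S j -> forall A : set R, measurable A ->
          P (X j @^-1` A) = P (Y @^-1` A)) &
      (forall (J : seq (idx d)) (A : idx d -> set R), uniq J ->
          (forall j, j \in J -> S j) -> (forall j, measurable (A j)) ->
          P (\bigcap_(j in [set` J]) (X j @^-1` A j)) =
          (\prod_(j <- J) P (X j @^-1` A j))%E)].

Definition logp (R : realType) (x : R) : R := Num.max (ln x) 1.

(* Main.v *)
(* Write m = |n|, L = log m and gam = beta / (1 - alpha). Truncating the summands at
   delta sqrt (m^alpha / L) costs little: by the moment condition and a count of lattice
   points, almost surely |X_j| is eventually at most delta sqrt (|j|^alpha log |j|), and a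
   Chernoff bound for the number of summands above the truncation level shows that each
   window contains boundedly many of them.

   The exponential moments of the truncated sums are then Gaussian up to a factor m^o(1).
   For the upper bound no maximal inequality is needed: corners k are rounded down to a
   grid with boundedly many points, the remainders being sums over few variables, whose
   tails decay faster than any prescribed power of m; and only m^o(1) indices n satisfy
   |n| = m by the divisor bound, so Borel-Cantelli along the sizes i^gam applies.

   For the lower bound, exponential tilting shows that the sum over the window at
   n = (floor(i^gam) / M^(d-1), M, ..., M) is large with probability at least
   i^(-(1 - eps/2)). These windows are disjoint because beta > 1, and M^(d-1) divides
   floor(i^gam) for a positive proportion of the i, which is proved by differencing i^gam
   modulo 1 until it varies slowly. *)

Require Import Defs.
From HB Require Import structures.
From mathcomp Require Import all_boot all_order all_algebra.
From mathcomp Require Import all_classical all_reals all_analysis.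
From mathcomp Require Import measurable_realfun.
From mathcomp Require Import ring lra zify.
Import Order.TTheory GRing.Theory Num.Theory.
Import numFieldNormedType.Exports.
Set Implicit Arguments.
Unset Strict Implicit.
Unset Printing Implicit Defensive.
Local Open Scope classical_set_scope.
Local Open Scope ring_scope.

(* [lia] without the real-valued hypotheses, on which its preprocessing is very slow. *)
Ltac natlia :=
  repeat match goal with x := _ |- _ => clearbody x end;
  try match goal with R : realType |- _ => clear dependent R end; lia.

(** * Independence and product expectations *)

(** The constant comes from the Gaussian rate: a sum of about m^alpha summands exceeds x sqrt(2
    m^alpha log m) with probability m^(-x^2/sigma^2 + o(1)), and along m = i^gam this is summable in
    i when x > sigma/sqrt(gam). The moment weight enters in two strengths: as it stands it controls
    single large summands, while all exponential estimates use a moment of order p = 1 + 1/alpha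
    derived from it. The margin of p over 2 makes the non-Gaussian error a negative power of m.
    Truncated summands are never recentred; the shift of their mean is charged to the p-th moment.

    The lower bound meets an arithmetic obstacle: every coordinate of n must grow while |n| is
    exactly floor(i^gam), a number with no prescribed factors. Since the probabilities are only
    slightly larger than 1/i, a positive density of multiples of M^(d-1) is wanted. Up to constants
    depending on M, disjointness compares the gap i^(gam-1) of consecutive sizes with the window
    length i^(gam alpha), and gam (1 - alpha) = beta > 1. *)

Section independence.
Context {R : realType} {dT : measure_display} {T : measurableType dT}.
Context (P : probability T R) {I : choiceType}.
Implicit Types (X : I -> T -> R) (J K : seq I).

Definition mutually_independent (S : set I) X : Prop :=
  (forall j, S j -> measurable_fun setT (X j)) /\
  (forall (J : seq I) (A : I -> set R), uniq J ->
     (forall j, j \in J -> S j) -> (forall j, measurable (A j)) ->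
     P (\bigcap_(j in [set` J]) (X j @^-1` A j)) =
     (\prod_(j <- J) P (X j @^-1` A j))%E).

(** A pi-system generating the sigma-algebra of the [X j] with [j] in [J]. The family [A] is total
    on [I], so that families for two lists can be pasted together. *)
Definition rectangles X J : set (set T) :=
  [set E | exists A : I -> set R, (forall j, measurable (A j)) /\
                                  E = \bigcap_(j in [set` J]) (X j @^-1` A j)].

Lemma rectangles_setI X J : setI_closed (rectangles X J).
Proof.
move=> _ _ [A [mA ->]] [B [mB ->]]; exists (fun j => A j `&` B j); split.
  by move=> j; exact: measurableI.
apply/seteqP; split => w.
  by move=> [h1 h2] j Jj; split; [exact: h1|exact: h2].
by move=> h; split => j Jj; have [] := h j Jj.
Qed.

Lemma rectanglesT X J : rectangles X J setT.
Proof.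
exists (fun=> setT); split => //.
by apply/seteqP; split => // w _ j _.
Qed.

Variables (S : set I) (X : I -> T -> R).
Hypothesis indepX : mutually_independent S X.
Let mX := indepX.1.

Lemma measurable_rectangles J : (forall j, j \in J -> S j) ->
  rectangles X J `<=` measurable.
Proof.
move=> JS _ [A [mA ->]]; rewrite bigcap_seq.
elim: J JS => [|j J IH] JS; first by rewrite big_nil.
rewrite big_cons; apply: measurableI.
  rewrite -[X in measurable X]setTI; apply: mX => //; apply: JS; exact: mem_head.
by apply: IH => k Jk; apply: JS; rewrite inE Jk orbT.
Qed.

Lemma measurable_sigma_rectangles J : (forall j, j \in J -> S j) ->
  <<s rectangles X J >> `<=` measurable.
Proof.
move=> JS; apply: smallest_sub; first exact: sigma_algebra_measurable.
exact: measurable_rectangles.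
Qed.

Lemma rectangles_indep J K E F : uniq (J ++ K) -> (forall j, j \in J ++ K -> S j) ->
  rectangles X J E -> rectangles X K F -> P (E `&` F) = (P E * P F)%E.
Proof.
move=> uJK JKS [A [mA ->]] [B [mB ->]].
pose C j := if j \in J then A j else B j.
have mC j : measurable (C j) by rewrite /C; case: ifP.
have dJK j : j \in K -> (j \in J) = false.
  move=> Kj; apply/negP => Jj; move: uJK; rewrite cat_uniq => /and3P[_ /hasP[]].
  by exists j.
have uJ : uniq J by move: uJK; rewrite cat_uniq => /and3P[].
have uK : uniq K by move: uJK; rewrite cat_uniq => /and3P[].
have -> : \bigcap_(j in [set` J]) (X j @^-1` A j) `&`
          \bigcap_(j in [set` K]) (X j @^-1` B j) =
          \bigcap_(j in [set` J ++ K]) (X j @^-1` C j).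
  apply/seteqP; split => w.
    move=> [h1 h2] j /=; rewrite mem_cat /C; case: ifPn => [Jj _|_ /= Kj].
      exact: h1.
    exact: h2.
  move=> h; split => j /= Hj.
    by have := h j; rewrite /= mem_cat Hj /C Hj; apply.
  by have := h j; rewrite /= mem_cat Hj orbT /C dJK //; apply.
have [_ iX] := indepX.
rewrite !iX //.
- rewrite big_cat /=; congr (_ * _)%E; apply: eq_big_seq => j Jj; rewrite /C.
    by rewrite Jj.
  by rewrite dJK.
- by move=> j Kj; apply: JKS; rewrite mem_cat Kj orbT.
- by move=> j Jj; apply: JKS; rewrite mem_cat Jj.
Qed.

(** Two applications of uniqueness of measures on a pi-system: with one event fixed, E -> P(E n F)
    and E -> P(E) P(F) are finite measures agreeing on rectangles. The first pass extends [E]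
    against a general [F], the second extends [F] against a rectangle. *)
Lemma sigma_rectangles_indep J K E F : uniq (J ++ K) ->
  (forall j, j \in J ++ K -> S j) ->
  <<s rectangles X J >> E -> <<s rectangles X K >> F ->
  P (E `&` F) = (P E * P F)%E.
Proof.
move=> uJK JKS sE sF.
have JS j : j \in J -> S j by move=> Jj; apply: JKS; rewrite mem_cat Jj.
have KS j : j \in K -> S j by move=> Kj; apply: JKS; rewrite mem_cat Kj orbT.
have ext L (HL : forall j, j \in L -> S j) F0 : measurable F0 ->
    (forall E, rectangles X L E -> P (E `&` F0) = (P E * P F0)%E) ->
    forall E, <<s rectangles X L >> E -> P (E `&` F0) = (P E * P F0)%E.
  move=> mF0 h E0 sE0.
  have r0 : 0 <= fine (P F0) by rewrite fine_ge0.
  pose m1 := mrestr P mF0 : {measure set T -> \bar R}.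
  pose m2 := mscale (NngNum r0) P : {measure set T -> \bar R}.
  have m2E A : m2 A = (P A * P F0)%E.
    by rewrite /m2 /= /mscale /= muleC fineK// fin_num_measure.
  rewrite -m2E.
  apply: (g_sigma_algebra_measure_unique (rectangles X L) _ (fun=> setT)
            _ _ m1 m2) => //.
  - exact: measurable_rectangles.
  - by move=> _; exact: rectanglesT.
  - by rewrite bigcup_const.
  - exact: rectangles_setI.
  - by move=> A LA; rewrite m2E /m1 /= /mrestr h.
  - move=> k; rewrite /m1 /= /mrestr setTI.
    by rewrite (le_lt_trans (probability_le1 _ _))// ltry.
apply: (ext J) => //.
  exact: (measurable_sigma_rectangles KS).
move=> E' rE'; rewrite setIC muleC; apply: (ext K) => //.
  exact: (measurable_rectangles JS).
by move=> F' rF'; rewrite setIC muleC; exact: (@rectangles_indep J K).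
Qed.

(** The same space with the smaller sigma-algebra: membership of an event in it becomes ordinary
    measurability of a function on this type. *)
Definition rect_space J := g_sigma_algebraType (rectangles X J).

Lemma measurable_coord J j : j \in J ->
  measurable_fun setT (X j : rect_space J -> R).
Proof.
move=> Jj _ A mA; rewrite setTI; apply: sub_sigma_algebra.
exists (fun i => if i == j then A else setT); split.
  by move=> i; case: ifP.
apply/seteqP; split => w /=.
  by move=> Aw i /= _; case: ifP => // /eqP->.
by move=> /(_ j Jj); rewrite eqxx.
Qed.

Lemma sigma_rectangles_mono J K : {subset J <= K} ->
  <<s rectangles X J >> `<=` <<s rectangles X K >>.
Proof.
move=> JK; apply: smallest_sub; first exact: smallest_sigma_algebra.
move=> _ [B [mB ->]]; apply: sub_sigma_algebra.
exists (fun i => if i \in J then B i else setT); split.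
  by move=> i; case: ifP.
apply/seteqP; split => w /=.
  by move=> Bw i /= Ki; case: ifPn => // Ji; exact: Bw.
by move=> h i /= Ji; have := h i (JK _ Ji); rewrite Ji.
Qed.

Lemma measurable_of_rect_space J (f : T -> R) : (forall j, j \in J -> S j) ->
  measurable_fun setT (f : rect_space J -> R) -> measurable_fun setT f.
Proof.
move=> JS mf _ A mA; apply: (measurable_sigma_rectangles JS).
exact: (mf measurableT A mA).
Qed.

Lemma measurable_coord_sum J (g : I -> R -> R) :
  (forall j, measurable_fun setT (g j)) ->
  measurable_fun setT ((fun w => \sum_(j <- J) g j (X j w)) : rect_space J -> R).
Proof.
move=> mg.
(* The sum lemma wants each summand measurable for every index, whereas [X j] is measurable here
   only for [j] in [J]; the other summands are set to 0. *)
apply: (@eq_measurable_fun _ _ (rect_space J) _ setT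
  (fun w => \sum_(j <- J) (if j \in J then g j (X j w) else 0))).
  by move=> w _; apply: eq_big_seq => j Jj; rewrite Jj.
apply: (@measurable_sum _ (rect_space J)) => j; case: (boolP (j \in J)) => Jj.
  by apply: measurableT_comp => //; exact: measurable_coord.
exact: measurable_cst.
Qed.

Lemma measurable_coord_prod J (g : I -> R -> R) :
  (forall j, measurable_fun setT (g j)) ->
  measurable_fun setT ((fun w => \prod_(j <- J) g j (X j w)) : rect_space J -> R).
Proof.
move=> mg.
apply: (@measurable_prod _ (rect_space J) R setT _ J (fun j w => g j (X j w))).
by move=> j Jj; apply: measurableT_comp => //; exact: measurable_coord.
Qed.

End independence.

Section product_expectation.
Context {R : realType} {dT : measure_display} {T : measurableType dT}.
Context (P : probability T R).

(** Independence makes the joint law of (U, V) the product of the marginal laws, and Tonelli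
    applies. *)
Lemma ge0_integral_mul_indep (U V : T -> R) :
  measurable_fun setT U -> measurable_fun setT V ->
  (forall w, 0 <= U w) -> (forall w, 0 <= V w) ->
  (forall A B, measurable A -> measurable B ->
    P (U @^-1` A `&` V @^-1` B) = (P (U @^-1` A) * P (V @^-1` B))%E) ->
  (\int[P]_w (U w * V w)%:E = \int[P]_w (U w)%:E * \int[P]_w (V w)%:E)%E.
Proof.
move=> mU mV U0 V0 iUV.
pose U' : {mfun T >-> R} := mfun_Sub (mem_set mU).
pose V' : {mfun T >-> R} := mfun_Sub (mem_set mV).
have mUV : measurable_fun setT (fun w => (U w, V w)) by exact: measurable_fun_pair.
pose W' : {mfun T >-> (R * R)%type} := mfun_Sub (mem_set mUV).
pose mu1 : probability _ R := distribution P U'.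
pose mu2 : probability _ R := distribution P V'.
pose mu : probability _ R := distribution P W'.
have E X0 : measurable X0 -> (mu1 \x mu2)%E X0 = mu X0.
  apply: product_measure_unique => A B mA mB.
  by rewrite /mu /mu1 /mu2 /distribution /pushforward /= -iUV.
(* The absolute values make the integrand nonnegative on the whole plane; they disappear on the
   range of (U, V). *)
pose f (z : R * R) : \bar R := (`|z.1| * `|z.2|)%:E.
have mf : measurable_fun [set: R * R] (EFin \o (fun z : R * R => `|z.1| * `|z.2|)).
  apply/measurable_EFinP; apply: measurable_funM.
    by apply: measurableT_comp => //; exact: measurable_fst.
  by apply: measurableT_comp => //; exact: measurable_snd.
have f0 z : (0 <= f z)%E by rewrite lee_fin mulr_ge0.
transitivity (\int[mu]_z f z)%E.
  rewrite ge0_integral_distribution//; apply: eq_integral => w _.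
  by rewrite /f /= !ger0_norm.
rewrite (@eq_measure_integral _ _ _ _ (mu1 \x mu2)%E); last first.
  by move=> A mA _; symmetry; exact: E.
rewrite fubini_tonelli1//=.
transitivity (\int[mu1]_x (`|x|%:E * \int[P]_w (V w)%:E))%E.
  apply: eq_integral => x _; rewrite /fubini_F /f /=.
  under eq_integral do rewrite EFinM.
  rewrite ge0_integralZl//.
    congr (_ * _)%E; rewrite ge0_integral_distribution//.
      by apply: eq_integral => w _ /=; rewrite ger0_norm.
    by apply/measurable_EFinP; exact: normr_measurable.
  by apply/measurable_EFinP; exact: normr_measurable.
rewrite ge0_integralZr//; last 2 first.
- by apply/measurable_EFinP; exact: normr_measurable.
- by apply: integral_ge0 => w _; rewrite lee_fin.
congr (_ * _)%E; rewrite ge0_integral_distribution//.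
  by apply: eq_integral => w _ /=; rewrite ger0_norm.
by apply/measurable_EFinP; exact: normr_measurable.
Qed.

Context {I : choiceType} (S : set I) (X : I -> T -> R).
Hypothesis indepX : mutually_independent P S X.

Lemma integral_prod_indep (Y : T -> R) (f : R -> R) (J : seq I) :
  measurable_fun setT Y ->
  (forall j, S j -> forall A, measurable A -> P (X j @^-1` A) = P (Y @^-1` A)) ->
  uniq J -> (forall j, j \in J -> S j) ->
  measurable_fun setT f -> (forall x, 0 <= f x) ->
  (\int[P]_w (\prod_(j <- J) f (X j w))%:E = (\int[P]_w (f (Y w))%:E) ^+ size J)%E.
Proof.
move=> mY dXY + + mf f0; elim: J => [|j J IH].
  move=> _ _; under eq_integral do rewrite big_nil.
  by rewrite integral_cst// mul1e; exact: probability_setT.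
move=> + JS; rewrite cons_uniq => /andP[jJ uJ].
have JS' k : k \in J -> S k by move=> Jk; apply: JS; rewrite inE Jk orbT.
have Sj : S j by apply: JS; exact: mem_head.
under eq_integral do rewrite big_cons.
have mXj : measurable_fun setT (X j) by exact: indepX.1.
rewrite (@ge0_integral_mul_indep (fun w => f (X j w))
          (fun w => \prod_(i <- J) f (X i w))).
- rewrite IH// [size (j :: J)]/= expeS; congr (_ * _)%E.
  pose Xj : {mfun T >-> R} := mfun_Sub (mem_set mXj).
  pose Y' : {mfun T >-> R} := mfun_Sub (mem_set mY).
  have mEf : measurable_fun setT (EFin \o f) by exact/measurable_EFinP.
  have Ef0 y : (0 <= (EFin \o f) y)%E by rewrite lee_fin.
  transitivity (\int[distribution P Xj]_y (EFin \o f) y)%E.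
    by rewrite ge0_integral_distribution.
  rewrite (@eq_measure_integral _ _ _ _ (distribution P Y')).
    by rewrite ge0_integral_distribution.
  by move=> A mA _; rewrite /= /distribution /pushforward /= dXY.
- exact: measurableT_comp.
- apply: (measurable_of_rect_space indepX JS').
  exact: (@measurable_coord_prod _ _ _ _ X J (fun=> f)).
- by [].
- by move=> w; apply: prodr_ge0.
- move=> A B mA mB.
  apply: (@sigma_rectangles_indep _ _ _ P _ S X indepX [:: j] J).
  + by rewrite /= jJ uJ.
  + by [].
  + have : measurable_fun setT ((f \o X j) : rect_space X [:: j] -> R).
      by apply: measurableT_comp => //; apply: measurable_coord; exact: mem_head.
    by move=> /(_ measurableT A mA); rewrite setTI.
  + have := @measurable_coord_prod _ _ _ _ X J (fun=> f) (fun=> mf).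
    by move=> /(_ measurableT B mB); rewrite setTI.
Qed.

Lemma indep_blocks (J : nat -> seq I) (E : nat -> set T) (s : seq nat) :
  uniq s ->
  (forall i, i \in s -> uniq (J i)) ->
  (forall i, i \in s -> forall j, j \in J i -> S j) ->
  (forall i k j, i \in s -> k \in s -> j \in J i -> j \in J k -> i = k) ->
  (forall i, i \in s -> <<s rectangles X (J i) >> (E i)) ->
  P (\bigcap_(i in [set` s]) E i) = (\prod_(i <- s) P (E i))%E.
Proof.
move=> us uJ JS dJ sE.
(* The induction must also carry that the intersection lies in the sigma-algebra of the concatenated
   blocks, so that it can be separated from the next block. *)
have : uniq (flatten [seq J i | i <- s]) /\
    <<s rectangles X (flatten [seq J i | i <- s]) >> (\bigcap_(i in [set` s]) E i) /\
    P (\bigcap_(i in [set` s]) E i) = (\prod_(i <- s) P (E i))%E; last by case=> _ [].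
elim: s us uJ JS dJ sE => [|i s IH] /=.
  move=> _ _ _ _ _; split => //; rewrite bigcap_seq !big_nil; split.
    by apply: sub_sigma_algebra; exact: rectanglesT.
  by rewrite probability_setT.
move=> /andP[is_ us] uJ JS dJ sE.
have ss k : k \in s -> k \in i :: s by rewrite inE orbC => ->.
have [] := IH us.
- by move=> k /ss; exact: uJ.
- by move=> k /ss; exact: JS.
- by move=> k l j /ss ks /ss ls; exact: dJ.
- by move=> k /ss; exact: sE.
move=> uf [sf Pf].
have uc : uniq (J i ++ flatten [seq J k | k <- s]).
  rewrite cat_uniq uJ ?mem_head//= uf andbT.
  apply/negP => /hasP[j /flattenP[_ /mapP[k ks ->] jk] ji].
  have ik : i = k by apply: (dJ i k j) => //; [exact: mem_head|exact: ss].
  by rewrite ik ks in is_.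
split => //.
have -> : \bigcap_(k in [set` i :: s]) E k = E i `&` \bigcap_(k in [set` s]) E k.
  by rewrite !bigcap_seq big_cons.
split.
  pose G := rect_space X (J i ++ flatten [seq J k | k <- s]).
  apply: (@measurableI _ G).
    apply: (@sigma_rectangles_mono _ _ _ _ X (J i)); last by apply: sE; exact: mem_head.
    by move=> j; rewrite mem_cat => ->.
  apply: (sigma_rectangles_mono _ sf).
  by move=> j; rewrite mem_cat => ->; rewrite orbT.
rewrite big_cons -Pf.
apply: (sigma_rectangles_indep indepX uc) => //.
  move=> j; rewrite mem_cat => /orP[ji|/flattenP[_ /mapP[k ks ->] jk]].
    by apply: (JS i) => //; exact: mem_head.
  by apply: (JS k) => //; exact: ss.
by apply: sE; exact: mem_head.
Qed.

End product_expectation.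

(** * Borel-Cantelli lemmas *)

Section borel_cantelli.
Context {R : realType} {dT : measure_display} {T : measurableType dT}.
Context (P : probability T R).

(** Replaces the integral test by a telescoping sum. It follows from e^u >= 1 + u and -ln(1 -
    1/(i+1)) >= 1/(i+1). *)
Lemma powR_telescope (kappa : R) (i : nat) : 0 < kappa -> (0 < i)%N ->
  kappa * i.+1%:R `^ (- (1 + kappa)) <= i%:R `^ (- kappa) - i.+1%:R `^ (- kappa).
Proof.
move=> k0 i0; set x : R := i%:R; set y : R := i.+1%:R.
have x0 : 0 < x by rewrite ltr0n.
have y0 : 0 < y by rewrite ltr0n.
have yx : y = x + 1 by rewrite /x /y -natr1.
have -> : x `^ (- kappa) = y `^ (- kappa) * expR (kappa * ln (y / x)).
  rewrite /powR !gt_eqF// -expRD; congr expR.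
  by rewrite ln_div ?posrE//; ring.
rewrite opprD powRD; last by rewrite (gt_eqF y0) implybT.
rewrite powR_inv1 ?(ltW y0)// (_ : _ - _ =
  y `^ (- kappa) * (expR (kappa * ln (y / x)) - 1)); last by ring.
rewrite (_ : _ * _ = y `^ (- kappa) * (kappa * y^-1)); last by ring.
rewrite ler_pM2l ?powR_gt0//.
rewrite lerBrDl; apply: le_trans (expR_ge1Dx _); rewrite lerD2l ler_pM2l//.
have -> : ln (y / x) = - ln (1 + (- y^-1)).
  rewrite -lnV ?posrE; last by rewrite subr_gt0 invf_lt1// yx ltrDr.
  congr ln; rewrite yx; field; apply/andP; split; apply/eqP; nra.
rewrite lerNr; apply: le_ln1Dx.
by rewrite ltrN2 invf_lt1// yx ltrDr.
Qed.

Lemma series_powR_bound (kappa : R) (n : nat) : 0 < kappa ->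
  \sum_(1 <= i < n.+1) i%:R `^ (- (1 + kappa)) <= 1 + kappa^-1.
Proof.
move=> k0.
suff H : forall m : nat, \sum_(1 <= i < m.+2) i%:R `^ (- (1 + kappa)) <=
    1 + kappa^-1 * (1 - m.+1%:R `^ (- kappa)).
  case: n => [|n]; first by rewrite big_nil addr_ge0// invr_ge0 ltW.
  by apply: le_trans (H n) _; rewrite lerD2l ler_piMr ?invr_ge0 ?(ltW k0)//.
elim=> [|m IH].
  by rewrite big_nat1 !powR1 subrr mulr0 addr0.
rewrite big_nat_recr//=; apply: le_trans (lerD IH (lexx _)) _.
have := @powR_telescope kappa m.+1 k0 isT.
rewrite -(ler_pM2l (_ : 0 < kappa^-1)) ?invr_gt0// mulKf ?gt_eqF//.
by lra.
Qed.

Lemma borel_cantelli_powR (F : nat -> set T) (C kappa : R) (N : nat) :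
  0 < kappa -> 0 <= C -> (forall i, (N <= i)%N -> measurable (F i)) ->
  (forall i, (N <= i)%N -> (P (F i) <= (C * i%:R `^ (- (1 + kappa)))%:E)%E) ->
  {ae P, forall w, exists M, forall i, (M <= i)%N -> ~ F i w}.
Proof.
move=> k0 C0 mF hF.
(* Emptying the initial sets makes measurability and the bound available at every index without
   changing the upper limit set. *)
pose F' i := if (N < i)%N then F i else set0.
have mF' i : measurable (F' i) by rewrite /F'; case: ifPn => // Ni; exact/mF/ltnW.
have hF' i : (P (F' i) <= ((0 < i)%:R * (C * i%:R `^ (- (1 + kappa))))%:E)%E.
  rewrite /F'; case: ifPn => Ni.
    by rewrite (leq_ltn_trans (leq0n _) Ni) mul1r; apply: hF; exact: ltnW.
  by rewrite measure0 lee_fin mulr_ge0 ?mulr_ge0 ?powR_ge0.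
have sF : (\sum_(i <oo) P (F' i) < +oo)%E.
  apply: le_lt_trans (ltry (C * (1 + kappa^-1))).
  apply: lime_le; first exact: is_cvg_nneseries.
  apply: nearW => n; apply: le_trans (lee_sum _ (fun i _ => hF' i)) _.
  rewrite sumEFin lee_fin.
  apply: le_trans (_ : \sum_(0 <= i < n.+1) (0 < i)%:R * (C * i%:R `^ (- (1 + kappa))) <= _).
    rewrite big_nat_recr//= lerDl mulr_ge0// mulr_ge0// powR_ge0//.
  rewrite big_ltn// mul0r add0r.
  apply: le_trans (_ : C * \sum_(1 <= i < n.+1) i%:R `^ (- (1 + kappa)) <= _).
    rewrite mulr_sumr; apply: ler_sum_nat => i /andP[i1 _].
    by rewrite i1 mul1r.
  by rewrite ler_wpM2l// series_powR_bound.
have mL : measurable (lim_sup_set F').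
  apply: bigcap_measurableType => n _; apply: bigcup_measurable => k _; exact: mF'.
have L0 : P (lim_sup_set F') = 0%E by exact: lim_sup_set_cvg0.
apply: (@negligibleS _ _ _ _ (lim_sup_set F')); last exact/negligibleP.
move=> w /= H n _; apply: contrapT => Hn; apply: H.
exists (maxn n N.+1) => i; rewrite geq_max => /andP[ni Ni] Fi; apply: Hn.
by exists i => //; rewrite /F' Ni.
Qed.

(** A finitary second Borel-Cantelli lemma: on a finite list, the probability that no event occurs
    is the product of the 1 - P(E i), at most exp(- sum of P(E i)), which can be made arbitrarily
    small. *)
Lemma borel_cantelli_indep (Q : nat -> Prop) (E : nat -> set T) :
  (forall i, Q i -> measurable (E i)) ->
  (forall (N : nat) (C : R), exists s : seq nat,
    [/\ forall i, i \in s -> (N <= i)%N /\ Q i,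
        P (\bigcap_(i in [set` s]) ~` E i) = (\prod_(i <- s) P (~` E i))%E &
        (C%:E <= \sum_(i <- s) P (E i))%E]) ->
  {ae P, forall w, forall N, exists i, [/\ (N <= i)%N, Q i & E i w]}.
Proof.
move=> mE H; apply: ae_foralln => N.
pose A := \bigcap_(i in [set i | (N <= i)%N /\ Q i]) ~` E i.
have mA : measurable A.
  by apply: bigcap_measurableType => i [_ Qi]; exact/measurableC/mE.
have PA : P A = 0%E.
  apply/eqP; rewrite eq_le measure_ge0 andbT.
  apply/lee_addgt0Pr => e e0; rewrite add0e.
  (* The sum is made at least -ln e so that the exponential bound is e. *)
  have [s [sQ sI sC]] := H N (- ln e).
  have mB : measurable (\bigcap_(i in [set` s]) ~` E i).
    rewrite bigcap_seq; elim: s sQ {sI sC} => [|i s IH] sQ.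
      by rewrite big_nil.
    rewrite big_cons; apply: measurableI.
      by apply/measurableC/mE; apply: (sQ i _).2; exact: mem_head.
    by apply: IH => k ks; apply: sQ; rewrite inE ks orbT.
  apply: le_trans (_ : P (\bigcap_(i in [set` s]) ~` E i) <= _)%E.
    apply: le_measure; rewrite ?inE// => w Aw i /= /sQ is_; exact: Aw.
  rewrite sI.
  have pE i : i \in s -> P (E i) = (fine (P (E i)))%:E.
    by move=> /sQ[_ Qi]; rewrite fineK// fin_num_measure//; exact: mE.
  have -> : (\prod_(i <- s) P (~` E i))%E = (\prod_(i <- s) (1 - fine (P (E i))))%:E.
    rewrite -prodEFin; apply: eq_big_seq => i is_.
    rewrite probability_setC; last by apply: mE; exact: (sQ i is_).2.
    by rewrite (pE i is_).
  rewrite lee_fin.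
  have {}sC : - ln e <= \sum_(i <- s) fine (P (E i)).
    rewrite -lee_fin -sumEFin; apply: le_trans sC _.
    by rewrite le_eqVlt; apply/orP; left; apply/eqP/eq_big_seq => i /pE.
  rewrite -[leRHS]lnK ?posrE//.
  apply: le_trans (_ : expR (- \sum_(i <- s) fine (P (E i))) <= _).
    rewrite -sumrN expR_sum big_seq_cond [leRHS]big_seq_cond.
    apply: ler_prod => i; rewrite andbT => is_.
    rewrite expR_ge1Dx andbT subr_ge0 -lee_fin -(pE i is_).
    by apply: probability_le1; apply: mE; exact: (sQ i is_).2.
  by rewrite ler_expR lerNl.
apply: (@negligibleS _ _ _ _ A).
  move=> w /= Hw i [Ni Qi] Ei; apply: Hw; exists i; split => //.
exact/negligibleP.
Qed.

End borel_cantelli.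

(** * Divisor bounds and lattice point counts *)

Section divisor_bound.
Context {R : realType}.

Lemma size_divisors_part (p m : nat) : prime p -> (0 < m)%N ->
  (size (divisors m) <= (logn p m).+1 * size (divisors m`_p^'))%N.
Proof.
move=> pp m0.
have -> : ((logn p m).+1 * size (divisors m`_p^') =
    size [seq (p ^ i * e)%N | i <- iota 0 (logn p m).+1, e <- divisors m`_p^'])%N.
  by rewrite size_allpairs size_iota.
apply: uniq_leq_size; first exact: divisors_uniq.
move=> x; rewrite -dvdn_divisors// => xm.
have x0 : (0 < x)%N by exact: dvdn_gt0 xm.
apply/allpairsP; exists (logn p x, x`_p^')%N; split.
- by rewrite mem_iota /= add0n ltnS; exact: dvdn_leq_log.
- by rewrite -dvdn_divisors ?part_gt0//; exact: partn_dvd.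
- by rewrite /= -p_part partnC.
Qed.

Lemma expn_natr_powR (p a : nat) (eta : R) :
  ((p ^ a)%:R : R) `^ eta = p%:R `^ (a%:R * eta).
Proof. by rewrite natrX -powR_mulrn// -powRrM. Qed.

(** The number of divisors is the product of the a + 1 over the prime powers p^a of m, to be
    compared with the product of the p^(a eta). Only the boundedly many primes below [P0] can have a
    + 1 > p^(a eta), and each of them costs at most a factor [K]. *)
Lemma size_divisors_le (eta : R) : 0 < eta ->
  exists2 C : R, 0 < C &
    forall m : nat, (0 < m)%N -> (size (divisors m))%:R <= C * m%:R `^ eta.
Proof.
move=> e0.
have l2 : (0 : R) < ln 2 by apply: ln_gt0; lra.
(* Chosen so that K 2^(a eta) >= K (1 + a eta ln 2) >= 1 + a for every a. *)
pose K : R := Num.max 1 (eta * ln 2)^-1.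
have K1 : 1 <= K by rewrite le_max lexx.
have K0 : 0 < K by lra.
have eK : 1 <= K * (eta * ln 2).
  rewrite -ler_pdivrMr ?mulr_gt0// mul1r.
  by rewrite /K le_max lexx orbT.
have two_a (a : nat) : a%:R + 1 <= K * 2 `^ (a%:R * eta).
  have -> : 2 `^ (a%:R * eta) = expR (a%:R * eta * ln 2) :> R.
    by rewrite /powR gt_eqF.
  apply: le_trans (_ : K * (1 + a%:R * eta * ln 2) <= _).
    rewrite mulrDr mulr1 addrC lerD//.
    have : a%:R * 1 <= a%:R * (K * (eta * ln 2)) by rewrite ler_wpM2l.
    by lra.
  by rewrite ler_pM2l// expR_ge1Dx.
(* For p >= 2^(1/eta) one has p^(a eta) >= 2^a >= a + 1, with no constant. *)
pose P0 := (Num.truncn ((2 : R) `^ eta^-1)).+1.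
have big_p (p a : nat) : (P0 <= p)%N -> a%:R + 1 <= (p%:R : R) `^ (a%:R * eta).
  move=> Pp.
  have h : (2 : R) `^ eta^-1 <= p%:R.
    by apply: le_trans (ltW (truncnS_gt _)) _; rewrite ler_nat.
  apply: le_trans (_ : (2 `^ eta^-1) `^ (a%:R * eta) <= _); last first.
    apply: ge0_ler_powR; rewrite ?nnegrE ?powR_ge0//.
    by rewrite mulr_ge0// ltW.
  rewrite -powRrM mulrCA mulVf ?mulr1 ?gt_eqF// powR_mulrn//.
  by rewrite natr1 -natrX ler_nat ltn_expl.
exists (K ^+ P0) => [|m m0]; first by rewrite exprn_gt0.
(* The induction strips the full power of the smallest prime p and raises the lower bound [t] to p +
   1; [P0 - t] bounds the number of cheap primes still to be paid for. *)
suff H : forall m t, (0 < m)%N -> (forall p, p \in primes m -> (t <= p)%N) ->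
    (size (divisors m))%:R <= K ^+ (P0 - t) * m%:R `^ eta.
  by have := H m 0%N m0; rewrite subn0; exact.
move=> {m m0} m; have [n] := ubnP m; elim: n m => // n IH m mn t m0 mt.
have [->|m1] := eqVneq m 1%N.
  by rewrite /= powR1 mulr1 exprn_ege1.
have {m1}m1 : (1 < m)%N by lia.
pose p := pdiv m; have pp : prime p by exact: pdiv_prime.
have pm : (p %| m)%N by exact: pdiv_dvd.
pose a := logn p m.
have a0 : (0 < a)%N by rewrite logn_gt0 mem_primes pp m0.
pose m' := (m`_p^')%N.
have mE : m = (p ^ a * m')%N by rewrite /m' -p_part partnC.
have m'0 : (0 < m')%N by exact: part_gt0.
have tp : (t <= p)%N by apply: mt; rewrite mem_primes pp m0.
have lt : (m' < n)%N.
  have : (p ^ 1 <= p ^ a)%N by rewrite leq_exp2l// prime_gt1.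
  have := prime_gt1 pp; rewrite expn1 => h1 h2.
  have : (1 * m' < p ^ a * m')%N by rewrite ltn_pmul2r//; lia.
  by rewrite mul1n -mE; lia.
have /(IH _ lt p.+1 m'0) {}IH : forall r, r \in primes m' -> (p < r)%N.
  move=> r; rewrite mem_primes => /and3P[pr _ rm].
  rewrite ltn_neqAle; apply/andP; split; last first.
    apply: pdiv_min_dvd; first exact: prime_gt1.
    by rewrite mE dvdn_mull.
  apply/eqP => E; have /pnatP := part_pnat (p^')%N m.
  by move=> /(_ m'0) /(_ r pr rm); rewrite !inE E eqxx.
have st : (size (divisors m))%:R <= (a%:R + 1) * (size (divisors m'))%:R :> R.
  by rewrite natr1 -natrM ler_nat; exact: size_divisors_part.
apply: le_trans st _.
have mpow : m%:R `^ eta = p%:R `^ (a%:R * eta) * m'%:R `^ eta :> R.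
  by rewrite {1}mE natrM powRM// expn_natr_powR.
have Kp : (a%:R + 1) * K ^+ (P0 - p.+1) <= K ^+ (P0 - t) * p%:R `^ (a%:R * eta).
  have [pP|Pp] := ltnP p P0.
    apply: le_trans (_ : K ^+ (P0 - p) * p%:R `^ (a%:R * eta) <= _); last first.
      by rewrite ler_wpM2r ?powR_ge0// ler_weXn2l// leq_sub2l.
    have -> : (P0 - p = (P0 - p.+1).+1)%N by lia.
    rewrite exprSr -mulrA mulrC ler_pM2l ?exprn_gt0//.
    apply: le_trans (two_a a) _; rewrite ler_pM2l//.
    apply: ge0_ler_powR; rewrite ?nnegrE ?mulr_ge0 ?(ltW e0)//.
    by rewrite ler_nat prime_gt1.
  have -> : (P0 - p.+1 = 0)%N by lia.
  rewrite expr0 mulr1; apply: le_trans (big_p _ a Pp) _.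
  by rewrite ler_peMl ?powR_ge0// exprn_ege1.
apply: le_trans (_ : (a%:R + 1) * (K ^+ (P0 - p.+1) * m'%:R `^ eta) <= _).
  by rewrite ler_wpM2l// addr_ge0.
by rewrite mpow !mulrA ler_wpM2r ?powR_ge0.
Qed.

Definition factorizations (d m : nat) : {set {ffun 'I_d -> 'I_m.+1}} :=
  [set n : {ffun 'I_d -> 'I_m.+1} | (\prod_(i < d) n i)%N == m].

Lemma card_factorizations_le (d : nat) (eta : R) : 0 < eta ->
  exists2 C : R, 0 < C &
    forall m : nat, (0 < m)%N -> #|factorizations d m|%:R <= C * m%:R `^ eta.
Proof.
(* Each factor divides m, so the count is at most the d-th power of the number of divisors. The
   exponent is divided by [d.+1] because d may be 0. *)
move=> e0; have d0 : (0 : R) < d.+1%:R by [].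
have [C C0 HC] := @size_divisors_le (eta / d.+1%:R) (divr_gt0 e0 d0).
exists (C ^+ d) => [|m m0]; first by rewrite exprn_gt0.
pose D := [pred x : 'I_m.+1 | (x %| m)%N].
have cD : (#|D| <= size (divisors m))%N.
  rewrite cardE -(size_map (val : 'I_m.+1 -> nat)); apply: uniq_leq_size.
    by rewrite map_inj_uniq ?enum_uniq//; exact: val_inj.
  move=> y /mapP[x]; rewrite mem_enum => xD ->.
  by rewrite -dvdn_divisors.
have cF : (#|factorizations d m| <= (size (divisors m)) ^ d)%N.
  apply: leq_trans (_ : #|ffun_on D : pred {ffun 'I_d -> 'I_m.+1}| <= _)%N.
    apply: subset_leq_card; apply/fintype.subsetP => n; rewrite inE => /eqP nm.
    apply/ffun_onP => i; rewrite inE.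
    suff : (n i %| \prod_(k < d) n k)%N by rewrite nm.
    by rewrite (bigD1 i)//= dvdn_mulr.
  rewrite card_ffun_on card_ord; have [->|dpos] := posnP d; first by rewrite !expn0.
  by rewrite leq_exp2r.
apply: le_trans (_ : (size (divisors m) ^ d)%:R <= _); first by rewrite ler_nat.
rewrite natrX; have m1 : (1 : R) <= m%:R by rewrite ler1n.
apply: le_trans (_ : (C * m%:R `^ (eta / d.+1%:R)) ^+ d <= _).
  by rewrite lerXn2r ?nnegrE ?mulr_ge0 ?powR_ge0 ?(ltW C0)// HC.
rewrite exprMn ler_pM2l ?exprn_gt0// -[X in X <= _]powR_mulrn ?powR_ge0// -powRrM.
apply: ler_powR => //; rewrite mulrAC ler_pdivrMr// ler_pM2l// ler_nat.
exact: leqnSn.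
Qed.

End divisor_bound.

Section lattice_count.
Context {R : realType}.

Lemma harmonic_le_ln (X : nat) : (0 < X)%N ->
  \sum_(a < X) (a.+1%:R)^-1 <= 1 + ln X%:R :> R.
Proof.
elim: X => [//|X IH] _; have [->|X0] := posnP X.
  by rewrite big_ord_recl big_ord0 ln1 invr1.
rewrite big_ord_recr /=; apply: le_trans (lerD (IH X0) (lexx _)) _.
rewrite -addrA lerD2l -lerBrDl.
have x0 : (0 : R) < X%:R by rewrite ltr0n.
have y0 : (0 : R) < X.+1%:R by rewrite ltr0n.
rewrite -ln_div ?posrE//.
have -> : X.+1%:R / X%:R = (1 + - X.+1%:R^-1)^-1 :> R.
  rewrite -natr1 in y0 *; field; apply/andP; split; apply/eqP; lra.

have h : X.+1%:R^-1 < 1 :> R by rewrite invf_lt1// ltr1n.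
rewrite lnV ?posrE ?subr_gt0//.
by rewrite lerNr; apply: le_ln1Dx; rewrite ltrN2.
Qed.

Definition lattice_points (d X : nat) : {set {ffun 'I_d -> 'I_X.+1}} :=
  [set j : {ffun 'I_d -> 'I_X.+1} |
    [forall i, (0 < j i)%N] && (\prod_(i < d) j i <= X)%N].

(* Once the last [e] coordinates are fixed, at most X / (their product) values of
   the first one remain; this keeps the power of the logarithm at [e]. *)
Lemma card_lattice_points_le (e X : nat) : (0 < X)%N ->
  #|lattice_points e.+1 X|%:R <= X%:R * (1 + ln X%:R) ^+ e :> R.
Proof.
move=> X0.
pose p (j : {ffun 'I_e.+1 -> 'I_X.+1}) : {ffun 'I_e -> 'I_X.+1} :=
  [ffun i => j (lift ord0 i)].
pose Q := [pred k : {ffun 'I_e -> 'I_X.+1} | [forall i, (0 < k i)%N]].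
have Qp j : j \in lattice_points e.+1 X -> Q (p j).
  rewrite inE => /andP[/forallP h _]; apply/forallP => i; rewrite ffunE; exact: h.
rewrite -sum1_card (partition_big p Q)//= natr_sum.
have fiber k : Q k -> (\sum_(j in lattice_points e.+1 X | p j == k) 1)%:R <=
    X%:R * \prod_(i < e) (k i)%:R^-1 :> R.
  move=> /forallP Qk.
  pose D := (\prod_(i < e) k i)%N.
  have D0 : (0 < D)%N by apply: prodn_gt0.
  have h : (\sum_(j in lattice_points e.+1 X | p j == k) 1 <= X %/ D)%N.
    rewrite sum1dep_card.
    pose F := [set j in lattice_points e.+1 X | p j == k].
    pose f (j : {ffun 'I_e.+1 -> 'I_X.+1}) : nat := j ord0.
    have injf : {in F &, injective f}.
      move=> j j'; rewrite !inE => /andP[_ /eqP jk] /andP[_ /eqP jk'] ff.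
      apply/ffunP => i; case: (unliftP ord0 i) => [i' ->|->]; last exact: val_inj.
      by have := congr1 (fun g : {ffun _ -> _} => g i') (etrans jk (esym jk')); rewrite !ffunE.
    rewrite -(size_iota 1 (X %/ D)).
    apply: leq_trans (_ : size (map f (enum F)) <= _)%N.
      by rewrite size_map -cardE.
    apply: uniq_leq_size.
      rewrite map_inj_in_uniq ?enum_uniq// => j j'; rewrite !mem_enum; exact: injf.
    move=> y /mapP[j]; rewrite mem_enum !inE => /andP[/andP[/forallP j0 jX] /eqP jk] ->.
    rewrite mem_iota j0/= add1n ltnS leq_divRL//.
    apply: leq_trans jX; rewrite big_ord_recl leq_mul2l; apply/orP; right.
    by rewrite /D -jk; apply: eq_leq; apply: eq_bigr => i _; rewrite ffunE.
  apply: le_trans (_ : (X %/ D)%:R <= _); first by rewrite ler_nat.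
  have DR : (0 : R) < D%:R by rewrite ltr0n.
  rewrite prodfV -natr_prod -/D ler_pdivlMr// -natrM ler_nat.
  exact: leq_divM.
apply: le_trans (ler_sum _ fiber) _.
rewrite -mulr_sumr ler_pM2l ?ltr0n//.
pose h (a : 'I_X.+1) : R := a%:R^-1.
apply: le_trans (_ : \prod_(i < e) \sum_(a : 'I_X.+1 | (0 < a)%N) h a <= _).
  rewrite bigA_distr_big /= le_eqVlt; apply/orP; left; apply/eqP.
  apply: eq_bigl => k; rewrite inE; apply/forallP/ffun_onP => H i; exact: H.
rewrite prodr_const card_ord lerXn2r ?nnegrE//.
- by apply: sumr_ge0 => a _; rewrite invr_ge0.
- by rewrite addr_ge0// ln_ge0// ler1n.
rewrite big_mkcond big_ord_recl /= add0r; apply: le_trans (harmonic_le_ln X0).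
by apply: ler_sum => a _; rewrite /h lift0.
Qed.

End lattice_count.

(** * Divisibility of integer parts of powers *)

Section finite_differences.
Context {R : realType}.

Definition fdiff (g : R -> R) : R -> R := fun x => g (x + 1) - g x.

Lemma iter_fdiffS n (g : R -> R) x :
  iter n.+1 fdiff g x = iter n fdiff g (x + 1) - iter n fdiff g x.
Proof. by []. Qed.

Lemma iter_fdiffZ n (c : R) (g : R -> R) x :
  iter n fdiff (fun y => c * g y) x = c * iter n fdiff g x.
Proof. by elim: n x => [//|n IH] x; rewrite !iter_fdiffS !IH mulrBr. Qed.

Lemma is_derive_translate (g : R -> R) (x d : R) :
  is_derive (x + 1) 1 g d -> is_derive x 1 (fun y => g (y + 1)) d.
Proof.
move=> H.
have H1 : is_derive x 1 (fun y : R => y + 1) 1 by exact: is_derive_shift.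
by have := @is_derive1_comp _ g (fun y : R => y + 1) x _ _ H H1; rewrite mulr1.
Qed.

Lemma is_derive_iter_fdiff_powR n (gam x : R) : 0 < x ->
  is_derive x 1 (iter n fdiff (@powR R ^~ gam)) (gam * iter n fdiff (@powR R ^~ (gam - 1)) x).
Proof.
elim: n x => [|n IH] x x0; first exact: is_derive1_powR.
rewrite iter_fdiffS mulrBr.
apply: is_deriveB; last exact: IH.
by apply: is_derive_translate; apply: IH; rewrite addr_gt0.
Qed.

(** Differencing commutes with differentiation, so each use of the mean value theorem trades one
    difference for a factor of the falling factorial and a unit of the exponent. *)
Lemma iter_fdiff_powR n (gam x : R) : 0 < x ->
  exists2 xi, x <= xi <= x + n%:R &
    iter n fdiff (@powR R ^~ gam) x = (\prod_(j < n) (gam - j%:R)) * xi `^ (gam - n%:R).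
Proof.
elim: n gam x => [|n IH] gam x x0.
  by exists x; rewrite ?addr0 ?lexx// big_ord0 mul1r subr0.
rewrite iter_fdiffS.
have [|||c] := @MVT _ (iter n fdiff (@powR R ^~ gam))
  (fun y => gam * iter n fdiff (@powR R ^~ (gam - 1)) y) x (x + 1).
- by rewrite ltrDl.
- by move=> y; rewrite in_itv/= => /andP[xy _]; apply: is_derive_iter_fdiff_powR; exact: lt_trans xy.
- apply: derivable_within_continuous => y; rewrite in_itv/= => /andP[xy _].
  by have [] := @is_derive_iter_fdiff_powR n gam y (lt_le_trans x0 xy).
rewrite in_itv/= => /andP[xc cx1] ->.
have [xi /andP[cxi xic] ->] := IH (gam - 1) c (lt_trans x0 xc).
exists xi.
  rewrite (le_trans (ltW xc) cxi)/=; apply: le_trans xic _.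
  by rewrite -natr1; lra.
rewrite big_ord_recl /= subr0 [x + 1]addrC addrK mulr1 mulrA; congr (_ * _ * _).
  by apply: eq_bigr => j _; rewrite /= /bump /= add1n -natr1; lra.
by congr (_ `^ _); rewrite -natr1; lra.
Qed.

End finite_differences.

Lemma powR_unbounded {R : realType} (kappa K : R) : 0 < kappa ->
  exists N0 : nat, forall N : nat, (N0 <= N)%N -> K <= N%:R `^ kappa.
Proof.
move=> k0; pose B : R := Num.max 1 K; have B0 : 0 < B by rewrite lt_max ltr01.
exists (Num.truncn (B `^ kappa^-1)).+1 => N HN.
apply: le_trans (_ : B <= _); first by rewrite le_max lexx orbT.
have -> : B = (B `^ kappa^-1) `^ kappa.
  by rewrite -powRrM mulVf ?lt0r_neq0// powRr1 ?ltW.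
apply: ge0_ler_powR; rewrite ?nnegrE ?powR_ge0 ?(ltW k0)//.
by apply: le_trans (ltW (truncnS_gt _)) _; rewrite ler_nat.
Qed.

Section hitting.
Context {R : realType}.
Implicit Types (u v w : nat -> R).

Definition frac (x : R) : R := x - (Num.floor x)%:~R.

Lemma frac_eq (x : R) (z : int) : z%:~R <= x < z%:~R + 1 -> frac x = x - z%:~R.
Proof.
move=> h; rewrite /frac; congr (_ - _%:~R); apply: floor_def.
by rewrite intrD.
Qed.

Lemma frac_int (x : R) (z : int) : frac (x - z%:~R) = frac x.
Proof.
rewrite (@frac_eq _ (Num.floor x - z)) ?intrB /frac; first by ring.
have /andP[h1 h2] := floor_itv x; rewrite intrD in h2.
by apply/andP; split; lra.
Qed.

(* [v] creeps upwards, hence crosses the window [eps/2, eps] modulo 1 slowly. *)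
Lemma drift v (s L : nat) (a b eps : R) : 0 < a -> a <= b -> b <= eps / 4 ->
  0 < eps <= 1 / 2 -> 2 <= L%:R * a ->
  (forall i, (s <= i < s + L)%N -> a <= v i.+1 - v i <= b) ->
  exists t r : nat, [/\ (s <= t)%N, (t + r <= s + L)%N, eps / 4 <= b * r.+1%:R &
    forall i, (t <= i <= t + r)%N -> eps / 2 <= frac (v i) <= eps].
Proof.
move=> a0 ab be /andP[e0 e1] La Hv.
have b0 : 0 < b by lra.
have lo t j : (s <= t)%N -> (t + j <= s + L)%N -> v t + j%:R * a <= v (t + j)%N.
  move=> st; elim: j => [|j IH] H; first by rewrite addn0; lra.
  have H1 : (t + j <= s + L)%N by natlia.
  have /andP[h _] : a <= v (t + j).+1 - v (t + j)%N <= b by apply: Hv; natlia.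
  by have := IH H1; rewrite addnS -natr1; lra.
have up t j : (s <= t)%N -> (t + j <= s + L)%N -> v (t + j)%N <= v t + j%:R * b.
  move=> st; elim: j => [|j IH] H; first by rewrite addn0; lra.
  have H1 : (t + j <= s + L)%N by natlia.
  have /andP[_ h] : a <= v (t + j).+1 - v (t + j)%N <= b by apply: Hv; natlia.
  by have := IH H1; rewrite addnS -natr1; lra.
(* The first integer above v(s). The total rise, at least L a >= 2, carries v past z + 1, hence
   across the window above z. *)
pose z := Num.floor (v s) + 1.
have /andP[z1 z2] : v s < z%:~R <= v s + 1.
  have /andP[h1 h2] := floor_itv (v s); rewrite /z; rewrite !intrD in h2 *.
  by apply/andP; split; lra.
have vL : z%:~R + 1 <= v (s + L)%N.
  by have := lo s L (leqnn _) (leqnn _); lra.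
have exP : exists i, (s <= i)%N && (z%:~R + eps / 2 <= v i).
  by exists (s + L)%N; rewrite leq_addr/=; lra.
case: (ex_minnP exP) => t /andP[st vt] tmin.
have tL : (t <= s + L)%N.
  by apply: tmin; rewrite leq_addr/=; lra.
have ts : (s < t)%N.
  by rewrite ltn_neqAle st andbT; apply/eqP => E; move: vt; rewrite -E; lra.
have vt' : v t <= z%:~R + eps / 2 + b.
  have h1 : v t.-1 < z%:~R + eps / 2.
    rewrite ltNge; apply/negP => h; have := tmin t.-1.
    by rewrite h andbT => /(_ _); natlia.
  have /andP[_] : a <= v t.-1.+1 - v t.-1 <= b by apply: Hv; natlia.
  by rewrite prednK; [lra|natlia].
(* The largest r with (r + 1) b <= eps/2. Entering the window overshoots by at most b and r further
   steps add at most r b, so v stays below z + eps. *)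
pose r := (Num.truncn (eps / 2 / b)).-1.
have q2 : 2 <= eps / 2 / b by rewrite ler_pdivlMr//; lra.
have rb : r.+1%:R * b <= eps / 2 < r.+2%:R * b.
  have q0 : 0 <= eps / 2 / b by lra.
  have /andP[h1 h2] := truncn_itv q0.
  have r1 : (Num.truncn (eps / 2 / b)) = r.+1.
    by rewrite /r prednK// truncn_gt0; lra.
  by rewrite -ler_pdivlMr// -ltr_pdivrMr// -r1 h1.
have /andP[rb1 rb2] := rb.
have rL : (t + r <= s + L)%N.
  rewrite leqNgt; apply/negP => H.
  pose j := (s + L - t)%N; have jE : (t + j)%N = (s + L)%N by rewrite /j; natlia.
  have jr : (j <= r)%N by rewrite /j; natlia.
  have := up t j st; rewrite jE => /(_ (leqnn _)).
  have : j%:R * b <= r%:R * b by rewrite ler_pM2r// ler_nat.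
  by move: rb1; rewrite -natr1; lra.
exists t, r; split => //.
  by move: rb2; rewrite -natr1; lra.
move=> i /andP[ti ir]; pose j := (i - t)%N.
have iE : i = (t + j)%N by rewrite /j; natlia.
have jr : (j <= r)%N by rewrite /j; natlia.
have tj : (t + j <= s + L)%N by natlia.
have h1 : v t <= v i.
  have : 0 <= j%:R * a by rewrite mulr_ge0// ltW.
  by have := lo t j st tj; rewrite -iE; lra.
have h2 : v i <= z%:~R + eps.
  have := up t j st tj; rewrite -iE.
  have : j%:R * b <= r%:R * b by rewrite ler_pM2r// ler_nat.
  by move: rb1; rewrite -natr1; lra.
rewrite (@frac_eq _ z); last by apply/andP; split; lra.
by apply/andP; split; lra.
Qed.

Definition sdiff u : nat -> R := fun i => u i.+1 - u i.

(* When the difference of order [l + 1] is small and positive modulo 1, the one of order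
   [l] creeps upwards, and [drift] supplies the run that the induction needs. *)
Lemma descent (l : nat) (eps : R) : 0 < eps <= 1 / 2 ->
  exists delta : R, exists L : nat, 0 < delta <= 1 / 2 /\
    forall u (s : nat),
      (forall i, (s <= i < s + L)%N -> delta / 2 <= frac (iter l sdiff u i) <= delta) ->
      exists2 i, (s <= i <= s + L)%N & eps / 2 <= frac (u i) <= eps.
Proof.
move=> he; elim: l => [|l [delta [L [/andP[d0 d1] IH]]]].
  exists eps, 1%N; split => // u s H; exists s; first by natlia.
  by apply: H; natlia.
(* With upper increment bound [delta'], [drift] gives a run with delta/4 <= delta' (r + 1), that is
   r >= L, the length required at order [l]. *)
pose delta' : R := delta / (4 * L.+1%:R).
have L0 : (1 : R) <= L.+1%:R by rewrite ler1n.
have d'0 : 0 < delta' by rewrite /delta' divr_gt0// mulr_gt0//; lra.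
have d'E : delta' * L.+1%:R = delta / 4 by rewrite /delta'; field; lra.
have d'1 : delta' <= delta / 4.
  by rewrite -d'E ler_peMr// ltW.
pose L1 := (Num.truncn (4 / delta')).+1.
exists delta', L1.+1; split; first by apply/andP; split; lra.
move=> u s H.
set w := iter l sdiff u.
(* Subtracting integers leaves fractional parts unchanged and turns the increments of w, known only
   modulo 1, into their small positive representatives. *)
pose v i := w i - (\sum_(s <= k < i) Num.floor (sdiff w k))%:~R.
have vinc i : (s <= i)%N -> v i.+1 - v i = frac (sdiff w i).
  by move=> si; rewrite /v big_nat_recr//= intrD /frac /sdiff; ring.
have fv i : frac (v i) = frac (w i) by rewrite /v frac_int.
have [||||||t [r [st tr rb Hr]]] := @drift v s L1 (delta' / 2) delta' delta.
- by lra.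
- by lra.
- by [].
- by rewrite d0.
- have : 4 / delta' < L1%:R by rewrite /L1 truncnS_gt.
  by rewrite ltr_pdivrMr//; lra.
- move=> i /andP[si iL]; rewrite vinc//.
  by have := H i; rewrite iterS -/w; apply; natlia.
have Lr : (L <= r)%N.
  rewrite -ltnS -(ler_nat R) -(ler_pM2l d'0).
  by rewrite d'E.
have [|i /andP[ti iL] Hi] := IH u t.
- move=> i /andP[ti iL]; rewrite -/w -fv.
  by apply: Hr; natlia.
- by exists i => //; natlia.
Qed.

Definition hits (Q : pred nat) (x n : nat) : nat := \sum_(x <= i < x + n) Q i.

Lemma hits_cat (Q : pred nat) x m n : hits Q x (m + n) = (hits Q x m + hits Q (x + m) n)%N.
Proof. by rewrite /hits addnA -big_cat_nat// leq_addr. Qed.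

Lemma hits_mono (Q : pred nat) x m y n : (y <= x)%N -> (x + m <= y + n)%N ->
  (hits Q x m <= hits Q y n)%N.
Proof.
move=> yx xm.
have -> : n = ((x - y) + (m + (y + n - (x + m))))%N by natlia.
rewrite !hits_cat; have -> : (y + (x - y))%N = x by natlia.
natlia.
Qed.

Lemma hits_blocks (Q : pred nat) x M B (h : R) :
  (forall j, (j < B)%N -> h <= (hits Q (x + j * M) M)%:R) ->
  h * B%:R <= (hits Q x (B * M))%:R.
Proof.
elim: B => [|B IH] H; first by rewrite mulr0.
rewrite mulSn addnC hits_cat natrD -natr1 mulrDr mulr1 lerD ?H//.
by apply: IH => j jB; apply: H; natlia.
Qed.

Lemma hits_sub (Q Q' : pred nat) x n : (forall i, Q i -> Q' i) ->
  (hits Q x n <= hits Q' x n)%N.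
Proof. by move=> QQ; apply: leq_sum => i _; case: (boolP (Q i)) => // /QQ ->. Qed.

Lemma hits_gt0 (Q : pred nat) x n i : (x <= i < x + n)%N -> Q i -> (0 < hits Q x n)%N.
Proof.
move=> /andP[xi ixn] Qi.
have := @hits_mono Q i 1 x n xi; rewrite addn1 => /(_ ixn).
by rewrite /hits addn1 big_nat1 Qi.
Qed.

End hitting.

Section hit_frequency.
Context {R : realType}.
Implicit Types (u v w : nat -> R).

(** The quantitative form of [descent]. In each chunk of length about 2/a the difference of order k
    crosses a window modulo 1 and spends about delta/a steps there; cutting this run into blocks of
    length L + 1 gives one hit per block. *)
Lemma hits_frac (k : nat) (eps : R) : 0 < eps <= 1 / 2 ->
  exists C : R, exists c : R, 0 < c /\ 0 < C /\ forall (u : nat -> R) (a : R) (N : nat),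
    0 < a -> a <= c -> C <= a * N%:R ->
    (forall i, (N <= i < N + N)%N -> a <= iter k.+1 sdiff u i <= 3 * a) ->
    c * N%:R <= (hits (fun i => eps / 2 <= frac (u i) <= eps) N N)%:R.
Proof.
move=> he; have [delta [L [/andP[d0 d1] HL]]] := descent k he.
pose L1 : R := L.+1%:R.
have L10 : 1 <= L1 by rewrite ler1n.
(* 144 = 24 * 6: a chunk contains at least delta/(24 L1 a) hits, and at least a N / 6 chunks fit
   into [N, 2N) once a N >= 6. *)
pose c : R := delta / (144 * L1).
have cE : c * L1 = delta / 144 by rewrite /c; field; lra.
have c0 : 0 < c by rewrite divr_gt0// mulr_gt0//; lra.
have c1 : c <= delta / 144 by rewrite -cE ler_peMr// ltW.
exists 6, c; split => //; split => // u a N a0 ac aN Hu.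
set Q := fun i => _.
pose A := (Num.truncn (2 / a)).+1.
have aA : 2 < A%:R * a by rewrite -ltr_pdivrMr// truncnS_gt.
have aA' : A%:R * a <= 2 + a.
  have h : 0 <= 2 / a by rewrite divr_ge0// ltW.
  have /andP[h1 _] := truncn_itv h.
  by rewrite /A -natr1 mulrDl mul1r lerD2r -ler_pdivlMr.
pose M := A.+1.
have aM : M%:R * a <= 3 by rewrite /M -natr1 mulrDl mul1r; lra.
pose B := (N %/ M)%N.
have chunk s : (N <= s)%N -> (s + M <= N + N)%N ->
    exists2 h : nat, delta / (24 * L1) <= h%:R * a & (h <= hits Q s M)%N.
  move=> Ns sM.
  have [||||||t [r [st tr rb Hr]]] := @drift _ (iter k sdiff u) s A a (3 * a) delta => //.
  - by lra.
  - by lra.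
  - by rewrite d0.
  - by rewrite ltW.
  - by move=> i /andP[si iA]; apply: Hu; rewrite /M in sM; natlia.
  exists (r.+1 %/ L.+1)%N; last first.
    apply: leq_trans (_ : hits Q t (r.+1 %/ L.+1 * L.+1) <= _)%N; last first.
      apply: hits_mono => //.
      by have := leq_divM r.+1 L.+1; rewrite /M; natlia.
    rewrite -(ler_nat R) -[leLHS]mul1r; apply: hits_blocks => j jB; rewrite ler1n.
    have jr : ((j.+1) * L.+1 <= r.+1)%N.
      by apply: leq_trans (leq_divM r.+1 L.+1); rewrite leq_mul2r jB orbT.
    have [|i /andP[i1 i2] Hi] := HL u (t + j * L.+1)%N.
      by move=> i /andP[i1 i2]; apply: Hr; rewrite mulSn in jr; natlia.
    by apply: (@hits_gt0 _ _ _ i) => //; natlia.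
  have rL : 2 * L1 <= r.+1%:R.
    have : 24 * L1 * c <= r.+1%:R * a * 12 * 2 by rewrite mulrAC; nra.
    move=> _; rewrite -(ler_pM2r a0).
    have : L1 * a <= L1 * c by rewrite ler_pM2l//; lra.
    by rewrite [L1 * c]mulrC cE; nra.
  have := ltn_ceil r.+1 (ltn0Sn L); rewrite -(ltr_nat R) natrM => h.
  rewrite ler_pdivrMr; last by lra.
  by rewrite -natr1 -/L1 in h *; nra.
pose y : R := delta / (24 * L1) / a.
have tot : y * B%:R <= (hits Q N (B * M))%:R.
  apply: hits_blocks => j jB.
  have jM : ((j.+1) * M <= N)%N.
    by apply: leq_trans (leq_divM N M); rewrite leq_mul2r jB orbT.
  have [||h h1 h2] := chunk (N + j * M)%N; [natlia|by rewrite mulSn in jM; natlia|].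
  apply: le_trans (_ : h%:R <= _); last by rewrite ler_nat.
  by rewrite /y ler_pdivrMr.
have BMN : (hits Q N (B * M) <= hits Q N N)%N.
  by apply: hits_mono => //; rewrite leq_add2l leq_divM.
apply: le_trans (_ : y * B%:R <= _); last by apply: le_trans tot _; rewrite ler_nat.
have := ltn_ceil N (ltn0Sn A); rewrite -(ltr_nat R) natrM -natr1 -/M -/B => NB.
have NaB : N%:R * a <= 6 * B%:R.
  have : 0 <= B%:R * (3 - M%:R * a) by rewrite mulr_ge0//; lra.
  have : N%:R * a <= (B%:R + 1) * M%:R * a by rewrite ler_pM2r// ltW.
  by lra.
have -> : y * B%:R = (delta / (144 * L1)) * (6 * B%:R / a).
  by rewrite /y; field; apply/andP; split; apply/eqP; lra.
by rewrite -/c ler_pM2l// ler_pdivlMr.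
Qed.

End hit_frequency.

Section divisible_floor.
Context {R : realType}.

(* [floor (i ^ gam)] is divisible by [q] when [i ^ gam / q] has fractional part below
   [1 / q]; the difference of order [truncn gam + 1] of [i ^ gam] tends slowly to 0.
   For integer [gam] the multiples of [q] suffice. *)
Lemma floor_powR_divisible (gam : R) (q : nat) : 1 < gam -> (0 < q)%N ->
  exists c : R, exists N0 : nat, 0 < c /\ forall N : nat, (N0 <= N)%N ->
    c * N%:R <= (hits (fun i => (q%:Z %| Num.floor (i%:R `^ gam))%Z) N N)%:R.
Proof.
move=> g1 q0; have q0R : (0 : R) < q%:R by rewrite ltr0n.
have q1R : (1 : R) <= q%:R by rewrite ler1n.
pose k := Num.truncn gam.
have /andP[kg gk] : k%:R <= gam < k.+1%:R by apply: truncn_itv; lra.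
have [gE|gN] := eqVneq gam k%:R.
  exists (q%:R^-1 / 2), (q * 2)%N; split; first by rewrite divr_gt0// invr_gt0.
  move=> N HN.
  have h : (N %/ q)%:R <= (hits (fun i : nat => (q %| `|Num.floor (i%:R `^ gam)|)%N) N N)%:R :> R.
    apply: le_trans (_ : (hits (fun i : nat => (q %| `|Num.floor (i%:R `^ gam)|)%N) N
      (N %/ q * q))%:R <= _); last by rewrite ler_nat hits_mono// leq_add2l leq_divM.
    rewrite -[leLHS]mul1r; apply: hits_blocks => j _; rewrite ler1n.
    (* The multiple of q in the block of length q starting at N + j q. *)
    pose i := (((N + j * q) + q.-1) %/ q * q)%N.
    apply: (@hits_gt0 _ _ _ i).
      have := ltn_ceil (N + j * q + q.-1) q0; have := leq_divM (N + j * q + q.-1) q.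
      by rewrite /i mulSn; natlia.
    have -> : i%:R `^ gam = ((i ^ k)%N%:Z)%:~R :> R.
      by rewrite gE powR_mulrn// -natrX pmulrn.
    rewrite intrKfloor /= dvdn_exp//; last by rewrite dvdn_mull.
    by rewrite /k truncn_gt0 ltW.
  apply: le_trans h.
  have := ltn_ceil N q0; rewrite -(ltr_nat R) natrM -natr1 => h.
  rewrite mulrAC ler_pdivrMr// mulrC ler_pdivrMr//.
  have : (q * 2)%:R <= N%:R :> R by rewrite ler_nat.
  by rewrite natrM; lra.
have kg' : k%:R < gam by rewrite lt_neqAle eq_sym gN.
pose kap : R := k.+1%:R - gam.
have kap0 : 0 < kap by rewrite /kap; lra.
have kap1 : kap < 1 by rewrite /kap -natr1; lra.
(* A fractional part of i^gam / q at most 1/(2q) leaves a remainder at most 1/2 < 1 after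
   multiplication by q, so the integer part of i^gam is exactly a multiple of q. *)
pose eps : R := (2 * q%:R)^-1.
have epsE : eps * (2 * q%:R) = 1 by rewrite /eps mulVf//; lra.
have heps : 0 < eps <= 1 / 2.
  by rewrite invr_gt0 mulr_gt0//= div1r lef_pV2 ?posrE//; lra.
have [C [c [c0 [C0 H]]]] := @hits_frac R k eps heps.
pose cst : R := (\prod_(j < k.+1) (gam - j%:R)) / q%:R.
have cst0 : 0 < cst.
  rewrite divr_gt0// prodr_gt0// => j _; rewrite subr_gt0; apply: le_lt_trans kg'.
  by rewrite ler_nat -ltnS.
have [N1 HN1] := @powR_unbounded R kap (cst / c) kap0.
have kap1' : 0 < 1 - kap by lra.
have [N2 HN2] := @powR_unbounded R (1 - kap) (C * 3 `^ kap / cst) kap1'.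
exists c, (maxn (maxn N1 N2) k.+1); split => // N.
rewrite !geq_max -andbA => /and3P[N1N N2N kN].
have N0 : (0 : R) < N%:R by rewrite ltr0n; exact: leq_ltn_trans (leq0n _) kN.
pose X : R := 3 * N%:R.
have X0 : 0 < X by rewrite mulr_gt0.
(* The difference of order k + 1 is cst xi^(-kap) with N <= xi <= 3N = X. As 3^kap <= 3, it stays
   between a and 3a; moreover a tends to 0 while a N tends to infinity, because 0 < kap < 1. *)
pose a : R := cst * X `^ (- kap).
have a0 : 0 < a by rewrite mulr_gt0// powR_gt0.
apply: le_trans (_ : (hits (fun i => eps / 2 <= frac (i%:R `^ gam / q%:R) <= eps) N N)%:R <= _).
  apply: (H (fun i => i%:R `^ gam / q%:R) a N) => //.
  - rewrite /a powRN ler_pdivrMr ?powR_gt0// mulrC -ler_pdivrMr//.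
    apply: le_trans (HN1 N N1N) _; apply: ge0_ler_powR; rewrite ?nnegrE ?(ltW kap0) ?(ltW X0) ?(ltW N0)//.
    by rewrite /X; lra.
  - have := HN2 N N2N; rewrite ler_pdivrMr// => h.
    have -> : a * N%:R = N%:R `^ (1 - kap) * cst / 3 `^ kap.
      have -> : N%:R `^ (1 - kap) = N%:R / N%:R `^ kap :> R.
        by rewrite powRB ?(gt_eqF N0) ?implybT// powRr1// ltW.
      rewrite /a /X powRN powRM ?(ltW N0)//.
      have n0 : N%:R `^ kap != 0 :> R by rewrite gt_eqF// powR_gt0.
      have t0 : 3 `^ kap != 0 :> R by rewrite gt_eqF// powR_gt0.
      by field; rewrite n0 t0.
    by rewrite ler_pdivlMr// powR_gt0.
  - move=> i /andP[Ni iN].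
    have E : forall n j, iter n sdiff (fun i => i%:R `^ gam / q%:R) j =
        iter n fdiff (fun y => q%:R^-1 * y `^ gam) j%:R :> R.
      elim=> [|n IHn] j; first by rewrite /= mulrC.
      by rewrite iterS /sdiff !IHn iter_fdiffS natr1.
    have i0 : (0 : R) < i%:R by apply: lt_le_trans N0 _; rewrite ler_nat.
    rewrite E iter_fdiffZ.
    have [xi /andP[xi1 xi2] ->] := @iter_fdiff_powR R k.+1 gam i%:R i0.
    rewrite mulrA [q%:R^-1 * _]mulrC -/cst.
    have -> : gam - k.+1%:R = - kap by rewrite /kap; lra.
    have xN : N%:R <= xi by apply: le_trans xi1; rewrite ler_nat.
    have xX : xi <= X.
      have : (i + k.+1)%:R <= (3 * N)%:R :> R by rewrite ler_nat; natlia.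
      by rewrite natrD natrM /X; exact: le_trans.
    have xi0 : 0 < xi by exact: lt_le_trans N0 xN.
    rewrite /a ler_pM2l// [3 * _]mulrCA ler_pM2l// !powRN lef_pV2 ?posrE ?powR_gt0//.
    apply/andP; split.
      by apply: ge0_ler_powR; rewrite ?nnegrE ?(ltW kap0) ?(ltW X0) ?(ltW xi0).
    rewrite -[leRHS]invrK lef_pV2 ?posrE ?powR_gt0 ?invr_gt0 ?mulr_gt0 ?invr_gt0 ?powR_gt0//.
    rewrite invfM invrK /X powRM ?(ltW N0)//.
    have h3 : 3 `^ kap <= 3 :> R by apply: ler1_powR; lra.
    rewrite mulrA; apply: le_trans (_ : N%:R `^ kap <= _).
      by rewrite ler_piMl ?powR_ge0// mulrC ler_pdivrMr; lra.
    by apply: ge0_ler_powR; rewrite ?nnegrE ?(ltW kap0) ?(ltW N0) ?(ltW xi0).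
rewrite ler_nat; apply: hits_sub => i /andP[h1 h2].
pose z := Num.floor (i%:R `^ gam / q%:R).
suff -> : Num.floor (i%:R `^ gam) = q%:Z * z by rewrite dvdz_mulr.
apply: floor_def; rewrite intrD intrM.
have fE : i%:R `^ gam = q%:~R * z%:~R + q%:R * frac (i%:R `^ gam / q%:R).
  by rewrite /frac -/z; field; lra.
have /andP[e0 _] := heps.
have qe : q%:R * eps = 1 / 2 by lra.
have f1 : q%:R * frac (i%:R `^ gam / q%:R) <= 1 / 2 by rewrite -qe ler_pM2l.
have f0 : 0 <= q%:R * frac (i%:R `^ gam / q%:R) by rewrite mulr_ge0//; lra.
by rewrite fE; apply/andP; split; lra.
Qed.

End divisible_floor.

(** * Windows of indices *)

Section windows.
Context {d : nat}.
Implicit Types n k j : idx d.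

(** The summation range of [Tsum] as a duplicate-free list, the form in which independence is
    used. *)
Definition window n k : seq (idx d) :=
  map (fun t : {ffun 'I_d -> 'I_(\max_(i < d) k i).+1} =>
         [ffun i => (n i + t i).+1] : idx d)
    (enum [pred t : {ffun 'I_d -> 'I_(\max_(i < d) k i).+1} | [forall i, (t i < k i)%N]]).

Lemma Tsum_window (R : realType) (T : Type) (X : idx d -> T -> R) n k w :
  Tsum X n k w = \sum_(j <- window n k) X j w.
Proof. by rewrite /Tsum /window big_map big_enum. Qed.

Lemma uniq_window n k : uniq (window n k).
Proof.
rewrite map_inj_uniq ?enum_uniq// => t t' E; apply/ffunP => i; apply/val_inj => /=.
by have := congr1 (fun g : idx d => g i) E; rewrite !ffunE => -[] /addnI.
Qed.

Lemma mem_window n k j :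
  (j \in window n k) = [forall i, (n i < j i <= n i + k i)%N].
Proof.
apply/mapP/forallP.
  move=> [t]; rewrite mem_enum inE => /forallP tk -> i; rewrite ffunE.
  by have := tk i; lia.
move=> H.
have jk i : (j i - (n i).+1 < (\max_(i < d) k i).+1)%N.
  have : (k i <= \max_(i < d) k i)%N by exact: leq_bigmax.
  by have := H i; lia.
exists [ffun i => Ordinal (jk i)].
  rewrite mem_enum inE; apply/forallP => i; rewrite ffunE /=.
  by have := H i; lia.
by apply/ffunP => i; rewrite !ffunE /=; have := H i; lia.
Qed.

Lemma size_window n k : size (window n k) = idx_size k.
Proof.
rewrite size_map -cardE /idx_size.
pose F (i : 'I_d) := [pred x : 'I_(\max_(i < d) k i).+1 | (x < k i)%N].
rewrite (_ : #|_| = #|family F|); last first.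
  by apply: eq_card => t; rewrite [LHS]inE; apply/forallP/familyP => H i; exact: H.
rewrite card_family foldrE big_map big_enum /=; apply: eq_bigr => i _.
have ki : (k i <= (\max_(i < d) k i).+1)%N by apply/leqW; exact: leq_bigmax.
have wi : injective (widen_ord ki).
  by move=> x y /(congr1 val) /= E; apply/val_inj.
rewrite -[RHS]card_ord -[RHS](fintype.card_image wi).
apply: eq_card => x; rewrite [LHS]inE; apply/idP/mapP => [xk|[y _ ->]].
  by exists (Ordinal xk); rewrite ?mem_enum//; exact/val_inj.
exact: (ltn_ord y).
Qed.

Lemma window_pos n k j : j \in window n k -> pos_idx j.
Proof. by rewrite mem_window => /forallP H i; have := H i; lia. Qed.

Lemma window_ge n k j : j \in window n k -> (idx_size n <= idx_size j)%N.
Proof.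
rewrite mem_window => /forallP H; apply: leq_prod => i _.
by have := H i; lia.
Qed.

(** Together with [window_ge] this makes the sizes in a window comparable with |n|, so a bound in
    terms of |j| becomes one in terms of |n|. *)
Lemma window_le n k j : (forall i, (k i <= n i)%N) -> j \in window n k ->
  (idx_size j <= 2 ^ d * idx_size n)%N.
Proof.
move=> kn; rewrite mem_window => /forallP H.
have -> : (2 ^ d = \prod_(i < d) 2)%N by rewrite prod_nat_const card_ord.
rewrite -big_split /=; apply: leq_prod => i _.
by have := H i; have := kn i; lia.
Qed.

Definition window_diff n k k' := [seq j <- window n k | j \notin window n k'].

Lemma window_perm n k k' : (forall i, (k' i <= k i)%N) ->
  perm_eq [seq j <- window n k | j \in window n k'] (window n k').
Proof.
move=> kk; apply: uniq_perm; rewrite ?filter_uniq ?uniq_window// => j.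
rewrite mem_filter; case: (boolP (j \in window n k')) => //=.
rewrite !mem_window => /forallP H; apply/forallP => i.
by have := H i; have := kk i; lia.
Qed.

Lemma big_window_diff (R : nmodType) (F : idx d -> R) n k k' :
  (forall i, (k' i <= k i)%N) ->
  \sum_(j <- window n k) F j =
  \sum_(j <- window n k') F j + \sum_(j <- window_diff n k k') F j.
Proof.
move=> kk; rewrite (bigID (fun j => j \in window n k')) /=; congr (_ + _).
  by rewrite -big_filter; exact: perm_big (window_perm n kk).
by rewrite -big_filter.
Qed.

Lemma size_window_diff n k k' : (forall i, (k' i <= k i)%N) ->
  (size (window_diff n k k') + idx_size k' = idx_size k)%N.
Proof.
move=> kk; rewrite -!(size_window n) -(perm_size (window_perm n kk)) !size_filter.
by rewrite addnC count_predC.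
Qed.

(** After division by the sides of N all factors lie in [0, 1], where a difference of products is at
    most the sum of the differences of the factors. *)
Lemma idx_size_diff_le (R : realFieldType) (N k k' : idx d) (e : R) :
  (forall i, (0 < N i)%N) -> (forall i, (k i <= N i)%N) ->
  (forall i, (k' i <= k i)%N) ->
  (forall i, (k i)%:R - (k' i)%:R <= e * (N i)%:R) ->
  (idx_size k)%:R - (idx_size k')%:R <= d%:R * e * (idx_size N)%:R.
Proof.
move=> N0 kN k'k ke.
have N0R i : (0 : R) < (N i)%:R by rewrite ltr0n.
pose a i : R := (k i)%:R / (N i)%:R; pose b i : R := (k' i)%:R / (N i)%:R.
have h (s : seq 'I_d) : [/\ \prod_(i <- s) a i - \prod_(i <- s) b i <= (size s)%:R * e,
    0 <= \prod_(i <- s) b i, \prod_(i <- s) b i <= \prod_(i <- s) a i &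
    \prod_(i <- s) a i <= 1].
  elim: s => [|i s [IH1 IH2 IH3 IH4]]; first by rewrite !big_nil mul0r subrr; split.
  have a1 : a i <= 1 by rewrite ler_pdivrMr// mul1r ler_nat.
  have b0 : 0 <= b i by rewrite divr_ge0.
  have ab : b i <= a i by rewrite ler_pM2r ?invr_gt0// ler_nat.
  have abe : a i - b i <= e by rewrite /a /b -mulrBl ler_pdivrMr.
  rewrite !big_cons /= -natr1.
  move: IH1 IH2 IH3 IH4; move: (\prod_(l <- s) a l) (\prod_(l <- s) b l) (a i) (b i) a1 b0 ab abe.
  move=> pa pb x y x1 y0 yx xye h1 h2 h3 h4; split; last 3 first.
  - by rewrite mulr_ge0.
  - by rewrite ler_pM.
  - by rewrite mulr_ile1//; lra.
  have : x * (pa - pb) <= pa - pb by rewrite ler_piMl// subr_ge0.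
  have : (x - y) * pb <= x - y by rewrite ler_piMr// ?subr_ge0//; lra.
  by lra.
have [H _ _ _] := h (enum 'I_d); rewrite size_enum_ord !big_enum /= in H.
have NN : (0 : R) < (idx_size N)%:R by rewrite ltr0n prodn_gt0.
rewrite -ler_pdivrMr// mulrBl /idx_size !natr_prod -!prodf_div.
exact: H.
Qed.

Section max.
Context {R : realType} {T : Type}.
Variables (X : idx d -> T -> R).

Lemma maxT_le n (m : idx d) w (x : R) : 0 <= x ->
  (forall k : idx d, (forall i, (k i <= m i)%N) -> Tsum X n k w <= x) -> maxT X n m w <= x.
Proof.
move=> x0 H; apply: bigmax_le => // k /forallP km; apply: H => i; rewrite ffunE.
exact: km.
Qed.

Lemma Tsum_le_maxT n (m : idx d) w : Tsum X n m w <= maxT X n m w.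
Proof.
have mm i : (m i < (\max_(i < d) m i).+1)%N by rewrite ltnS; exact: leq_bigmax.
pose k : {ffun 'I_d -> 'I_(\max_(i < d) m i).+1} := [ffun i => Ordinal (mm i)].
have kE : [ffun i => nat_of_ord (k i)] = m by apply/ffunP => i; rewrite !ffunE.
have := lexx (maxT X n m w); rewrite {1}/maxT => /bigmax_leP[_ /(_ k)].
rewrite kE; apply.
by apply/forallP => i; rewrite ffunE.
Qed.

Lemma maxT_ge0 n (m : idx d) w : 0 <= maxT X n m w.
Proof. exact: bigmax_ge_id. Qed.

End max.

End windows.

(** * Exponential inequalities and truncated moments *)

Section exponential_inequalities.
Context {R : realType}.

Lemma ge0_of_derive (g g' : R -> R) : (forall x : R, is_derive x 1 g (g' x)) ->
  g 0 = 0 -> (forall x, 0 <= x -> 0 <= g' x) -> forall u, 0 <= u -> 0 <= g u.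
Proof.
move=> dg g0 g'0 u u0.
have cg : {within `[0, u], continuous g}.
  by apply: derivable_within_continuous => x _; have [] := dg x.
have [c] := @MVT_segment _ g g' 0 u u0 (fun x _ => dg x) cg.
rewrite in_itv/= => /andP[c0 _]; rewrite g0 !subr0 => ->.
by rewrite mulr_ge0// g'0.
Qed.

Lemma is_derive_expRN (x : R) : is_derive x 1 (fun t : R => expR (- t)) (- expR (- x)).
Proof.
have H := @is_derive1_comp R expR (fun t : R => - t) x _ _ (is_derive_expR _) (is_deriveNid x 1).
by rewrite mulrN1 in H.
Qed.

Lemma is_derive_sqr_half (x : R) : is_derive x 1 (fun t : R => t ^+ 2 / 2) x.
Proof.
have -> : (fun t : R => t ^+ 2 / 2) = (2^-1 : R) \*: (fun t : R => t ^+ 2).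
  by apply/funext => t /=; rewrite mulrC.
by apply: is_derive_eq; rewrite /GRing.scale/=; lra.
Qed.

Lemma expRN_le_quadratic (t : R) : 0 <= t -> expR (- t) <= 1 - t + t ^+ 2 / 2.
Proof.
move=> t0; rewrite -subr_ge0.
apply: (@ge0_of_derive (fun t => 1 - t + t ^+ 2 / 2 - expR (- t))
  (fun t => 0 - 1 + t - - expR (- t))) => //.
- move=> x; apply: is_deriveB; last exact: is_derive_expRN.
  by apply: is_deriveD; exact: is_derive_sqr_half.
- by rewrite subr0 expr0n mul0r oppr0 expR0; ring.
- by move=> x x0; have := @expR_ge1Dx R (- x); lra.
Qed.

Lemma quadratic_le_expR (t : R) : 0 <= t -> 1 + t + t ^+ 2 / 2 <= expR t.
Proof.
move=> t0; rewrite -subr_ge0.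
apply: (@ge0_of_derive (fun t => expR t - (1 + t + t ^+ 2 / 2))
  (fun t => expR t - (0 + 1 + t))) => //.
- move=> x; apply: is_deriveB.
  by apply: is_deriveD; exact: is_derive_sqr_half.
- by rewrite expr0n mul0r expR0; ring.
- by move=> x x0; have := @expR_ge1Dx R x; lra.
Qed.

Lemma expR_le_quadraticM (t : R) : 0 <= t -> expR t <= 1 + t + t ^+ 2 / 2 * expR t.
Proof.
move=> t0; rewrite -subr_ge0.
apply: (@ge0_of_derive (fun t => 1 + t + t ^+ 2 / 2 * expR t - expR t)
  (fun t => 0 + 1 + (t ^+ 2 / 2 *: expR t + expR t *: t) - expR t)) => //.
- move=> x; apply: is_deriveB; apply: is_deriveD.
  apply: (@is_deriveM R R (fun t => t ^+ 2 / 2) expR); exact: is_derive_sqr_half.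
- by rewrite expr0n !mul0r expR0; ring.
- move=> x x0; rewrite /GRing.scale/=.
  have h : (1 - x) * expR x <= 1.
    rewrite -[leRHS](expRxMexpNx_1 x) mulrC ler_pM2l ?expR_gt0//.
    exact: expR_ge1Dx.
  have : 0 <= x ^+ 2 / 2 * expR x by rewrite mulr_ge0 ?expR_ge0// divr_ge0// exprn_ge0.
  by lra.
Qed.

Lemma quadraticM_le_expRN (t : R) : 0 <= t ->
  1 - t + t ^+ 2 / 2 * expR (- t) <= expR (- t).
Proof.
move=> t0; rewrite -subr_ge0.
apply: (@ge0_of_derive (fun t => expR (- t) - (1 - t + t ^+ 2 / 2 * expR (- t)))
  (fun t => - expR (- t) - (0 - 1 + (t ^+ 2 / 2 *: - expR (- t) + expR (- t) *: t)))) => //.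
- move=> x; apply: is_deriveB; first exact: is_derive_expRN.
  apply: is_deriveD.
  apply: (@is_deriveM R R (fun t => t ^+ 2 / 2) (fun t => expR (- t))).
    exact: is_derive_sqr_half.
  exact: is_derive_expRN.
- by rewrite expr0n !mul0r oppr0 expR0; ring.
- move=> x x0; rewrite /GRing.scale/=.
  have h : (1 + x) * expR (- x) <= 1.
    rewrite -[leRHS](expRxMexpNx_1 x) ler_pM2r ?expR_gt0//.
    exact: expR_ge1Dx.
  have : 0 <= x ^+ 2 / 2 * expR (- x) by rewrite mulr_ge0 ?expR_ge0// divr_ge0// exprn_ge0.
  by lra.
Qed.

(** This and the next bound are second-order expansions whose relative error e^|u| or e^(-|u|)
    multiplies only the quadratic term, and is near 1 when u is small. *)
Lemma expR_le_quadratic (u : R) : expR u <= 1 + u + u ^+ 2 / 2 * expR `|u|.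
Proof.
have [u0|/ltW u0] := leP 0 u; first by rewrite ger0_norm//; exact: expR_le_quadraticM.
rewrite ler0_norm//; have t0 : 0 <= - u by lra.
have := expRN_le_quadratic t0; rewrite opprK sqrrN.
have h : 1 <= expR (- u) by rewrite -expR0 ler_expR.
have : u ^+ 2 / 2 * 1 <= u ^+ 2 / 2 * expR (- u).
  by rewrite ler_wpM2l// divr_ge0// sqr_ge0.
by lra.
Qed.

Lemma quadratic_le_expRM (u : R) : 1 + u + u ^+ 2 / 2 * expR (- `|u|) <= expR u.
Proof.
have [u0|/ltW u0] := leP 0 u; last first.
  rewrite ler0_norm//; have t0 : 0 <= - u by lra.
  by have := quadraticM_le_expRN t0; rewrite !opprK sqrrN.
rewrite ger0_norm//; have := quadratic_le_expR u0.
have h : expR (- u) <= 1 by rewrite -expR0 ler_expR; lra.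
have : u ^+ 2 / 2 * expR (- u) <= u ^+ 2 / 2 * 1.
  by rewrite ler_wpM2l// divr_ge0// sqr_ge0.
by lra.
Qed.

(** Large values become 0 rather than b, so x and its truncation differ only when the level is
    exceeded, and then by exactly x. *)
Definition trunc (b x : R) : R := if `|x| <= b then x else 0.

Lemma ler_powR_scale (b x p q : R) : 0 < b -> b < x -> q <= p ->
  x `^ q <= b `^ (q - p) * x `^ p.
Proof.
move=> b0 bx qp; have x0 : 0 < x by exact: lt_trans bx.
have -> : x `^ q = x `^ (q - p) * x `^ p.
  by rewrite -powRD ?subrK// (gt_eqF x0) implybT.
rewrite ler_pM2r ?powR_gt0// -[q - p]opprB !powRN lef_pV2 ?posrE ?powR_gt0//.
by apply: ge0_ler_powR; rewrite ?nnegrE ?subr_ge0 ?(ltW b0) ?(ltW x0) ?(ltW bx).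
Qed.

Section pointwise.
Variables (lam b p : R).
Hypotheses (lam0 : 0 <= lam) (b0 : 0 < b) (p2 : 2 <= p).

(** The right side is a combination of 1, y, y^2 and |y|^p, whose expectations are known. Keeping
    the untruncated lam y, which integrates to 0, avoids recentring; when |y| > b it is compensated
    by |y| <= b^(1-p) |y|^p. *)
Lemma expR_trunc_le (y : R) : expR (lam * trunc b y) <=
  1 + lam * y + (lam ^+ 2 * expR (lam * b) / 2) * y ^+ 2
    + (lam * b `^ (1 - p)) * `|y| `^ p.
Proof.
have B0 : 0 <= (lam * b `^ (1 - p)) * `|y| `^ p by rewrite !mulr_ge0 ?powR_ge0.
have A0 : 0 <= lam ^+ 2 / 2 * y ^+ 2.
  by rewrite mulr_ge0 ?sqr_ge0// divr_ge0// sqr_ge0.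
rewrite /trunc; case: (leP `|y| b) => yb.
  apply: le_trans (expR_le_quadratic _) _.
  have : lam ^+ 2 / 2 * y ^+ 2 * expR `|lam * y| <= lam ^+ 2 / 2 * y ^+ 2 * expR (lam * b).
    by rewrite ler_wpM2l// ler_expR normrM ger0_norm// ler_wpM2l.
  by rewrite exprMn; lra.
rewrite mulr0 expR0.
have p1 : 1 <= p by apply: le_trans p2; rewrite ler1n.
have := ler_powR_scale b0 yb p1; rewrite powRr1//.
move=> /(ler_wpM2l lam0); rewrite mulrA => h.
have : lam * - `|y| <= lam * y by rewrite ler_wpM2l// lerNnormlW.
have : 0 <= (lam ^+ 2 / 2 * y ^+ 2) * expR (lam * b) by rewrite mulr_ge0// expR_ge0.
by lra.
Qed.

Lemma expR_trunc_ge (y : R) :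
  1 + lam * y + (lam ^+ 2 * expR (- (lam * b)) / 2) * y ^+ 2
    - (lam * b `^ (1 - p) + lam ^+ 2 / 2 * b `^ (2 - p)) * `|y| `^ p <=
  expR (lam * trunc b y).
Proof.
have B0 : 0 <= (lam * b `^ (1 - p) + lam ^+ 2 / 2 * b `^ (2 - p)) * `|y| `^ p.
  apply: mulr_ge0; last exact: powR_ge0.
  apply: addr_ge0; first by rewrite mulr_ge0 ?powR_ge0.
  by apply: mulr_ge0; [rewrite divr_ge0// sqr_ge0|exact: powR_ge0].
have A0 : 0 <= lam ^+ 2 / 2 * y ^+ 2.
  by rewrite mulr_ge0 ?sqr_ge0// divr_ge0// sqr_ge0.
rewrite /trunc; case: (leP `|y| b) => yb.
  apply: le_trans (quadratic_le_expRM _).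
  have : lam ^+ 2 / 2 * y ^+ 2 * expR (- (lam * b)) <= lam ^+ 2 / 2 * y ^+ 2 * expR (- `|lam * y|).
    by rewrite ler_wpM2l// ler_expR lerN2 normrM ger0_norm// ler_wpM2l.
  by rewrite exprMn; lra.
rewrite mulr0 expR0.
have p1 : 1 <= p by apply: le_trans p2; rewrite ler1n.
have := ler_powR_scale b0 yb p1; rewrite powRr1//.
move=> /(ler_wpM2l lam0); rewrite mulrA => h1.
have := ler_powR_scale b0 yb p2; rewrite powR_mulrn// real_normK ?num_real// => h2.
have l0 : 0 <= lam ^+ 2 / 2 by rewrite divr_ge0// sqr_ge0.
have := ler_wpM2l l0 h2; rewrite mulrA => {}h2.
have : lam * y <= lam * `|y| by rewrite ler_wpM2l// ler_norm.
have e1 : expR (- (lam * b)) <= 1 by rewrite -expR0 ler_expR oppr_le0 mulr_ge0// ltW.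
have : (lam ^+ 2 / 2 * y ^+ 2) * expR (- (lam * b)) <= (lam ^+ 2 / 2 * y ^+ 2) * 1.
  by rewrite ler_wpM2l.
by lra.
Qed.

Lemma expR_exceed_le (y : R) : expR (lam * (b < `|y|)%R%:R) <=
  1 + (expR lam * b `^ (- p)) * `|y| `^ p.
Proof.
case: (ltP b `|y|) => yb; last first.
  by rewrite mulr0 expR0 lerDl mulr_ge0 ?mulr_ge0 ?powR_ge0 ?expR_ge0.
have p0 : 0 <= p by exact: le_trans p2.
have := ler_powR_scale b0 yb p0; rewrite powRr0 sub0r => h.
rewrite mulr1 -mulrA; apply: ler_wpDl => //.
by rewrite ler_peMr// expR_ge0.
Qed.

End pointwise.

End exponential_inequalities.

Section moment_bounds.
Context {R : realType} {dT : measure_display} {T : measurableType dT}.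
Context (P : probability T R) (Y : T -> R) (p v mp : R).

Definition centred_moments : Prop :=
  [/\ measurable_fun setT Y,
      P.-integrable setT (EFin \o Y) /\ (\int[P]_w (Y w)%:E = 0)%E,
      P.-integrable setT (EFin \o (fun w => Y w ^+ 2)) /\
        (\int[P]_w (Y w ^+ 2)%:E = v%:E)%E &
      P.-integrable setT (EFin \o (fun w => `|Y w| `^ p)) /\
        (\int[P]_w (`|Y w| `^ p)%:E = mp%:E)%E].

Hypothesis HY : centred_moments.

Lemma integral_moments (c0 c1 c2 c3 : R) :
  P.-integrable setT
    (fun w => (c0 + c1 * Y w + c2 * Y w ^+ 2 + c3 * `|Y w| `^ p)%:E) /\
  (\int[P]_w (c0 + c1 * Y w + c2 * Y w ^+ 2 + c3 * `|Y w| `^ p)%:E =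
   (c0 + c2 * v + c3 * mp)%:E)%E.
Proof.
have [mY [i1 e1] [i2 e2] [i3 e3]] := HY.
pose f0 := fun w : T => c0%:E.
pose f1 := fun w => (c1%:E * (Y w)%:E)%E.
pose f2 := fun w => (c2%:E * (Y w ^+ 2)%:E)%E.
pose f3 := fun w => (c3%:E * (`|Y w| `^ p)%:E)%E.
have I0 : P.-integrable setT f0 by exact: finite_measure_integrable_cst.
have I1 : P.-integrable setT f1 by exact: integrableZl.
have I2 : P.-integrable setT f2 by exact: integrableZl.
have I3 : P.-integrable setT f3 by exact: integrableZl.
have -> : (fun w => (c0 + c1 * Y w + c2 * Y w ^+ 2 + c3 * `|Y w| `^ p)%:E) =
    (f0 \+ f1 \+ f2 \+ f3)%E by [].
have I01 : P.-integrable setT (f0 \+ f1)%E by exact: integrableD.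
have I012 : P.-integrable setT (f0 \+ f1 \+ f2)%E by exact: integrableD.
split; first exact: integrableD.
rewrite integralD// integralD// integralD// /f0 /f1 /f2 /f3 integral_cst//.
rewrite !integralZl// e1 e2 e3 mule0 adde0 !EFinD !EFinM.
by rewrite [X in (c0%:E * X)%E](_ : _ = 1%E) ?mule1//; exact: probability_setT.
Qed.

Lemma integral_le_moments (f : R -> R) (c0 c1 c2 c3 : R) :
  measurable_fun setT f -> (forall y, 0 <= f y) ->
  (forall y, f y <= c0 + c1 * y + c2 * y ^+ 2 + c3 * `|y| `^ p) ->
  (\int[P]_w (f (Y w))%:E <= (c0 + c2 * v + c3 * mp)%:E)%E.
Proof.
move=> mf f0 fle; have [I <-] := integral_moments c0 c1 c2 c3.
have [mY _ _ _] := HY.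
apply: ge0_le_integral => //.
- by move=> w _; rewrite lee_fin.
- by apply/measurable_EFinP; exact: measurableT_comp.
- by have /integrableP[] := I.
- by move=> w _; rewrite lee_fin.
Qed.

(** The upper bound with coefficients [a0] to [a3] provides the integrability of f(Y); its values do
    not enter the conclusion. *)
Lemma integral_ge_moments (f : R -> R) (c0 c1 c2 c3 a0 a1 a2 a3 : R) :
  measurable_fun setT f -> (forall y, 0 <= f y) ->
  (forall y, f y <= a0 + a1 * y + a2 * y ^+ 2 + a3 * `|y| `^ p) ->
  (forall y, c0 + c1 * y + c2 * y ^+ 2 + c3 * `|y| `^ p <= f y) ->
  ((c0 + c2 * v + c3 * mp)%:E <= \int[P]_w (f (Y w))%:E)%E.
Proof.
move=> mf f0 fle fge; have [I <-] := integral_moments c0 c1 c2 c3.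
have [mY _ _ _] := HY; have [I' _] := integral_moments a0 a1 a2 a3.
apply: le_integral => //.
- apply: (le_integrable _ _ _ I') => //.
    by apply/measurable_EFinP; exact: measurableT_comp.
  move=> w _; rewrite /= lee_fin ger0_norm//.
  by apply: le_trans (fle (Y w)) _; exact: ler_norm.
- by move=> w _; rewrite lee_fin.
Qed.

Lemma moment_ge0 : 0 <= v /\ 0 <= mp.
Proof.
have [_ _ [_ e2] [_ e3]] := HY; split; rewrite -lee_fin -?e2 -?e3.
  by apply: integral_ge0 => w _; rewrite lee_fin sqr_ge0.
by apply: integral_ge0 => w _; rewrite lee_fin powR_ge0.
Qed.

End moment_bounds.

Section sums.
Context {R : realType} {dT : measure_display} {T : measurableType dT}.
Context (P : probability T R) (Y : T -> R) (p v mp : R).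
Hypotheses (HY : centred_moments P Y p v mp) (p2 : 2 <= p).
Context {I : choiceType} (S : set I) (X : I -> T -> R).
Hypothesis indepX : mutually_independent P S X.
Hypothesis dXY : forall j, S j -> forall A, measurable A ->
  P (X j @^-1` A) = P (Y @^-1` A).

Lemma measurable_trunc (b : R) : measurable_fun setT (trunc b).
Proof.
apply: measurable_fun_ifT => //.
by apply: measurable_fun_ler => //; exact: normr_measurable.
Qed.

Lemma measurable_expR_trunc (lam b : R) :
  measurable_fun setT (fun y => expR (lam * trunc b y)).
Proof.
apply: measurableT_comp => //; apply: measurable_funM => //.
exact: measurable_trunc.
Qed.

Lemma measurable_exceed (b : R) : measurable_fun setT (fun y : R => (b < `|y|)%R%:R : R).
Proof.
have -> : (fun y : R => (b < `|y|)%R%:R : R) = (fun y => if b < `|y| then 1 else 0).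
  by apply/funext => y; case: ifP.
apply: measurable_fun_ifT => //.
by apply: measurable_fun_ltr => //; exact: normr_measurable.
Qed.

Lemma lee_expe (x y : \bar R) (n : nat) : (0 <= x)%E -> (x <= y)%E ->
  (x ^+ n <= y ^+ n)%E.
Proof.
move=> x0 xy; elim: n => [|n IH]; first by rewrite !expe0.
by rewrite !expeS; apply: lee_pmul => //; exact: expe_ge0.
Qed.

Lemma measurable_sum_coord (J : seq I) (g : R -> R) : (forall j, j \in J -> S j) ->
  measurable_fun setT g ->
  measurable_fun setT (fun w => \sum_(j <- J) g (X j w)).
Proof.
move=> JS mg; apply: (measurable_of_rect_space indepX JS).
exact: (@measurable_coord_sum _ _ _ _ X J (fun=> g)).
Qed.

Lemma integral_expR_sum (J : seq I) (g : R -> R) : uniq J ->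
  (forall j, j \in J -> S j) -> measurable_fun setT g ->
  (\int[P]_w (expR (\sum_(j <- J) g (X j w)))%:E =
   (\int[P]_w (expR (g (Y w)))%:E) ^+ size J)%E.
Proof.
move=> uJ JS mg.
have [mY _ _ _] := HY.
rewrite -(integral_prod_indep indepX mY dXY uJ JS (f := expR \o g)).
- by apply: eq_integral => w _; rewrite expR_sum.
- exact: measurableT_comp.
- by move=> x; exact: expR_ge0.
Qed.

Section blocks.
Variables (J : seq I) (lam b : R).
Hypotheses (uJ : uniq J) (JS : forall j, j \in J -> S j).
Hypotheses (lam0 : 0 <= lam) (b0 : 0 < b).

Lemma mgf_sum_trunc_le :
  (\int[P]_w (expR (\sum_(j <- J) lam * trunc b (X j w)))%:E <=
   (expR ((size J)%:R * (lam ^+ 2 * expR (lam * b) / 2 * v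
     + lam * b `^ (1 - p) * mp)))%:E)%E.
Proof.
have mt : measurable_fun setT (fun y => lam * trunc b y).
  by apply: measurable_funM => //; exact: measurable_trunc.
rewrite (integral_expR_sum uJ JS mt) expRM_natl EFin_expe.
apply: lee_expe; first by apply: integral_ge0 => w _; rewrite lee_fin expR_ge0.
apply: le_trans (integral_le_moments HY _ _ (fun y => expR_trunc_le lam0 b0 p2 y)) _.
- exact: measurable_expR_trunc.
- by move=> y; exact: expR_ge0.
- by rewrite lee_fin -addrA expR_ge1Dx.
Qed.

(** One factor is at least 1 + psi, and ln(1 + psi) >= psi/(1 + psi). *)
Lemma mgf_sum_trunc_ge (psi : R) : 0 <= psi ->
  psi <= lam ^+ 2 * expR (- (lam * b)) / 2 * v
    - (lam * b `^ (1 - p) + lam ^+ 2 / 2 * b `^ (2 - p)) * mp ->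
  ((expR ((size J)%:R * (psi / (1 + psi))))%:E <=
   \int[P]_w (expR (\sum_(j <- J) lam * trunc b (X j w)))%:E)%E.
Proof.
move=> psi0 hpsi.
have mt : measurable_fun setT (fun y => lam * trunc b y).
  by apply: measurable_funM => //; exact: measurable_trunc.
rewrite (integral_expR_sum uJ JS mt) expRM_natl EFin_expe.
apply: lee_expe; first by rewrite lee_fin expR_ge0.
apply: le_trans (_ : (1 + psi)%:E <= _)%E.
  rewrite lee_fin -[leRHS](lnK (x := 1 + psi)) ?posrE; last by lra.
  rewrite ler_expR.
  have -> : psi / (1 + psi) = - (- (psi / (1 + psi))) by rewrite opprK.
  have -> : ln (1 + psi) = - ln (1 + - (psi / (1 + psi))).
    rewrite -lnV ?posrE; last by rewrite subr_gt0 ltr_pdivrMr; lra.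
    by congr ln; field; lra.
  by rewrite lerN2 le_ln1Dx// ltrN2 ltr_pdivrMr; lra.
have H := integral_ge_moments HY (measurable_expR_trunc lam b) (fun y => expR_ge0 _)
  (fun y => expR_trunc_le lam0 b0 p2 y)
  (c3 := - (lam * b `^ (1 - p) + lam ^+ 2 / 2 * b `^ (2 - p))).
apply: le_trans (H 1 lam (lam ^+ 2 * expR (- (lam * b)) / 2) _).
  by rewrite lee_fin; lra.
by move=> y; rewrite mulNr; exact: expR_trunc_ge.
Qed.

Lemma mgf_sum_exceed_le :
  (\int[P]_w (expR (\sum_(j <- J) lam * (b < `|X j w|)%R%:R))%:E <=
   (expR ((size J)%:R * (expR lam * b `^ (- p) * mp)))%:E)%E.
Proof.
have mt : measurable_fun setT (fun y : R => lam * (b < `|y|)%R%:R).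
  by apply: measurable_funM => //; exact: measurable_exceed.
rewrite (integral_expR_sum uJ JS mt) expRM_natl EFin_expe.
apply: lee_expe; first by apply: integral_ge0 => w _; rewrite lee_fin expR_ge0.
have h y : expR (lam * (b < `|y|)%R%:R) <=
    1 + 0 * y + 0 * y ^+ 2 + (expR lam * b `^ (- p)) * `|y| `^ p.
  by rewrite !mul0r !addr0; exact: expR_exceed_le.
apply: le_trans (integral_le_moments HY _ _ h) _.
- exact: measurableT_comp.
- by move=> y; exact: expR_ge0.
- by rewrite lee_fin mul0r addr0 expR_ge1Dx.
Qed.

End blocks.

End sums.

(** * Chernoff bound and exponential tilting *)

Section tilting.
Context {R : realType} {dT : measure_display} {T : measurableType dT}.
Context (P : probability T R).

Lemma chernoff_bound (U : T -> R) (x M : R) : measurable_fun setT U ->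
  (\int[P]_w (expR (U w))%:E <= (expR M)%:E)%E ->
  (P [set w | (x <= U w)%R] <= (expR (M - x))%:E)%E.
Proof.
move=> mU UM.
pose U' : {RV P >-> R} := mfun_Sub (mem_set mU).
apply: le_trans (@chernoff _ _ _ P U' 1 x ltr01) _.
rewrite mul1r expRD EFinM lee_wpmul2r ?lee_fin ?expR_ge0//.
rewrite /mmt_gen_fun unlock; apply: le_trans UM.
by rewrite le_eqVlt; apply/orP; left; apply/eqP/eq_integral => w _; rewrite /= mulr1.
Qed.

(* Under the law tilted by [exp (a U)], the mass outside [lo, hi] is controlled by
   the moment generating function at [a + t] and [a - t]. *)
Lemma tilting_bound (U : T -> R) (a t lo hi A B1 B2 : R) : measurable_fun setT U ->
  0 <= a -> 0 <= t -> 0 <= B1 -> 0 <= B2 ->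
  (A%:E <= \int[P]_w (expR (a * U w))%:E)%E ->
  (\int[P]_w (expR ((a + t) * U w))%:E <= B1%:E)%E ->
  (\int[P]_w (expR ((a - t) * U w))%:E <= B2%:E)%E ->
  ((A - expR (- (t * hi)) * B1 - expR (t * lo) * B2)%:E <=
   (expR (a * hi))%:E * P [set w | (lo < U w)%R])%E.
Proof.
move=> mU a0 t0 B10 B20 hA hB1 hB2.
pose E := [set w | lo < U w].
have mE : measurable E.
  rewrite (_ : E = setT `&` U @^-1` `]lo, +oo[%classic); first exact: mU.
  by rewrite setTI; apply/seteqP; split => w /=; rewrite in_itv/= andbT.
have mexp c : measurable_fun setT (fun w => (expR (c * U w))%:E).
  by apply/measurable_EFinP; apply: measurableT_comp => //; exact: measurable_funM.
pose g1 w := ((expR (a * hi))%:E * (\1_E w)%:E)%E.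
pose g2 w := ((expR (- (t * hi)))%:E * (expR ((a + t) * U w))%:E)%E.
pose g3 w := ((expR (t * lo))%:E * (expR ((a - t) * U w))%:E)%E.
have mg1 : measurable_fun setT g1.
  by apply: emeasurable_funM => //; apply/measurable_EFinP; exact: measurable_indic.
have mg2 : measurable_fun setT g2 by exact: emeasurable_funM.
have mg3 : measurable_fun setT g3 by exact: emeasurable_funM.
have g10 w : (0 <= g1 w)%E by rewrite mule_ge0 ?lee_fin ?expR_ge0.
have g20 w : (0 <= g2 w)%E by rewrite mule_ge0 ?lee_fin ?expR_ge0.
have g30 w : (0 <= g3 w)%E by rewrite mule_ge0 ?lee_fin ?expR_ge0.
have : (A%:E <= (expR (a * hi))%:E * P E + (expR (- (t * hi)) * B1)%:E
    + (expR (t * lo) * B2)%:E)%E.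
  apply: le_trans hA _.
  (* Pointwise, e^(aU) is at most one of the three terms: [g2] if U >= hi, [g1] if lo < U < hi, and
     [g3] if U <= lo. *)
  apply: le_trans (_ : \int[P]_w (g1 w + g2 w + g3 w) <= _)%E.
    apply: ge0_le_integral => //.
      by apply: emeasurable_funD => //; exact: emeasurable_funD.
    move=> w _; rewrite /g1 /g2 /g3 -!EFinM -!EFinD lee_fin -!expRD.
    have [Uhi|Uhi] := leP hi (U w).
      apply: ler_wpDr; first exact: expR_ge0.
      apply: ler_wpDl; first by rewrite mulr_ge0// expR_ge0.
      rewrite ler_expR; have : 0 <= t * (U w - hi) by rewrite mulr_ge0// subr_ge0.
      by lra.
    have [Ulo|Ulo] := ltP lo (U w).
      apply: ler_wpDr; first exact: expR_ge0.
      apply: ler_wpDr; first exact: expR_ge0.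
      rewrite indicE mem_set// mulr1 ler_expR.
      by rewrite ler_wpM2l// ltW.
    apply: ler_wpDl; first by rewrite addr_ge0 ?mulr_ge0 ?expR_ge0.
    rewrite ler_expR; have : 0 <= t * (lo - U w) by rewrite mulr_ge0// subr_ge0.
    by lra.
  rewrite ge0_integralD//; last 2 first.
  - by move=> w _; exact: adde_ge0.
  - exact: emeasurable_funD.
  rewrite ge0_integralD//.
  rewrite /g1 /g2 /g3 !ge0_integralZl//; try by move=> w _; rewrite lee_fin ?expR_ge0.
  - rewrite integral_indic// setIT; apply: leeD; first apply: leeD => //.
    + by rewrite EFinM lee_wpmul2l// lee_fin expR_ge0.
    + by rewrite EFinM lee_wpmul2l// lee_fin expR_ge0.
  - by apply/measurable_EFinP; exact: measurable_indic.
have PEf : P E = (fine (P E))%:E by rewrite fineK// fin_num_measure.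
by rewrite PEf -!EFinM -!EFinD !lee_fin; lra.
Qed.

End tilting.

(** * Tails of truncated sums *)

Section growth.
Context {R : realType}.

Lemma near_le_powR (tau K : R) : 0 < tau -> \forall m \near \oo, K <= (m%:R : R) `^ tau.
Proof.
move=> t0; have [N0 H] := @powR_unbounded R tau K t0.
by exists N0 => // m /= Nm; exact: H.
Qed.

Lemma near_le_ln (K : R) : \forall m \near \oo, K <= ln (m%:R : R).
Proof.
have h := @near_le_powR 1 (expR K) ltr01; near=> m.
have : expR K <= m%:R `^ 1 by near: m; exact: h.
rewrite powRr1// => hm; rewrite -[leLHS]expRK ler_ln ?posrE ?expR_gt0//.
by apply: lt_le_trans hm; exact: expR_gt0.
Unshelve. all: by end_near. Qed.

Lemma near_ln_le_powR (tau K : R) : 0 < tau -> 0 <= K ->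
  \forall m \near \oo, K * ln (m%:R : R) <= m%:R `^ tau.
Proof.
move=> t0 K0; have t2 : 0 < tau / 2 by rewrite divr_gt0.
have h := @near_le_powR (tau / 2) (K * (2 / tau)) t2.
near=> m.
have m0 : (0 : R) < m%:R.
  by rewrite ltr0n; near: m; exists 1%N.
have hm : K * (2 / tau) <= m%:R `^ (tau / 2) by near: m; exact: h.
have -> : m%:R `^ tau = m%:R `^ (tau / 2) * m%:R `^ (tau / 2) :> R.
  by rewrite -powRD ?(gt_eqF m0) ?implybT//; congr (_ `^ _); field.
have -> : ln m%:R = (2 / tau) * ln (m%:R `^ (tau / 2)) :> R.
  by rewrite ln_powR; field; rewrite gt_eqF.
rewrite mulrA; apply: ler_pM => //.
- by rewrite mulr_ge0// divr_ge0// ltW.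
- apply: ln_ge0; have : (m%:R : R) `^ 0 <= m%:R `^ (tau / 2).
    by apply: ler_powR; [rewrite ler1n -(ltr0n R)|exact: ltW].
  by rewrite powRr0.
- by apply/ltW/ln_sublinear; rewrite powR_gt0.
Unshelve. all: by end_near. Qed.

Definition nrm (alpha : R) (m : nat) : R := Num.sqrt (2 * m%:R `^ alpha * ln m%:R).

(** The exponent optimising the Gaussian Chernoff bound for m^alpha variables of unit variance at
    the level [nrm alpha m]. *)
Definition cscale (alpha : R) (m : nat) : R := nrm alpha m / m%:R `^ alpha.

Section scale.
Variables (alpha : R) (m : nat).
Hypothesis L1 : 1 <= ln (m%:R : R).

Lemma size_gt0 : (0 : R) < m%:R.
Proof. by rewrite ltNge; apply/negP => h; move: L1; rewrite (ln0 h) ler10. Qed.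

Lemma ln_size_gt0 : 0 < ln (m%:R : R).
Proof. exact: lt_le_trans L1. Qed.

Lemma sqr_nrm : nrm alpha m ^+ 2 = 2 * m%:R `^ alpha * ln m%:R.
Proof. by rewrite sqr_sqrtr// !mulr_ge0 ?powR_ge0// ltW// ln_size_gt0. Qed.

Lemma nrm_gt0 : 0 < nrm alpha m.
Proof. by rewrite sqrtr_gt0 !mulr_gt0 ?powR_gt0 ?size_gt0 ?ln_size_gt0. Qed.

Lemma cscale_gt0 : 0 < cscale alpha m.
Proof. by rewrite divr_gt0 ?nrm_gt0// powR_gt0// size_gt0. Qed.

Lemma cscale_nrm : cscale alpha m * nrm alpha m = 2 * ln m%:R.
Proof.
have := size_gt0 => m0; rewrite /cscale mulrAC -expr2 sqr_nrm.
by field; rewrite gt_eqF// powR_gt0.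
Qed.

Lemma sqr_cscale : m%:R `^ alpha * cscale alpha m ^+ 2 = 2 * ln m%:R.
Proof.
have := size_gt0 => m0; rewrite -cscale_nrm /cscale.
by field; rewrite gt_eqF// powR_gt0.
Qed.

End scale.

(** Up to logarithms the left side is m^(alpha (1 - p/2)), so p > 2 leaves a power saving. Of this
    saving, 4 [tau], half pays for the logarithms through [e], one [tau] for the constant K, and one
    remains. *)
Lemma near_cscale_powR (alpha p : R) : 0 < alpha -> 2 < p ->
  exists2 tau : R, 0 < tau & forall K : R, 0 <= K ->
    \forall m \near \oo, K * (m%:R `^ alpha * cscale alpha m `^ p) <= m%:R `^ (- tau).
Proof.
move=> a0 p2; pose tau := alpha * (p - 2) / 8.
have t0 : 0 < tau by rewrite divr_gt0// mulr_gt0// subr_gt0.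
exists tau => // K K0.
pose e := alpha * (p - 2) / (2 * p).
have e0 : 0 < e by rewrite divr_gt0 ?mulr_gt0 ?subr_gt0//; lra.
have h1 := @near_ln_le_powR e 2 e0 (ler0n _ _).
have h2 := @near_le_powR tau K t0.
have h3 := near_le_ln 1.
near=> m.
have L1 : 1 <= ln (m%:R : R) by near: m; exact: h3.
have m0 := size_gt0 L1.
have c0 := cscale_gt0 alpha L1.
have Le : 2 * ln m%:R <= m%:R `^ e :> R by near: m; exact: h1.
have Kt : K <= (m%:R : R) `^ tau by near: m; exact: h2.
have c2 : cscale alpha m ^+ 2 <= m%:R `^ (e - alpha).
  rewrite powRD ?(gt_eqF m0) ?implybT// powRN -ler_pdivrMr ?invr_gt0 ?powR_gt0// invrK.
  by rewrite mulrC sqr_cscale.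
have cp : cscale alpha m `^ p <= m%:R `^ ((e - alpha) * (p / 2)).
  have -> : cscale alpha m `^ p = (cscale alpha m ^+ 2) `^ (p / 2).
    by rewrite -powR_mulrn ?(ltW c0)// -powRrM; congr (_ `^ _); field.
  rewrite [leRHS]powRrM; apply: ge0_ler_powR; rewrite ?nnegrE ?sqr_ge0 ?powR_ge0//.
  by rewrite divr_ge0//; lra.
apply: le_trans (_ : m%:R `^ tau * (m%:R `^ alpha * m%:R `^ ((e - alpha) * (p / 2))) <= _).
  by rewrite ler_pM ?mulr_ge0 ?powR_ge0// ler_wpM2l ?powR_ge0.
rewrite -!powRD ?(gt_eqF m0) ?implybT//; apply: ler_powR.
  by rewrite ler1n -(ltr0n R).
rewrite /e /tau le_eqVlt; apply/orP; left; apply/eqP; field; apply/eqP; lra.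
Unshelve. all: by end_near. Qed.

Lemma near_cscale_le (alpha e : R) : 0 < alpha -> 0 < e ->
  \forall m \near \oo, cscale alpha m ^+ 2 <= e.
Proof.
move=> a0 e0.
have h1 := @near_ln_le_powR alpha (2 / e) a0 (divr_ge0 (ler0n _ _) (ltW e0)).
have h3 := near_le_ln 1.
near=> m.
have L1 : 1 <= ln (m%:R : R) by near: m; exact: h3.
have m0 := size_gt0 L1.
have Le : 2 / e * ln m%:R <= m%:R `^ alpha :> R by near: m; exact: h1.
rewrite -(ler_pM2l (_ : 0 < m%:R `^ alpha)) ?powR_gt0// sqr_cscale//.
rewrite -ler_pdivrMr//; apply: le_trans Le.
by rewrite le_eqVlt; apply/orP; left; apply/eqP; field; rewrite gt_eqF.
Unshelve. all: by end_near. Qed.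

End growth.

Section tails.
Context {R : realType} {dT : measure_display} {T : measurableType dT}.
Context (P : probability T R) (Y : T -> R) (alpha p v mp : R).
Hypotheses (HY : centred_moments P Y p v mp) (p2 : 2 < p) (alpha0 : 0 < alpha).
Context {I : choiceType} (S : set I) (X : I -> T -> R).
Hypothesis indepX : mutually_independent P S X.
Hypothesis dXY : forall j, S j -> forall A, measurable A ->
  P (X j @^-1` A) = P (Y @^-1` A).

Let p2' : 2 <= p := ltW p2.
Let v0 : 0 <= v := (moment_ge0 HY).1.
Let mp0 : 0 <= mp := (moment_ge0 HY).2.
Let c (m : nat) := cscale alpha m.

(* With truncation at [delta / cscale], an exponent [a * cscale] gives [a * delta] on the
   truncation level and [2 * a * ln m] on the level [nrm alpha m]. *)
Definition tsum (delta : R) (m : nat) (J : seq I) (w : T) : R :=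
  \sum_(j <- J) trunc (delta / cscale alpha m) (X j w).

Lemma near_cscale_small (K : R) : 0 <= K ->
  \forall m \near \oo, K * (m%:R `^ alpha * c m `^ p) <= 1.
Proof.
move=> K0; have [tau t0 /(_ K K0) h1] := near_cscale_powR alpha0 p2.
have h3 := @near_le_ln R 1; near=> m.
have L1 : 1 <= ln (m%:R : R) by near: m; exact: h3.
have m0 := size_gt0 L1.
apply: le_trans (_ : m%:R `^ (- tau) <= _); first by near: m; exact: h1.
rewrite powRN invf_le1 ?powR_gt0//; have : (m%:R : R) `^ 0 <= m%:R `^ tau.
  by apply: ler_powR; [rewrite ler1n -(ltr0n R)|exact: ltW].
by rewrite powRr0.
Unshelve. all: by end_near. Qed.

Lemma measurable_tsum delta m J : (forall j, j \in J -> S j) ->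
  measurable_fun setT (tsum delta m J).
Proof.
move=> JS; apply: (measurable_sum_coord indepX JS); exact: measurable_trunc.
Qed.

Section scaled.
Variables (a delta : R) (m : nat).
Hypotheses (a0 : 0 <= a) (delta0 : 0 < delta) (L1 : 1 <= ln (m%:R : R)).

Let c0 : 0 < c m := cscale_gt0 alpha L1.

Lemma scaled_lam_b : a * c m * (delta / c m) = a * delta.
Proof. by field; rewrite gt_eqF. Qed.

Lemma scaled_b_powR (q : R) : (delta / c m) `^ (q - p) = delta `^ (q - p) * c m `^ (p - q).
Proof.
rewrite powRM ?invr_ge0 ?(ltW c0) ?(ltW delta0)//; congr (_ * _).
by rewrite -powR_inv1 ?(ltW c0)// -powRrM mulN1r opprB.
Qed.

Lemma scaled_powR1 : c m * c m `^ (p - 1) = c m `^ p.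
Proof. by apply: mulr_powRB1; [exact: ltW|exact: lt_trans p2]. Qed.

Lemma scaled_powR2 : c m ^+ 2 * c m `^ (p - 2) = c m `^ p.
Proof.
rewrite -powR_mulrn ?(ltW c0)// -powRD ?(gt_eqF c0) ?implybT//.
by congr (_ `^ _); lra.
Qed.

End scaled.

(** The identity m^alpha c^2 = 2 ln m turns the quadratic term into a multiple of ln m, and the p-th
    moment term falls below [kappa]. The threshold for m is uniform over blocks, as the later union
    bounds require. *)
Lemma mgf_tsum_le (a delta rho kappa : R) : 0 <= a -> 0 < delta -> 0 <= rho -> 0 < kappa ->
  \forall m \near \oo, forall J : seq I, uniq J -> (forall j, j \in J -> S j) ->
    (size J)%:R <= rho * m%:R `^ alpha ->
    (\int[P]_w (expR (a * (c m * tsum delta m J w)))%:E <=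
     (expR (ln m%:R * (a ^+ 2 * rho * v * expR (a * delta) + kappa)))%:E)%E.
Proof.
move=> a0 d0 r0 k0.
pose D := delta `^ (1 - p).
have D0 : 0 <= D by exact: powR_ge0.
pose K := rho * a * D * mp / kappa.
have K0 : 0 <= K by rewrite /K divr_ge0 ?(ltW k0)// !mulr_ge0.
have h1 := near_cscale_small K0; have h3 := @near_le_ln R 1.
near=> m => J uJ JS sJ.
have L1 : 1 <= ln (m%:R : R) by near: m; exact: h3.
have m0 := size_gt0 L1; have c0 := cscale_gt0 alpha L1; rewrite -/(c m) in c0.
have hK : K * (m%:R `^ alpha * c m `^ p) <= 1 by near: m; exact: h1.
have lam0 : 0 <= a * c m by rewrite mulr_ge0// ltW.
have b0 : 0 < delta / c m by rewrite divr_gt0.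
under eq_integral => w _ do rewrite /tsum mulrA mulr_sumr.
apply: le_trans (mgf_sum_trunc_le HY p2' indepX dXY uJ JS lam0 b0) _.
rewrite lee_fin ler_expR scaled_lam_b// scaled_b_powR//.
rewrite -/D.
have -> : a * c m * (D * c m `^ (p - 1)) = a * D * c m `^ p.
  by rewrite -scaled_powR1//; ring.
set E := expR (a * delta).
have E0 : 0 <= E by exact: expR_ge0.
set Cp := c m `^ p in hK *; have Cp0 : 0 <= Cp by exact: powR_ge0.
apply: le_trans (_ : rho * m%:R `^ alpha * ((a * c m) ^+ 2 * E / 2 * v + a * D * Cp * mp) <= _).
  have Q0 : 0 <= (a * c m) ^+ 2 * E / 2 * v.
    by apply: mulr_ge0 => //; apply: divr_ge0 => //; apply: mulr_ge0 => //; exact: sqr_ge0.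
  by rewrite ler_wpM2r// addr_ge0// !mulr_ge0.
have -> : rho * m%:R `^ alpha * ((a * c m) ^+ 2 * E / 2 * v + a * D * Cp * mp) =
    rho * a ^+ 2 * E * v / 2 * (m%:R `^ alpha * c m ^+ 2) +
    (K * (m%:R `^ alpha * Cp)) * kappa.
  by rewrite /K; field; rewrite gt_eqF.
rewrite sqr_cscale//.
have : (K * (m%:R `^ alpha * Cp)) * kappa <= 1 * kappa by rewrite ler_pM2r.
have : kappa * 1 <= kappa * ln m%:R by rewrite ler_pM2l.
by lra.
Unshelve. all: by end_near. Qed.

Lemma mgf_tsum_ge (a delta rho kappa : R) : 0 < v -> 0 < a -> 0 < delta -> 0 < rho ->
  0 < kappa ->
  \forall m \near \oo, forall J : seq I, uniq J -> (forall j, j \in J -> S j) ->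
    rho * m%:R `^ alpha <= (size J)%:R ->
    ((expR (ln m%:R * (a ^+ 2 * rho * v * expR (- (a * delta)) - kappa)))%:E <=
     \int[P]_w (expR (a * (c m * tsum delta m J w)))%:E)%E.
Proof.
move=> vp a0 d0 r0 k0.
pose E := expR (- (a * delta)).
have E0 : 0 < E by exact: expR_gt0.
have E1 : E <= 1 by rewrite -expR0 ler_expR oppr_le0 mulr_ge0// ltW.
pose A := a ^+ 2 * E * v.
have A0 : 0 < A by rewrite !mulr_gt0// exprn_gt0.
pose H := (a * delta `^ (1 - p) + a ^+ 2 / 2 * delta `^ (2 - p)) * mp.
have H0 : 0 <= H.
  by rewrite mulr_ge0// addr_ge0// mulr_ge0 ?powR_ge0 ?(ltW a0)// divr_ge0// sqr_ge0.
(* Bounds the p-th moment error: by A, so that psi is nonnegative, and by kappa/(2 rho), half of the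
   allowed loss. *)
pose k1 := Num.min A (kappa / (2 * rho)).
have k10 : 0 < k1 by rewrite lt_min A0 divr_gt0// mulr_gt0.
have k1A : k1 <= A by rewrite ge_min lexx.
have k1k : k1 * rho <= kappa / 2.
  have : k1 <= kappa / (2 * rho) by rewrite ge_min lexx orbT.
  by rewrite ler_pdivlMr ?mulr_gt0//; lra.
(* Bounds c(m)^2 so that the term psi^2 lost in psi/(1 + psi) >= psi (1 - psi) costs the other half
   of kappa. *)
pose k2 := kappa / (rho * A * A).
have k20 : 0 < k2 by rewrite divr_gt0// !mulr_gt0.
have h1 := near_cscale_small (divr_ge0 H0 (ltW k10)).
have h2 := near_cscale_le alpha0 k20.
have h3 := @near_le_ln R 1.
near=> m => J uJ JS sJ.
have L1 : 1 <= ln (m%:R : R) by near: m; exact: h3.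
have m0 := size_gt0 L1; have c0 := cscale_gt0 alpha L1; rewrite -/(c m) in c0.
have hK : H / k1 * (m%:R `^ alpha * c m `^ p) <= 1 by near: m; exact: h1.
have hc : c m ^+ 2 <= k2 by near: m; exact: h2.
have lam0 : 0 <= a * c m by rewrite mulr_ge0// ltW.
have b0 : 0 < delta / c m by rewrite divr_gt0.
have Ma0 : 0 < (m%:R : R) `^ alpha by rewrite powR_gt0.
set Ma := (m%:R : R) `^ alpha in Ma0 sJ hK *.
set L := ln (m%:R : R) in L1 *.
have McL : Ma * c m ^+ 2 = 2 * L by exact: sqr_cscale.
pose psi := A * c m ^+ 2 / 2 - H * c m `^ p.
have Hk : H * (Ma * c m `^ p) <= k1.
  by move: hK; rewrite mulrAC ler_pdivrMr// mul1r.
have MpsiE : Ma * psi = A * (Ma * c m ^+ 2) / 2 - H * (Ma * c m `^ p).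
  by rewrite /psi; ring.
have Mpsi : A * L - k1 <= Ma * psi by rewrite MpsiE McL; lra.
have AL : A * 1 <= A * L by rewrite ler_pM2l.
have psi0 : 0 <= psi by rewrite -(pmulr_rge0 _ Ma0); lra.
have psi1 : psi <= A * k2 / 2.
  have : 0 <= H * c m `^ p by rewrite mulr_ge0// powR_ge0.
  have : A * c m ^+ 2 <= A * k2 by rewrite ler_pM2l.
  by rewrite /psi; lra.
have psiE : psi = (a * c m) ^+ 2 * expR (- (a * c m * (delta / c m))) / 2 * v
    - (a * c m * (delta / c m) `^ (1 - p) + (a * c m) ^+ 2 / 2 * (delta / c m) `^ (2 - p)) * mp.
  rewrite scaled_lam_b// !scaled_b_powR//.
  have e1 : c m `^ p = c m * c m `^ (p - 1) by rewrite scaled_powR1.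
  have e2 : c m `^ p = c m ^+ 2 * c m `^ (p - 2) by rewrite scaled_powR2.
  rewrite /psi /A /H -/E mulrDl mulrDl {1}e1.
  rewrite [X in _ - (_ + X)](_ : _ = a ^+ 2 / 2 * delta `^ (2 - p) * mp *
    (c m ^+ 2 * c m `^ (p - 2))); first by ring.
  by rewrite -e2.
under eq_integral => w _ do rewrite /tsum mulrA mulr_sumr.
have hpsi : psi <= psi by [].
rewrite {2}psiE in hpsi.
apply: le_trans (mgf_sum_trunc_ge HY p2' indepX dXY uJ JS lam0 b0 psi0 hpsi).
rewrite lee_fin ler_expR.
apply: le_trans (_ : rho * Ma * (psi / (1 + psi)) <= _); last first.
  by rewrite ler_wpM2r// divr_ge0//; lra.
apply: le_trans (_ : rho * Ma * (psi * (1 - psi)) <= _); last first.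
  rewrite ler_wpM2l ?mulr_ge0 ?(ltW r0) ?(ltW Ma0)// ler_pdivlMr; last by lra.
  have : 0 <= psi * psi * psi by rewrite !mulr_ge0.
  by lra.
have Mpsi2 : Ma * psi <= A * L.
  rewrite MpsiE McL; have : 0 <= H * (Ma * c m `^ p) by rewrite mulr_ge0// mulr_ge0 ?powR_ge0 ?(ltW Ma0).
  by lra.
have q1 : rho * (Ma * psi * psi) <= kappa / 2 * L.
  apply: le_trans (_ : rho * (A * L * (A * k2 / 2)) <= _).
    by rewrite ler_pM2l// ler_pM// mulr_ge0// ltW.
  by rewrite le_eqVlt; apply/orP; left; apply/eqP; rewrite /k2; field; rewrite !gt_eqF.
have q2 : rho * (A * L - k1) <= rho * (Ma * psi) by rewrite ler_pM2l.
have q3 : kappa / 2 * 1 <= kappa / 2 * L by rewrite ler_pM2l// divr_gt0.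
have -> : rho * Ma * (psi * (1 - psi)) = rho * (Ma * psi) - rho * (Ma * psi * psi) by ring.
rewrite /A in q2.
have -> : L * (a ^+ 2 * rho * v * E - kappa) = rho * (a ^+ 2 * E * v * L) - kappa * L by ring.
rewrite mulrBr in q2.
by lra.
Unshelve. all: by end_near. Qed.

End tails.

Section tail_probabilities.
Context {R : realType} {dT : measure_display} {T : measurableType dT}.
Context (P : probability T R) (Y : T -> R) (alpha p v mp : R).
Hypotheses (HY : centred_moments P Y p v mp) (p2 : 2 < p) (alpha0 : 0 < alpha).
Context {I : choiceType} (S : set I) (X : I -> T -> R).
Hypothesis indepX : mutually_independent P S X.
Hypothesis dXY : forall j, S j -> forall A, measurable A ->
  P (X j @^-1` A) = P (Y @^-1` A).

Let v0 : 0 <= v := (moment_ge0 HY).1.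
Let mp0 : 0 <= mp := (moment_ge0 HY).2.
Let c (m : nat) := cscale alpha m.

Lemma small_expR (b eta : R) : 0 < b -> 0 < eta ->
  exists2 delta0 : R, 0 < delta0 &
    forall delta, 0 < delta <= delta0 -> expR (b * delta) <= 1 + eta.
Proof.
move=> b0 e0; exists (ln (1 + eta) / b); first by rewrite divr_gt0// ln_gt0//; lra.
move=> delta /andP[d0 d1]; rewrite -[leRHS]lnK ?posrE; last by lra.
by rewrite ler_expR mulrC -ler_pdivlMr.
Qed.

Lemma powR_expR (m : nat) (e : R) : 0 < (m%:R : R) ->
  m%:R `^ (- e) = expR (- (ln m%:R * e)) :> R.
Proof. by move=> m0; rewrite /powR gt_eqF// mulNr mulrC. Qed.

(** Chernoff with exponent a c(m): since c(m) [nrm alpha m] = 2 ln m, the level x contributes 2 a x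
    to the power of m. The parameter a is left free for the two uses below. *)
Lemma tsum_tail_le (x a delta rho kappa : R) : 0 < a -> 0 < delta -> 0 <= rho -> 0 < kappa ->
  \forall m \near \oo, forall J : seq I, uniq J -> (forall j, j \in J -> S j) ->
    (size J)%:R <= rho * m%:R `^ alpha ->
    (P [set w | (x * nrm alpha m <= tsum alpha X delta m J w)%R] <=
     (m%:R `^ (- (2 * a * x - a ^+ 2 * rho * v * expR (a * delta) - kappa)))%:E)%E.
Proof.
move=> a0 d0 r0 k0.
have h1 := mgf_tsum_le HY p2 alpha0 indepX dXY (ltW a0) d0 r0 k0.
have h3 := @near_le_ln R 1.
near=> m => J uJ JS sJ.
have L1 : 1 <= ln (m%:R : R) by near: m; exact: h3.
have m0 := size_gt0 L1; have c0 := cscale_gt0 alpha L1; rewrite -/(c m) in c0.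
have /(_ J uJ JS sJ) hM : forall J : seq I, uniq J -> (forall j, j \in J -> S j) ->
    (size J)%:R <= rho * m%:R `^ alpha ->
    (\int[P]_w (expR (a * (c m * tsum alpha X delta m J w)))%:E <=
     (expR (ln m%:R * (a ^+ 2 * rho * v * expR (a * delta) + kappa)))%:E)%E.
  by near: m; exact: h1.
have mU : measurable_fun setT (fun w => a * (c m * tsum alpha X delta m J w)).
  by do 2 apply: measurable_funM => //; exact: (measurable_tsum alpha indepX).
have := chernoff_bound (2 * a * x * ln m%:R) mU hM.
rewrite powR_expR// (_ : _ - _ = - (ln m%:R * (2 * a * x
  - a ^+ 2 * rho * v * expR (a * delta) - kappa))); last by ring.
apply: le_trans; rewrite le_eqVlt; apply/orP; left; apply/eqP; congr (P _).
have E w : (x * nrm alpha m <= tsum alpha X delta m J w) =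
    (2 * a * x * ln m%:R <= a * (c m * tsum alpha X delta m J w)).
  have -> : 2 * a * x * ln m%:R = a * (c m * (x * nrm alpha m)).
    by have := cscale_nrm alpha L1; rewrite -/(c m) => e; rewrite [c m * _]mulrCA e; ring.
  by rewrite !ler_pM2l.
by apply/seteqP; split => w /=; rewrite E.
Unshelve. all: by end_near. Qed.

Lemma tsum_upper_tail (x g : R) : 0 < x -> 0 < g -> v * g < x ^+ 2 ->
  exists2 eta : R, 0 < eta & exists2 delta0 : R, 0 < delta0 &
  forall delta, 0 < delta <= delta0 ->
  \forall m \near \oo, forall J : seq I, uniq J -> (forall j, j \in J -> S j) ->
    (size J)%:R <= m%:R `^ alpha ->
    (P [set w | (x * nrm alpha m <= tsum alpha X delta m J w)%R] <=
     (m%:R `^ (- (g * (1 + eta))))%:E)%E.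
Proof.
move=> x0 g0 vg.
have vge0 : 0 <= v by exact: v0.
(* A variance strictly between v and x^2/g: it is positive even when v = 0, and the Chernoff
   exponent x^2/v1 at a = x/v1 still exceeds g. *)
pose y := x ^+ 2 / g; pose v1 := (v + y) / 2.
have xg : v < y by rewrite ltr_pdivlMr.
have v10 : 0 < v1 by rewrite /v1; lra.
have vv1 : v <= v1 by rewrite /v1; lra.
pose q := x ^+ 2 / v1.
have gq : g < q.
  by rewrite /q ltr_pdivlMr// mulrC -ltr_pdivlMr// -/y /v1; lra.
pose eta := (q / g - 1) / 4.
have eta0 : 0 < eta by rewrite divr_gt0// subr_gt0 ltr_pdivlMr// mul1r.
have qE : q = g * (1 + 4 * eta) by rewrite /eta; field; rewrite gt_eqF.
pose a := x / v1.
have a0 : 0 < a by rewrite divr_gt0.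
have q0 : 0 < q by exact: lt_trans gq.
have ge0 : 0 < g * eta by rewrite mulr_gt0.
have [delta0 d00 Hd] := small_expR a0 (divr_gt0 ge0 q0).
exists eta => //; exists delta0 => // delta hd.
have /andP[d0 _] := hd.
have h1 := tsum_tail_le x a0 d0 (ler01 : 0 <= 1 :> R) ge0.
have h3 := @near_le_ln R 1.
near=> m => J uJ JS sJ.
have L1 : 1 <= ln (m%:R : R) by near: m; exact: h3.
have m0 := size_gt0 L1.
have m1 : (1 : R) <= m%:R by rewrite ler1n -(ltr0n R).
rewrite -(mul1r (m%:R `^ alpha)) in sJ.
apply: le_trans (_ : (m%:R `^ (- (2 * a * x - a ^+ 2 * 1 * v * expR (a * delta) - g * eta)))%:E <= _)%E.
  by move: J uJ JS sJ; near: m; exact: h1.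
rewrite lee_fin ler_powR// lerN2.
have e1 := Hd _ hd.
have qe : q * expR (a * delta) <= q + g * eta.
  apply: le_trans (_ : q * (1 + g * eta / q) <= _); first by rewrite ler_pM2l.
  by rewrite le_eqVlt; apply/orP; left; apply/eqP; field; rewrite gt_eqF.
have av : a ^+ 2 * 1 * v * expR (a * delta) <= q * expR (a * delta).
  rewrite ler_pM2r ?expR_gt0// mulr1.
  have -> : q = a ^+ 2 * v1 by rewrite /q /a; field; rewrite gt_eqF.
  by rewrite ler_wpM2l// sqr_ge0.
have ax : 2 * a * x = 2 * q by rewrite /q /a; field; rewrite gt_eqF.
have ge1 : g * (1 + eta) = q - 3 * (g * eta) by rewrite qE; ring.
by rewrite ge1 ax; lra.
Unshelve. all: by end_near. Qed.

(* The error made by rounding a corner down to the grid is a sum over such a block. *)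
Lemma tsum_small_block_tail (eta D : R) : 0 < eta -> 0 < D ->
  exists2 delta0 : R, 0 < delta0 & exists2 rho : R, 0 < rho &
  forall delta, 0 < delta <= delta0 ->
  \forall m \near \oo, forall J : seq I, uniq J -> (forall j, j \in J -> S j) ->
    (size J)%:R <= rho * m%:R `^ alpha ->
    (P [set w | (eta * nrm alpha m <= tsum alpha X delta m J w)%R] <=
     (m%:R `^ (- D))%:E)%E.
Proof.
move=> eta0 D0.
(* The level gives 2 a eta = D + 2. One of the two spare units covers the variance term, made at
   most 1 by the small [rho] and [delta], the other is kappa = 1. *)
pose a := (D + 2) / (2 * eta).
have a0 : 0 < a by rewrite divr_gt0 ?mulr_gt0//; lra.
pose rho := (2 * (a ^+ 2 * (v + 1)))^-1.
have vge0 : 0 <= v by exact: v0.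
have v10 : 0 < v + 1 by lra.
have av0 : 0 < a ^+ 2 * (v + 1) by rewrite mulr_gt0// exprn_gt0.
have r0 : 0 < rho by rewrite invr_gt0 mulr_gt0.
have [delta0 d00 Hd] := small_expR a0 (ltr01 : 0 < 1 :> R).
exists delta0 => //; exists rho => // delta hd.
have /andP[d0 _] := hd.
have h1 := tsum_tail_le eta a0 d0 (ltW r0) (ltr01 : 0 < 1 :> R).
have h3 := @near_le_ln R 1.
near=> m => J uJ JS sJ.
have L1 : 1 <= ln (m%:R : R) by near: m; exact: h3.
have m0 := size_gt0 L1.
have m1 : (1 : R) <= m%:R by rewrite ler1n -(ltr0n R).
apply: le_trans (_ : (m%:R `^ (- (2 * a * eta - a ^+ 2 * rho * v * expR (a * delta) - 1)))%:E <= _)%E.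
  by move: J uJ JS sJ; near: m; exact: h1.
rewrite lee_fin ler_powR// lerN2.
have e1 := Hd _ hd.
have ae : 2 * a * eta = D + 2 by rewrite /a; field; rewrite gt_eqF.
have : a ^+ 2 * rho * v * expR (a * delta) <= a ^+ 2 * rho * (v + 1) * 2.
  have ar : 0 <= a ^+ 2 * rho by rewrite mulr_ge0 ?sqr_ge0 ?(ltW r0).
  apply: ler_pM; [exact: mulr_ge0|exact: expR_ge0| |by lra].
  by apply: ler_wpM2l => //; lra.
have -> : a ^+ 2 * rho * (v + 1) * 2 = 1.
  by rewrite /rho; field; rewrite !gt_eqF.
by rewrite ae; lra.
Unshelve. all: by end_near. Qed.

(** The expected number of exceedances is at most m^(-tau), so at exponent tau ln m the moment
    generating function is at most e, and K exceedances have probability at most e m^(-tau K). The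
    extra 1 in K tau >= D + 1 absorbs the factor e. *)
Lemma exceed_count_tail (D : R) : 0 < D ->
  exists K : nat, forall delta, 0 < delta ->
  \forall m \near \oo, forall J : seq I, uniq J -> (forall j, j \in J -> S j) ->
    (size J)%:R <= m%:R `^ alpha ->
    (P [set w | (K%:R <= \sum_(j <- J) (delta / cscale alpha m < `|X j w|)%R%:R :> R)%R] <=
     (m%:R `^ (- D))%:E)%E.
Proof.
move=> D0; have [tau t0 Htau] := near_cscale_powR alpha0 p2.
pose K := (Num.truncn ((D + 1) / tau)).+1.
have Kt : D + 1 <= K%:R * tau by rewrite -ler_pdivrMr// ltW// truncnS_gt.
exists K => delta d0.
have K0 : 0 <= delta `^ (- p) * mp by rewrite mulr_ge0// powR_ge0.
have h1 := Htau _ K0; have h3 := @near_le_ln R 1.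
near=> m => J uJ JS sJ.
have L1 : 1 <= ln (m%:R : R) by near: m; exact: h3.
have m0 := size_gt0 L1; have c0 := cscale_gt0 alpha L1; rewrite -/(c m) in c0.
have hK : delta `^ (- p) * mp * (m%:R `^ alpha * c m `^ p) <= m%:R `^ (- tau) by near: m; exact: h1.
pose lam := tau * ln (m%:R : R).
have lam0 : 0 < lam by rewrite mulr_gt0//; lra.
have b0 : 0 < delta / c m by rewrite divr_gt0.
have mt : measurable_fun setT (fun y : R => lam * (delta / c m < `|y|)%R%:R).
  by apply: measurable_funM => //; exact: measurable_exceed.
have mU := measurable_sum_coord indepX JS mt.
have hM : (\int[P]_w (expR (\sum_(j <- J) lam * (delta / c m < `|X j w|)%R%:R))%:E <=
    (expR 1)%:E)%E.
  apply: le_trans (mgf_sum_exceed_le HY (ltW p2) indepX dXY lam uJ JS b0) _.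
  rewrite lee_fin ler_expR.
  have -> : expR lam = m%:R `^ tau by rewrite /powR gt_eqF.
  have -> : (delta / c m) `^ (- p) = delta `^ (- p) * c m `^ p.
    have := scaled_b_powR alpha p d0 L1 0; rewrite sub0r subr0; exact.
  apply: le_trans (_ : m%:R `^ alpha * (m%:R `^ tau * (delta `^ (- p) * c m `^ p) * mp) <= _).
    by rewrite ler_wpM2r// !mulr_ge0 ?powR_ge0.
  have -> : m%:R `^ alpha * (m%:R `^ tau * (delta `^ (- p) * c m `^ p) * mp) =
     m%:R `^ tau * (delta `^ (- p) * mp * (m%:R `^ alpha * c m `^ p)) by ring.
  apply: le_trans (_ : m%:R `^ tau * m%:R `^ (- tau) <= _).
    by rewrite ler_wpM2l// powR_ge0.
  by rewrite powRN divff// gt_eqF// powR_gt0.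
have := chernoff_bound (lam * K%:R) mU hM.
rewrite powR_expR//; move=> H; apply: le_trans (_ : (expR (1 - lam * K%:R))%:E <= _)%E; last first.
  rewrite lee_fin ler_expR /lam; have : (D + 1) * ln (m%:R : R) <= (K%:R * tau) * ln (m%:R : R).
    by rewrite ler_wpM2r//; lra.
  by lra.
apply: le_trans H; rewrite le_eqVlt; apply/orP; left; apply/eqP; congr (P _).
by apply/seteqP; split => w /=; rewrite -mulr_sumr ler_pM2l.
Unshelve. all: by end_near. Qed.

(** The tilt is the optimal theta/v lowered by the factor 1 - e. The tilted sum concentrates within
    relative distance e/4 of its centre, which lies above the level wanted; the cost g (1 - e)^2 (1
    + e/2) plus errors stays below g (1 - e/2). *)
Lemma tsum_lower_tail (theta g e : R) : 0 < theta -> 0 < v -> theta ^+ 2 = v * g ->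
  0 < e < 1 / 2 ->
  exists2 delta0 : R, 0 < delta0 & exists2 rho : R, 0 < rho < 1 &
  forall delta, 0 < delta <= delta0 ->
  \forall m \near \oo, forall J : seq I, uniq J -> (forall j, j \in J -> S j) ->
    rho * m%:R `^ alpha <= (size J)%:R <= m%:R `^ alpha ->
    ((m%:R `^ (- (g * (1 - e / 2))))%:E <=
     P [set w | (theta * (1 - 2 * e) * nrm alpha m < tsum alpha X delta m J w)%R])%E.
Proof.
move=> th0 vp thg /andP[e0 e1].
have g0 : 0 < g by rewrite -(pmulr_rgt0 _ vp) -thg exprn_gt0.
pose a := theta / v * (1 - e).
have a0 : 0 < a by rewrite mulr_gt0 ?divr_gt0//; lra.
have a2v : a ^+ 2 * v = g * (1 - e) ^+ 2.
  have -> : a ^+ 2 * v = theta ^+ 2 / v * (1 - e) ^+ 2.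
    by rewrite /a; field; rewrite gt_eqF.
  by rewrite thg; field; rewrite gt_eqF.
pose t := a * (e / 4).
have t0 : 0 < t by rewrite mulr_gt0// divr_gt0.
have ta : t <= a by rewrite /t ler_piMr ?(ltW a0)//; lra.
(* Error allowance in the exponents: the first bound keeps it below the gain t^2 v of the masses
   outside the interval, the second below the slack in the final exponent. *)
pose kap := Num.min (t ^+ 2 * v / 3) (g * e / 16).
have kap0 : 0 < kap.
  have ? : 0 < t ^+ 2 * v by rewrite mulr_gt0// exprn_gt0.
  have ? : 0 < g * e by exact: mulr_gt0.
  by rewrite lt_min !divr_gt0.
have kap1 : 3 * kap <= t ^+ 2 * v.
  have : kap <= t ^+ 2 * v / 3 by rewrite ge_min lexx.
  by lra.
have kap2 : 16 * kap <= g * e.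
  have : kap <= g * e / 16 by rewrite ge_min lexx orbT.
  by lra.
pose k1 := kap / 2.
have k10 : 0 < k1 by rewrite divr_gt0.
have k1E : k1 = kap / 2 by [].
pose b := a + t.
have b0 : 0 < b by rewrite addr_gt0.
have bv0 : 0 < b ^+ 2 * v by rewrite mulr_gt0// exprn_gt0.
pose eta := Num.min 1 (k1 / (b ^+ 2 * v)).
have eta0 : 0 < eta by rewrite lt_min ltr01 divr_gt0.
have eta1 : eta <= 1 by rewrite ge_min lexx.
have etab : b ^+ 2 * v * eta <= k1.
  have : eta <= k1 / (b ^+ 2 * v) by rewrite ge_min lexx orbT.
  by rewrite ler_pdivlMr// mulrC.
have e20 : 0 < eta / 2 by rewrite divr_gt0.
have [delta0 d00 Hd] := small_expR b0 e20.
exists delta0 => //; exists (1 - eta / 2); first by apply/andP; split; lra.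
move=> delta hd; have /andP[d0 _] := hd; have eb := Hd _ hd.
have rho0 : 0 < 1 - eta / 2 by lra.
have s0 : 0 <= a - t by lra.
have gk : g * (1 - e) ^+ 2 * (1 + e / 2) + 2 * kap <= g * (1 - e / 2).
  have : g * ((1 - e) ^+ 2 * (1 + e / 2)) <= g * (1 - e).
    rewrite ler_pM2l//; have : e * e * e <= e * (1/2) by nra.
    by lra.
  have : 0 <= g * e by rewrite mulr_ge0// ltW.
  by lra.
(* With kap ln m >= 2 this makes each of the two outside masses at most a quarter of the total. *)
have e4 : (4 : R) <= expR 2.
  have -> : (2 : R) = 1 + 1 by ring.
  have := @expR_ge1Dx R 1; rewrite expRD => z.
  have : 2 * 2 <= expR 1 * expR 1 :> R by apply: ler_pM => //; lra.
  by lra.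
have tk : (a ^+ 2 - t ^+ 2) * v + kap <= a ^+ 2 * v - 2 * kap by lra.
have up s : 0 <= s <= b -> s ^+ 2 * 1 * v * expR (s * delta) + k1 <= s ^+ 2 * v + kap.
  move=> /andP[s1 s2].
  have es : expR (s * delta) <= 1 + eta / 2.
    by apply: le_trans eb; rewrite ler_expR ler_pM2r.
  have sb : s ^+ 2 * v <= b ^+ 2 * v by rewrite ler_pM2r// lerXn2r// nnegrE// ltW.
  have : s ^+ 2 * v * expR (s * delta) <= s ^+ 2 * v * (1 + eta / 2).
    by rewrite ler_wpM2l// mulr_ge0// sqr_ge0.
  have : s ^+ 2 * v * eta <= b ^+ 2 * v * eta by rewrite ler_pM2r.
  by rewrite mulr1; lra.
have lo_a : a ^+ 2 * v - kap <= a ^+ 2 * (1 - eta / 2) * v * expR (- (a * delta)) - k1.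
  have ea : 1 - eta / 2 <= expR (- (a * delta)).
    have : expR (a * delta) <= 1 + eta / 2.
      by apply: le_trans eb; rewrite ler_expR ler_pM2r// /b; lra.
    have xy : expR (a * delta) * expR (- (a * delta)) = 1 by exact: expRxMexpNx_1.
    have y0 := expR_gt0 (- (a * delta)).
    move=> h; have : expR (a * delta) * expR (- (a * delta)) <= (1 + eta / 2) * expR (- (a * delta)).
      by rewrite ler_pM2r.
    rewrite xy => h'; rewrite -(ler_pM2l (_ : 0 < 1 + eta / 2)); last by lra.
    apply: le_trans h'; have : 0 <= eta * eta by rewrite mulr_ge0// ltW.
    by lra.
  have av : a ^+ 2 * v <= b ^+ 2 * v.
    by rewrite ler_pM2r// lerXn2r// ?nnegrE ?(ltW a0) ?(ltW b0)// /b; lra.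
  have av0 : 0 < a ^+ 2 * v by rewrite mulr_gt0// exprn_gt0.
  have x1 : a ^+ 2 * v * (1 - eta / 2) * (1 - eta / 2) <=
      a ^+ 2 * v * (1 - eta / 2) * expR (- (a * delta)).
    by rewrite ler_pM2l// mulr_gt0.
  have x2 : a ^+ 2 * v * eta <= b ^+ 2 * v * eta by rewrite ler_pM2r.
  have x3 : 0 <= a ^+ 2 * v * (eta * eta) by rewrite mulr_ge0 ?(ltW av0)// mulr_ge0// ltW.
  by rewrite [a ^+ 2 * (1 - eta / 2) * v]mulrAC; lra.
have h3 := @near_le_ln R 1.
have h5 := @near_le_ln R (2 / kap).
have hup s : 0 <= s <= b -> \forall m \near \oo, forall J : seq I, uniq J ->
    (forall j, j \in J -> S j) -> (size J)%:R <= m%:R `^ alpha ->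
    (\int[P]_w (expR (s * (c m * tsum alpha X delta m J w)))%:E <=
     (expR (ln m%:R * (s ^+ 2 * v + kap)))%:E)%E.
  move=> sb; have /andP[s1 _] := sb.
  have h := mgf_tsum_le HY p2 alpha0 indepX dXY s1 d0 ler01 k10.
  apply: filterS2 h h3 => m Hm L1 J uJ JS sJ.
  apply: le_trans (Hm J uJ JS _) _; first by rewrite mul1r.
  by rewrite lee_fin ler_expR ler_wpM2l ?up// ltW// ln_size_gt0.
have hlo : \forall m \near \oo, forall J : seq I, uniq J ->
    (forall j, j \in J -> S j) -> (1 - eta / 2) * m%:R `^ alpha <= (size J)%:R ->
    ((expR (ln m%:R * (a ^+ 2 * v - kap)))%:E <=
     \int[P]_w (expR (a * (c m * tsum alpha X delta m J w)))%:E)%E.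
  have h := mgf_tsum_ge HY p2 alpha0 indepX dXY vp a0 d0 rho0 k10.
  apply: filterS2 h h3 => m Hm L1 J uJ JS sJ.
  apply: le_trans (Hm J uJ JS sJ).
  by rewrite lee_fin ler_expR ler_wpM2l ?lo_a// ltW// ln_size_gt0.
have h1 : 0 <= a + t <= b by rewrite (ltW b0) lexx.
have h2 : 0 <= a - t <= b by apply/andP; split => //; rewrite /b; lra.
apply: filterS (filterI (filterI h3 h5) (filterI (hup _ h1) (filterI (hup _ h2) hlo))).
move=> m [[L1 L2] [B1 [B2 A]]] J uJ JS /andP[sJ1 sJ2].
have {}B1 := B1 J uJ JS sJ2; have {}B2 := B2 J uJ JS sJ2; have {}A := A J uJ JS sJ1.
have m0 := size_gt0 L1; have c0 := cscale_gt0 alpha L1; rewrite -/(c m) in c0.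
set L := ln (m%:R : R) in L1 L2 B1 B2 A *.
have L0 : 0 < L := lt_le_trans ltr01 L1.
have kL : 2 <= kap * L by rewrite mulrC -ler_pdivrMr.
have mU : measurable_fun setT (fun w => c m * tsum alpha X delta m J w).
  by apply: measurable_funM => //; exact: (measurable_tsum alpha indepX).
have H := tilting_bound (2 * (a - t) * v * L) (2 * b * v * L) mU (ltW a0) (ltW t0)
  (expR_ge0 _) (expR_ge0 _) A B1 B2.
have {}H : ((expR (L * (a ^+ 2 * v - 2 * kap)))%:E <= (expR (a * (2 * b * v * L)))%:E *
    P [set w | (2 * (a - t) * v * L < c m * tsum alpha X delta m J w)%R])%E.
  apply: le_trans H; rewrite lee_fin -!expRD.
  have -> : - (t * (2 * b * v * L)) + L * (b ^+ 2 * v + kap) =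
      L * ((a ^+ 2 - t ^+ 2) * v + kap) by rewrite /b; ring.
  have -> : t * (2 * (a - t) * v * L) + L * ((a - t) ^+ 2 * v + kap) =
      L * ((a ^+ 2 - t ^+ 2) * v + kap) by ring.
  have w1 : expR (L * ((a ^+ 2 - t ^+ 2) * v + kap)) <= expR (L * (a ^+ 2 * v - 2 * kap)).
    by rewrite ler_expR ler_pM2l.
  have w2 : 4 * expR (L * (a ^+ 2 * v - 2 * kap)) <= expR (L * (a ^+ 2 * v - kap)).
    have -> : L * (a ^+ 2 * v - kap) = kap * L + L * (a ^+ 2 * v - 2 * kap) by ring.
    rewrite expRD ler_pM2r ?expR_gt0//.
    by apply: le_trans e4 _; rewrite ler_expR.
  by have := expR_gt0 (L * (a ^+ 2 * v - 2 * kap)); lra.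
have mE x : measurable [set w | (x < c m * tsum alpha X delta m J w)%R].
  rewrite (_ : [set w | _] = setT `&` (fun w => c m * tsum alpha X delta m J w) @^-1` `]x, +oo[%classic).
    exact: mU.
  by rewrite setTI; apply/seteqP; split => w /=; rewrite in_itv/= andbT.
have E w : (theta * (1 - 2 * e) * nrm alpha m < tsum alpha X delta m J w) =
    (2 * theta * (1 - 2 * e) * L < c m * tsum alpha X delta m J w).
  have -> : 2 * theta * (1 - 2 * e) * L = c m * (theta * (1 - 2 * e) * nrm alpha m).
    by have := cscale_nrm alpha L1; rewrite -/(c m) -/L => e'; rewrite [c m * _]mulrCA e'; ring.
  by rewrite ltr_pM2l.
have -> : [set w | (theta * (1 - 2 * e) * nrm alpha m < tsum alpha X delta m J w)%R] =
    [set w | (2 * theta * (1 - 2 * e) * L < c m * tsum alpha X delta m J w)%R].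
  by apply/seteqP; split => w /=; rewrite E.
apply: le_trans (_ : P [set w | (2 * (a - t) * v * L < c m * tsum alpha X delta m J w)%R] <= _)%E; last first.
  apply: le_measure; rewrite ?inE//=; try exact: mE.
  move=> w /=; apply: le_lt_trans; rewrite ler_pM2r// /t.
  have -> : 2 * (a - a * (e / 4)) * v = 2 * theta * ((1 - e) * (1 - e / 4)).
    by rewrite /a; field; rewrite gt_eqF.
  rewrite ler_pM2l ?mulr_gt0//.
  by have : 0 <= e * e by [rewrite mulr_ge0// ltW]; lra.
rewrite -(@lee_pmul2l _ (expR (a * (2 * b * v * L)))%:E) ?lte_fin ?expR_gt0//.
apply: le_trans H; rewrite powR_expR// -/L -EFinM -expRD lee_fin ler_expR.
have ab : a * (2 * b * v * L) = L * (2 * (a ^+ 2 * v) * (1 + e / 4)) by rewrite /b /t; ring.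
rewrite ab a2v.
by have := ler_wpM2l (ltW L0) gk; lra.
Qed.

End tail_probabilities.

(** * Large summands and the truncation error *)

Section factorization_lists.
Context {d : nat}.

Definition fac_seq (m : nat) : seq (idx d) :=
  map (fun t : {ffun 'I_d -> 'I_m.+1} => [ffun i => nat_of_ord (t i)] : idx d)
    (enum (factorizations d m)).

Lemma size_fac_seq m : size (fac_seq m) = #|factorizations d m|.
Proof. by rewrite size_map -cardE. Qed.

Lemma mem_fac_seq (m : nat) (n : idx d) : (0 < m)%N ->
  (n \in fac_seq m) = (idx_size n == m).
Proof.
move=> m0; apply/mapP/eqP => [[t] | nm].
  rewrite mem_enum inE => /eqP tm ->; rewrite -[RHS]tm; apply: eq_bigr => i _.
  by rewrite ffunE.
have nim i : (n i < m.+1)%N.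
  rewrite ltnS; apply: dvdn_leq => //; rewrite -nm /idx_size (bigD1 i)//=.
  exact: dvdn_mulr.
exists [ffun i => Ordinal (nim i)].
  rewrite mem_enum inE; apply/eqP; rewrite -[RHS]nm; apply: eq_bigr => i _.
  by rewrite ffunE.
by apply/ffunP => i; rewrite !ffunE.
Qed.

Lemma pos_idxP (n : idx d) : pos_idx n <-> (0 < idx_size n)%N.
Proof.
split=> [n0|n0 i]; first exact: prodn_gt0.
by move: n0; rewrite /idx_size (bigD1 i)//= muln_gt0 => /andP[].
Qed.

Lemma sum_factorizations_le (X : nat) :
  (\sum_(1 <= m < X.+1) #|factorizations d m| <= #|lattice_points d X|)%N.
Proof.
pose pr (j : {ffun 'I_d -> 'I_X.+1}) := (\prod_(i < d) j i)%N.
have fib m : (1 <= m < X.+1)%N ->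
    (#|factorizations d m| <= #|[set j in lattice_points d X | pr j == m]|)%N.
  move=> /andP[m1 mX].
  have wm : (m.+1 <= X.+1)%N by [].
  pose f (t : {ffun 'I_d -> 'I_m.+1}) : {ffun 'I_d -> 'I_X.+1} :=
    [ffun i => widen_ord wm (t i)].
  have injf : injective f.
    move=> t t' E; apply/ffunP => i; apply/val_inj.
    by have := congr1 (fun g : {ffun 'I_d -> 'I_X.+1} => val (g i)) E; rewrite !ffunE.
  rewrite -(card_imset _ injf); apply: subset_leq_card.
  apply/fintype.subsetP => _ /imsetP[t + ->]; rewrite !inE => /eqP tm.
  have prf : (\prod_(i < d) f t i)%N = m.
    by rewrite -[RHS]tm; apply: eq_bigr => i _; rewrite ffunE.
  rewrite /pr prf eqxx andbT; apply/andP; split; last by [].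
  apply/forallP => i; rewrite lt0n; apply/negP => /eqP E.
  by move: prf; rewrite (bigD1 i)//= E mul0n => m0; rewrite -m0 in m1.
apply: leq_trans (_ : \sum_(1 <= m < X.+1) #|[set j in lattice_points d X | pr j == m]| <= _)%N.
  by rewrite big_nat_cond [leqRHS]big_nat_cond; apply: leq_sum => m /andP[/fib].
have E m : #|[set j in lattice_points d X | pr j == m]| =
    (\sum_(j in lattice_points d X) (pr j == m))%N.
  by rewrite -sum1dep_card big_mkcondr /=; apply: eq_bigr => j _; case: eqP.
under eq_bigr => m _ do rewrite E.
rewrite exchange_big /= -[leqRHS]sum1_card; apply: leq_sum => j _.
have -> : (\sum_(1 <= m < X.+1) (pr j == m))%N = count (pred1 (pr j)) (index_iota 1 X.+1).
  rewrite -sum1_count [RHS]big_mkcond /=; apply: eq_bigr => m _.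
  by rewrite eq_sym; case: eqP.
by rewrite count_uniq_mem ?iota_uniq//; case: (_ \in _).
Qed.

End factorization_lists.

Section lattice_moment.
Context {R : realType}.

Lemma logp_ge1 (x : R) : 1 <= logp x.
Proof. by rewrite /logp le_max lexx orbT. Qed.

Lemma logp_gt0 (x : R) : 0 < logp x.
Proof. exact: lt_le_trans (logp_ge1 x). Qed.

Lemma logp_scale_le (a x : R) : 0 < a -> 0 < x -> logp (a * x) <= (1 + `|ln a|) * logp x.
Proof.
move=> a0 x0; have l1 := logp_ge1 x.
have lx : ln x <= logp x by rewrite /logp le_max lexx.
have n0 := normr_ge0 (ln a); have na := ler_norm (ln a).
have h : `|ln a| * 1 <= `|ln a| * logp x by rewrite ler_wpM2l.
rewrite {1}/logp ge_max lnM ?posrE//; apply/andP; split; first by lra.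
by lra.
Qed.

(** The sum of both powers of A covers both signs of s; the logarithmic exponent d - 1 - 1/alpha may
    have either. *)
Lemma powR_ratio_le (x y A s : R) : 0 < x -> 0 < y -> 0 < A -> x <= A * y -> y <= A * x ->
  x `^ s <= (A `^ s + A `^ (- s)) * y `^ s.
Proof.
move=> x0 y0 A0 xy yx; rewrite mulrDl.
have [s0|/ltW s0] := leP 0 s.
  apply: ler_wpDr; first by rewrite mulr_ge0 ?powR_ge0.
  rewrite -powRM ?(ltW A0) ?(ltW y0)//.
  by apply: ge0_ler_powR; rewrite ?nnegrE ?(ltW x0) ?mulr_ge0 ?(ltW A0) ?(ltW y0).
apply: ler_wpDl; first by rewrite mulr_ge0 ?powR_ge0.
have r0 : 0 <= - s by rewrite oppr_ge0.
have e (z : R) : z `^ s = (z `^ (- s))^-1 by rewrite powRN invrK.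
rewrite [leLHS]e [y `^ s]e ler_pdivlMr ?powR_gt0// mulrC ler_pdivrMr ?powR_gt0//.
rewrite -powRM ?(ltW A0) ?(ltW x0)//.
by apply: ge0_ler_powR; rewrite ?nnegrE ?(ltW y0) ?mulr_ge0 ?(ltW A0) ?(ltW x0).
Qed.

(** Here the moment condition originates. The points j with delta [nrm alpha |j|] < y have size at
    most x, of order (y^2 / log y)^(1/alpha), and the count x (log x)^(d-1) is of order y^(2/alpha)
    (log y)^(d-1-1/alpha). *)
Lemma lattice_moment_bound (alpha delta : R) (e : nat) : 0 < alpha < 1 -> 0 < delta ->
  exists2 C : R, 0 <= C & forall (y : R) (n : nat), 0 <= y ->
    \sum_(1 <= m < n | (1 <= ln (m%:R : R)) && (delta * nrm alpha m < y))
      #|factorizations e.+1 m|%:R <=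
    C * (y `^ (2 / alpha) * logp y `^ (e.+1%:R - 1 - 1 / alpha)).
Proof.
move=> /andP[a0 a1] d0.
pose s : R := e.+1%:R - 1 - 1 / alpha.
pose A := 1 + `|ln delta|.
have A0 : 0 < A by have := normr_ge0 (ln delta); rewrite /A; lra.
pose C1 := (1 + 2 / alpha) ^+ e.
have C10 : 0 <= C1 by rewrite exprn_ge0// addr_ge0// divr_ge0// ltW.
pose C2 := (delta^-1) `^ (2 / alpha) * (A `^ s + A `^ (- s)).
have C20 : 0 <= C2 by rewrite mulr_ge0 ?addr_ge0 ?powR_ge0.
exists (C1 * C2); first exact: mulr_ge0.
move=> y n y0; rewrite -/s.
have rhs0 : 0 <= C1 * C2 * (y `^ (2 / alpha) * logp y `^ s).
  by apply: mulr_ge0; [exact: mulr_ge0|apply: mulr_ge0; exact: powR_ge0].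
pose Q m := (1 <= ln (m%:R : R)) && (delta * nrm alpha m < y).
pose z := y / delta.
have z0 : 0 <= z by rewrite divr_ge0// ltW.
have Qz m : Q m -> m%:R `^ alpha * ln m%:R < z ^+ 2 /\ 1 < z.
  move=> /andP[L1 hy]; have m0 := size_gt0 L1.
  have nz : nrm alpha m < z by rewrite /z ltr_pdivlMr// mulrC.
  have n0 := nrm_gt0 alpha L1.
  have h : nrm alpha m ^+ 2 < z ^+ 2 by rewrite ltrXn2r// ?nnegrE// ltW.
  rewrite sqr_nrm// in h.
  have m1 : (1 : R) <= m%:R by rewrite ler1n -(ltr0n R).
  have ma1 : 1 <= (m%:R : R) `^ alpha.
    have : (m%:R : R) `^ 0 <= m%:R `^ alpha by apply: ler_powR => //; exact: ltW.
    by rewrite powRr0.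
  have p1 : 1 <= m%:R `^ alpha * ln (m%:R : R).
    by rewrite -[leLHS]mulr1; apply: ler_pM.
  split; first by lra.
  by rewrite -(@ltr_pXn2r _ 2) ?nnegrE// expr1n; lra.
(* An actual term of the sum forces z > 1, on which the logarithmic estimates below rely; without
   one the sum is 0. *)
have [/hasP[m0 _ Qm0]|/hasPn noQ] := boolP (has Q (index_iota 1 n)); last first.
  rewrite big1_seq// => m /andP[Qm mn]; have := noQ m mn.
  by rewrite /Q Qm.
have [_ z1] := Qz _ Qm0.
have zp : 0 < z by lra.
have lz := logp_gt0 z; have lz1 := logp_ge1 z.
have zl : logp z <= z.
  by rewrite /logp ge_max (ltW z1) andbT; apply/ltW/ln_sublinear.
pose x := (z ^+ 2 / logp z) `^ (alpha^-1).
have w0 : 0 < z ^+ 2 / logp z by rewrite divr_gt0// exprn_gt0.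
have x0 : 0 < x by rewrite powR_gt0.
have Qx m : Q m -> m%:R <= x.
  move=> Qm; have [hz _] := Qz m Qm; have /andP[L1 _] := Qm.
  have m0' := size_gt0 L1.
  suff : m%:R `^ alpha <= z ^+ 2 / logp z.
    move=> h; have -> : m%:R = (m%:R `^ alpha) `^ (alpha^-1) :> R.
      by rewrite -powRrM divff ?gt_eqF// powRr1// ltW.
    by apply: ge0_ler_powR; rewrite ?nnegrE ?invr_ge0 ?powR_ge0 ?(ltW a0) ?(ltW w0).
  rewrite ler_pdivlMr//.
  (* To replace ln m by log z in m^alpha ln m < z^2: if m^alpha <= z, then log z <= z suffices;
     otherwise ln z < alpha ln m <= ln m. *)
  have [mz|mz] := leP (m%:R `^ alpha) z.
    by rewrite expr2; apply: ler_pM; rewrite ?powR_ge0 ?(ltW lz).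
  apply: le_trans (ltW hz); rewrite ler_wpM2l ?powR_ge0//.
  rewrite /logp ge_max L1 andbT.
  have : ln z <= ln (m%:R `^ alpha) by rewrite ler_ln ?posrE ?powR_gt0// ltW.
  rewrite ln_powR => h; apply: le_trans h _.
  by rewrite ler_piMl//; [exact: le_trans L1|exact: ltW].
pose X := Num.truncn x.
have x1 : 1 <= x.
  apply: le_trans (Qx _ Qm0); have /andP[L1 _] := Qm0.
  by rewrite ler1n -(ltr0n R); exact: size_gt0.
have X1 : (0 < X)%N by rewrite truncn_gt0.
have Xx : X%:R <= x by have /andP[] := truncn_itv (ltW x0).
have X1R : (1 : R) <= X%:R by rewrite ler1n.
apply: le_trans (_ : (\sum_(1 <= m < X.+1) #|factorizations e.+1 m|)%:R <= _).
  rewrite natr_sum big_mkcond /=.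
  apply: le_trans (_ : \sum_(1 <= m < maxn n X.+1) (if Q m then #|factorizations e.+1 m|%:R else 0) <= _).
    have [->|n0] := posnP n.
      rewrite big_geq// sumr_ge0// => m _; by case: ifP.
    rewrite [leRHS](@big_cat_nat _ _ _ n)//=; last by rewrite leq_maxl.
    by rewrite lerDl sumr_ge0// => m _; case: ifP.
  rewrite (@big_cat_nat _ _ _ X.+1)//=; last by rewrite leq_maxr.
  rewrite [X in _ + X](_ : _ = 0) ?addr0.
    by apply: ler_sum => m _; case: ifP.
  rewrite big_nat_cond big1// => m /andP[/andP[Xm _] _]; case: ifP => // /Qx mx.
  have : (x < X.+1%:R) by rewrite /X truncnS_gt.
  have : (X.+1%:R : R) <= m%:R by rewrite ler_nat.
  by lra.
apply: le_trans (_ : X%:R * (1 + ln X%:R) ^+ e <= _).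
  apply: le_trans (@card_lattice_points_le R e X X1).
  by rewrite ler_nat; exact: sum_factorizations_le.
have lx : ln x <= 2 / alpha * logp z.
  rewrite ln_powR ln_div ?posrE ?exprn_gt0// lnXn//.
  have ll : 0 <= ln (logp z) by exact: ln_ge0.
  have lzz : ln z <= logp z by rewrite /logp le_max lexx.
  rewrite [2 / alpha]mulrC -mulrA ler_pM2l ?invr_gt0//.
  by rewrite -mulr_natr; lra.
have h1 : X%:R * (1 + ln X%:R) ^+ e <= x * ((1 + 2 / alpha) * logp z) ^+ e.
  apply: ler_pM => //.
    by rewrite exprn_ge0// addr_ge0// ln_ge0.
  rewrite lerXn2r// ?nnegrE ?addr_ge0 ?ln_ge0//.
    by rewrite mulr_ge0 ?(ltW lz)// addr_ge0// divr_ge0// ltW.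
  have : ln (X%:R : R) <= ln x by rewrite ler_ln// posrE ltr0n.
  by rewrite mulrDl mul1r; lra.
apply: le_trans h1 _.
have -> : x * ((1 + 2 / alpha) * logp z) ^+ e = C1 * (z `^ (2 / alpha) * logp z `^ s).
  rewrite exprMn -/C1 mulrCA; congr (_ * _).
  rewrite /x powRM ?invr_ge0 ?sqr_ge0 ?(ltW lz)// -mulrA; congr (_ * _).
    by rewrite -powR_mulrn// -powRrM.
  rewrite -(powR_mulrn e (ltW lz)) -powR_inv1 ?(ltW lz)// -powRrM -powRD ?(gt_eqF lz) ?implybT//.
  by congr (_ `^ _); rewrite /s -natr1; field; rewrite gt_eqF.
rewrite -mulrA ler_wpM2l// /C2 mulrACA.
have yE : y = delta * z by rewrite /z; field; rewrite gt_eqF.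
have yp : 0 < y by rewrite yE mulr_gt0.
apply: ler_pM; rewrite ?powR_ge0//.
  by rewrite -powRM ?invr_ge0 ?(ltW d0)// [_^-1 * y]mulrC.
apply: powR_ratio_le => //; first exact: logp_gt0.
  have di : 0 < delta^-1 by rewrite invr_gt0.
  have := logp_scale_le di yp; rewrite lnV ?posrE// normrN -/A.
  by rewrite /z [y / _]mulrC.
by rewrite {1}yE; exact: logp_scale_le.
Qed.

End lattice_moment.

Section union_bound.
Context {R : realType} {dT : measure_display} {T : measurableType dT}.
Context (P : probability T R) {I : eqType}.

Lemma union_bound (s : seq I) (A : I -> set T) : (forall j, j \in s -> measurable (A j)) ->
  measurable [set w | exists2 j, j \in s & A j w] /\
  (P [set w | exists2 j, j \in s & A j w] <= \sum_(j <- s) P (A j))%E.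
Proof.
elim: s => [|j s IH] mA.
  rewrite big_nil (_ : [set w | _] = set0) ?measure0//.
  by apply/seteqP; split => // w [].
have [|mS PS] := IH; first by move=> k ks; apply: mA; rewrite inE ks orbT.
have mj : measurable (A j) by apply: mA; exact: mem_head.
have -> : [set w | exists2 k, k \in j :: s & A k w] =
    A j `|` [set w | exists2 k, k \in s & A k w].
  apply/seteqP; split => w /=.
    by move=> [k]; rewrite inE => /orP[/eqP->|ks Ak]; [left|right; exists k].
  move=> [Aj|[k ks Ak]]; first by exists j => //; exact: mem_head.
  by exists k => //; rewrite inE ks orbT.
split; first exact: measurableU.
rewrite big_cons; apply: le_trans (measureU2 _ mj mS) _.
exact: leeD.
Qed.

End union_bound.

Section powers_of_indices.
Context {R : realType} {d : nat}.
Implicit Types n j k : idx d.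

Lemma prod_powR (alpha : R) (n : idx d) :
  \prod_(i < d) (n i)%:R `^ alpha = (idx_size n)%:R `^ alpha :> R.
Proof.
rewrite /idx_size; elim/big_ind2 : _ => //; first by rewrite powR1.
by move=> x1 x2 y1 y2 -> ->; rewrite natrM powRM.
Qed.

Lemma idx_powE (alpha : R) n i : idx_pow n alpha i = Num.truncn ((n i)%:R `^ alpha).
Proof. by rewrite ffunE truncn_floor powR_ge0. Qed.

Lemma idx_pow_itv (alpha : R) n i :
  ((idx_pow n alpha i)%:R : R) <= (n i)%:R `^ alpha < (idx_pow n alpha i).+1%:R.
Proof. by rewrite idx_powE; apply: truncn_itv; exact: powR_ge0. Qed.

Lemma idx_pow_gt0 (alpha : R) n i : 0 <= alpha -> pos_idx n -> (0 < idx_pow n alpha i)%N.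
Proof.
move=> a0 /(_ i) n0; rewrite idx_powE truncn_gt0.
have : ((n i)%:R : R) `^ 0 <= (n i)%:R `^ alpha by apply: ler_powR; rewrite ?ler1n.
by rewrite powRr0.
Qed.

Lemma idx_pow_le (alpha : R) n i : alpha <= 1 -> pos_idx n -> (idx_pow n alpha i <= n i)%N.
Proof.
move=> a1 /(_ i) n0; rewrite -(ler_nat R).
have /andP[h _] := idx_pow_itv alpha n i; apply: le_trans h _.
by apply: ler1_powR; rewrite ?ler1n.
Qed.

Lemma idx_size_pow_le (alpha : R) n k : (forall i, (k i <= idx_pow n alpha i)%N) ->
  (idx_size k)%:R <= (idx_size n)%:R `^ alpha :> R.
Proof.
move=> kN; rewrite -prod_powR /idx_size natr_prod; apply: ler_prod => i _.
rewrite ler0n/=; have /andP[h _] := idx_pow_itv alpha n i.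
by apply: le_trans h; rewrite ler_nat.
Qed.

Lemma nrm_window (alpha : R) (m j : nat) : 0 < alpha < 1 -> 1 <= ln (m%:R : R) ->
  (m <= j <= 2 ^ d * m)%N -> nrm alpha j <= (2 ^ d * d.+1)%:R * nrm alpha m.
Proof.
move=> /andP[a0 a1] L1 /andP[mj jm].
have m0 := size_gt0 L1.
have j0 : (0 : R) < j%:R by apply: lt_le_trans m0 _; rewrite ler_nat.
have jR : j%:R <= 2 ^+ d * m%:R :> R by rewrite -natrX -natrM ler_nat.
have Lj : 1 <= ln (j%:R : R).
  by apply: le_trans L1 _; rewrite ler_ln ?posrE// ler_nat.
have c1 : (1 : R) <= (2 ^ d * d.+1)%:R by rewrite ler1n muln_gt0 expn_gt0.
have n0 := nrm_gt0 alpha L1.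
rewrite -(@ler_pXn2r _ 2) ?nnegrE ?(ltW (nrm_gt0 alpha Lj))// ?mulr_ge0 ?(ltW n0)//.
rewrite exprMn !sqr_nrm//.
have p2 : 1 <= (2 : R) ^+ d by rewrite exprn_ege1// ler1n.
have h1 : j%:R `^ alpha <= 2 ^+ d * m%:R `^ alpha :> R.
  apply: le_trans (_ : (2 ^+ d * m%:R) `^ alpha <= _).
    by apply: ge0_ler_powR; rewrite ?nnegrE ?(ltW a0) ?mulr_ge0 ?exprn_ge0.
  rewrite powRM ?exprn_ge0// ler_wpM2r ?powR_ge0//.
  by apply: ler1_powR => //; exact: ltW.
have h2 : ln (j%:R : R) <= d.+1%:R * ln m%:R.
  apply: le_trans (_ : ln (2 ^+ d * m%:R) <= _).
    by rewrite ler_ln ?posrE ?mulr_gt0 ?exprn_gt0.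
  rewrite lnM ?posrE ?exprn_gt0// lnXn// -[d.+1%:R]natr1 mulrDl mul1r lerD2r.
  rewrite (_ : ln 2 *+ d = d%:R * ln 2); last by rewrite mulr_natl.
  rewrite ler_wpM2l//.
  apply: le_trans L1; have := @le_ln1Dx R 1; have -> : (1 + 1 : R) = 2 by ring.
  by apply; lra.
have h3 : 2 * j%:R `^ alpha * ln (j%:R : R) <=
    2 * (2 ^+ d * m%:R `^ alpha) * (d.+1%:R * ln m%:R).
  by apply: ler_pM => //; rewrite ?mulr_ge0 ?powR_ge0//; lra.
apply: le_trans h3 _.
have -> : 2 * (2 ^+ d * m%:R `^ alpha) * (d.+1%:R * ln m%:R) =
    (2 ^ d * d.+1)%:R * (2 * m%:R `^ alpha * ln (m%:R : R)).
  by rewrite natrM natrX; ring.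
rewrite ler_wpM2r ?expr2 ?ler_peMl// !mulr_ge0 ?powR_ge0//.
by lra.
Qed.

End powers_of_indices.

Section large_jumps.
Context {R : realType} {dT : measure_display} {T : measurableType dT}.
Context (P : probability T R) (e : nat) (alpha : R) (Y : T -> R).
Let d := e.+1.
Context (X : idx d -> T -> R).
Hypothesis alpha01 : 0 < alpha < 1.
Hypothesis mY : measurable_fun setT Y.
Hypothesis mX : forall j, pos_idx j -> measurable_fun setT (X j).
Hypothesis dXY : forall j, pos_idx j -> forall A, measurable A ->
  P (X j @^-1` A) = P (Y @^-1` A).
Hypothesis intY : (\int[P]_w ((`|Y w| `^ (2 / alpha)) *
              (logp `|Y w|) `^ (d%:R - 1 - 1 / alpha))%:E < +oo)%E.

Lemma measurable_gt_norm (b : R) : measurable [set y : R | b < `|y|].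
Proof.
rewrite (_ : [set y | _] = setT `&` (@Num.norm R R) @^-1` `]b, +oo[%classic).
  exact: normr_measurable.
by rewrite setTI; apply/seteqP; split => y /=; rewrite in_itv/= andbT.
Qed.

Lemma measurable_moment_weight (a b : R) :
  measurable_fun setT (fun w => (`|Y w| `^ a) * (logp `|Y w|) `^ b).
Proof.
have mn : measurable_fun setT (fun w => `|Y w|).
  by apply: measurableT_comp => //; exact: normr_measurable.
have ml : measurable_fun setT (fun w => logp `|Y w|).
  apply: measurable_maxr => //.
  by apply: (@measurableT_comp _ _ _ _ _ _ (@ln R)) => //; exact: measurable_ln.
apply: measurable_funM.
  by apply: (@measurableT_comp _ _ _ _ _ _ (@powR R ^~ a)) => //; exact: measurable_powR.
by apply: (@measurableT_comp _ _ _ _ _ _ (@powR R ^~ b)) => //; exact: measurable_powR.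
Qed.

(** First Borel-Cantelli lemma over all lattice points grouped by size. Exchanging sum and
    expectation turns the sum of probabilities into the expectation of a lattice count, bounded by
    the moment weight. *)
Lemma large_jumps (delta : R) : 0 < delta ->
  {ae P, forall w, exists M : nat, forall j, pos_idx j -> (M <= idx_size j)%N ->
     `|X j w| <= delta * nrm alpha (idx_size j)}.
Proof.
move=> d0.
pose Q (m : nat) := (1 <= ln (m%:R : R)) && (0 < m)%N.
pose G (m : nat) : set R := [set y | delta * nrm alpha m < `|y|].
have mG m : measurable (G m) by exact: measurable_gt_norm.
pose A m (j : idx d) : set T := X j @^-1` G m.
have fpos (m : nat) (j : idx d) : (0 < m)%N -> j \in fac_seq m -> pos_idx j.
  by move=> m0; rewrite mem_fac_seq// => /eqP jm; apply/pos_idxP; rewrite jm.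
have mA (m : nat) (j : idx d) : (0 < m)%N -> j \in fac_seq m -> measurable (A m j).
  move=> m0 jm; rewrite -[X in measurable X]setTI.
  by apply: (mX (fpos m j m0 jm)) => //; exact: mG.
pose F m : set T := if Q m then [set w | exists2 j, j \in fac_seq m & A m j w] else set0.
have mF m : measurable (F m).
  rewrite /F; case: ifPn => // /andP[_ m0].
  by have [] := union_bound P (fun j => mA m j m0).
have mYG m : measurable (Y @^-1` G m).
  by rewrite -[X in measurable X]setTI; exact: mY.
pose f m w : R := if Q m then #|factorizations d m|%:R * \1_(Y @^-1` G m) w else 0.
have f0 m w : 0 <= f m w by rewrite /f; case: ifP => // _; rewrite mulr_ge0.
have mf m : measurable_fun setT (f m).
  rewrite /f; case: (Q m); last exact: measurable_cst.
  by apply: measurable_funM => //; exact: measurable_indic.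
have PF m : (P (F m) <= \int[P]_w (f m w)%:E)%E.
  rewrite /F /f; case: ifPn => [/andP[_ m0]|_]; last by rewrite measure0 integral0.
  have [_ h] := union_bound P (fun j => mA m j m0); apply: le_trans h _.
  have pf : P (Y @^-1` G m) = (fine (P (Y @^-1` G m)))%:E by rewrite fineK// fin_num_measure.
  rewrite (eq_big_seq (fun=> (fine (P (Y @^-1` G m)))%:E)); last first.
    by move=> j /(fpos m _ m0) pj; rewrite -pf; exact: dXY.
  rewrite sumEFin big_const_seq count_predT size_fac_seq iter_addr_0.
  under eq_integral do rewrite EFinM.
  rewrite ge0_integralZl//; last by apply/measurable_EFinP; exact: measurable_indic.
  rewrite integral_indic// setIT.
  apply: le_trans (_ : (#|factorizations d m|%:R)%:E * P (Y @^-1` G m) <= _)%E => //.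
  by rewrite pf -EFinM mulr_natl.
have [C C0 HC] := @lattice_moment_bound R alpha delta e alpha01 d0.
pose h w : R := (`|Y w| `^ (2 / alpha)) * (logp `|Y w|) `^ (d%:R - 1 - 1 / alpha).
have h0 w : 0 <= h w by rewrite mulr_ge0 ?powR_ge0.
have mh : measurable_fun setT h by exact: measurable_moment_weight.
have mhE : measurable_fun setT (EFin \o h) by exact/measurable_EFinP.
have sF : (\sum_(m <oo) P (F m) < +oo)%E.
  apply: le_lt_trans (_ : (C%:E * \int[P]_w (h w)%:E < +oo)%E); last first.
    apply: lte_mul_pinfty; rewrite ?lee_fin//.
  apply: lime_le; first exact: is_cvg_nneseries.
  apply: nearW => n; apply: le_trans (lee_sum _ (fun m _ => PF m)) _.
  rewrite -ge0_integral_sum//; last 2 first.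
    by move=> m; apply/measurable_EFinP; exact: mf.
    by move=> m w _; rewrite lee_fin.
  rewrite -ge0_integralZl//; last by move=> w _; rewrite lee_fin.
  apply: ge0_le_integral => //.
  - by move=> w _; rewrite sumEFin lee_fin sumr_ge0.
  - under eq_fun do rewrite sumEFin.
    by apply/measurable_EFinP; exact: measurable_sum.
  - by apply: emeasurable_funM => //; exact/measurable_EFinP.
  move=> w _; rewrite sumEFin -EFinM lee_fin.
  apply: le_trans (HC `|Y w| n (normr_ge0 _)).
  have [->|n0] := posnP n; first by rewrite !big_geq.
  rewrite big_ltn// {1}/f /Q ltnn andbF add0r [leRHS]big_mkcond.
  apply: ler_sum_nat => m /andP[m1 _]; rewrite /f /Q m1 andbT.
  case: ifP => L1 //=; rewrite indicE; case: ifPn => [hy|]; last first.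
    by move=> hy; rewrite (_ : (_ \in _) = false) ?mulr0//; apply/negP => /set_mem; exact/negP.
  by rewrite ler_piMr// lern1 leq_b1.
have mL : measurable (lim_sup_set F).
  by apply: bigcap_measurableType => n _; apply: bigcup_measurable => k _; exact: mF.
have L0 : P (lim_sup_set F) = 0%E by exact: lim_sup_set_cvg0.
apply: (@negligibleS _ _ _ _ (lim_sup_set F)); last exact/negligibleP.
move=> w /= H n _; apply: contrapT => Hn; apply: H.
have [N3 _ H3] := @near_le_ln R 1.
exists (maxn n (maxn N3 1)) => j pj; rewrite !geq_max => /and3P[nj Nj j1].
rewrite leNgt; apply/negP => hj; apply: Hn; exists (idx_size j) => //.
rewrite /F /Q (H3 _ Nj) j1 /=; exists j; first by rewrite mem_fac_seq.
exact: hj.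
Qed.

End large_jumps.

(** * The sizes floor(i^gam) and Borel-Cantelli along them *)

Section sparse_sizes.
Context {R : realType}.
Variable gam : R.
Hypothesis gam1 : 1 < gam.

Definition bsize (i : nat) : nat := Num.truncn (i%:R `^ gam : R).

Lemma bsize_itv i : ((bsize i)%:R : R) <= i%:R `^ gam < (bsize i).+1%:R.
Proof. exact/truncn_itv/powR_ge0. Qed.

Lemma bsize_ge i : (0 < i)%N -> (i <= bsize i)%N.
Proof.
move=> i0; rewrite /bsize truncn_ge_nat ?powR_ge0//.
by apply: le1r_powR; rewrite ?ler1n// ltW.
Qed.

Lemma bsize_mono i k : (i <= k)%N -> (bsize i <= bsize k)%N.
Proof.
move=> ik; apply: le_truncn; apply: ge0_ler_powR; rewrite ?nnegrE// ?ler_nat//.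
by apply: ltW; apply: lt_trans gam1.
Qed.

Lemma powR_bsize_le i : (0 < i)%N -> i%:R `^ gam <= 2 * (bsize i)%:R :> R.
Proof.
move=> i0; have /andP[_ h] := bsize_itv i.
have : (1 : R) <= (bsize i)%:R by rewrite ler1n (leq_trans i0)// bsize_ge.
by move: h; rewrite -natr1; lra.
Qed.

Context {dT : measure_display} {T : measurableType dT} (P : probability T R).

(** Since i^gam <= 2 [bsize i], a bound of order (1 + kappa)/gam in the size is one of order 1 +
    kappa in i. *)
Lemma borel_cantelli_sizes (F : nat -> set T) (C kappa : R) (N : nat) :
  0 < kappa -> 0 <= C -> (forall m, (N <= m)%N -> measurable (F m)) ->
  (forall m, (N <= m)%N -> (P (F m) <= (C * m%:R `^ (- ((1 + kappa) / gam)))%:E)%E) ->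
  {ae P, forall w, exists M, forall i, (0 < i)%N -> (M <= bsize i)%N -> ~ F (bsize i) w}.
Proof.
move=> k0 C0 mF hF.
have g0 : 0 < gam by apply: lt_trans gam1.
have e0 : 0 <= (1 + kappa) / gam by rewrite divr_ge0 ?(ltW g0)//; lra.
have Ni i : (maxn N 1 <= i)%N -> (N <= bsize i)%N /\ (0 < i)%N.
  rewrite geq_max => /andP[Ni i0]; split => //.
  exact: leq_trans Ni (bsize_ge i0).
have := @borel_cantelli_powR R _ _ P (fun i => F (bsize i))
  (C * 2 `^ ((1 + kappa) / gam)) kappa (maxn N 1) k0 (mulr_ge0 C0 (powR_ge0 _ _)).
move=> /(_ _ _)/[dup] H.
have {}H : {ae P, forall w, exists M, forall i, (M <= i)%N -> ~ F (bsize i) w}.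
  apply: H => i /Ni[Nb i0]; first exact: mF.
  apply: le_trans (hF _ Nb) _; rewrite lee_fin -mulrA ler_wpM2l//.
  have b0 : (0 : R) < (bsize i)%:R by rewrite ltr0n (leq_trans i0)// bsize_ge.
  have i0R : (0 : R) < i%:R by rewrite ltr0n.
  have -> : i%:R `^ (- (1 + kappa)) = (i%:R `^ gam) `^ (- ((1 + kappa) / gam)) :> R.
    by rewrite -powRrM; congr (_ `^ _); field; rewrite gt_eqF.
  rewrite !powRN ler_pdivlMr ?powR_gt0// mulrC ler_pdivrMr ?powR_gt0//.
  rewrite -powRM ?(ltW b0)//; apply: ge0_ler_powR; rewrite ?nnegrE ?powR_ge0//.
  exact: powR_bsize_le.
(* A threshold for i becomes one for the size by monotonicity. *)
move=> _; apply: filterS H => w [M0 HM]; exists (bsize M0).+1 => i i0 Mi.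
apply: HM; rewrite leqNgt; apply/negP => iM.
by move: Mi; rewrite ltnNge bsize_mono// ltnW.
Qed.

End sparse_sizes.

Section truncation_error.
Context {R : realType} {dT : measure_display} {T : measurableType dT}.
Context (P : probability T R) (e : nat) (alpha gam p v mp : R) (Y : T -> R).
Let d := e.+1.
Context (X : idx d -> T -> R).
Hypotheses (alpha01 : 0 < alpha < 1) (gam1 : 1 < gam).
Hypotheses (HY : centred_moments P Y p v mp) (p2 : 2 < p).
Hypothesis indepX : mutually_independent P (@pos_idx d) X.
Hypothesis dXY : forall j, pos_idx j -> forall A, measurable A ->
  P (X j @^-1` A) = P (Y @^-1` A).
Hypothesis intY : (\int[P]_w ((`|Y w| `^ (2 / alpha)) *
              (logp `|Y w|) `^ (d%:R - 1 - 1 / alpha))%:E < +oo)%E.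

Let full (n : idx d) : seq (idx d) := window n (idx_pow n alpha).

Let fullS n j : j \in full n -> pos_idx j.
Proof. exact: window_pos. Qed.

Lemma exceed_count_rare : exists K : nat, forall delta : R, 0 < delta ->
  {ae P, forall w, exists M : nat, forall i, (0 < i)%N -> forall n : idx d,
     idx_size n = bsize gam i -> (M <= idx_size n)%N ->
     \sum_(j <- full n) (delta / cscale alpha (idx_size n) < `|X j w|)%R%:R < K%:R :> R}.
Proof.
have [a0 a1] := andP alpha01.
have g0 : 0 < gam by apply: lt_trans gam1.
(* The 1 pays for at most C m indices n of size m, and 2/gam is the Borel-Cantelli exponent with
   kappa = 1. *)
pose D : R := 1 + 2 / gam.
have D0 : 0 < D by rewrite addr_gt0// divr_gt0.
have [K HK] := exceed_count_tail HY p2 a0 indepX dXY D0.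
exists K => delta d0.
have [N _ HN] := HK _ d0.
have [C C0 HC] := @card_factorizations_le R d 1 ltr01.
pose A m (n : idx d) : set T :=
  [set w | (K%:R <= \sum_(j <- full n) (delta / cscale alpha m < `|X j w|)%R%:R :> R)%R].
pose F m : set T := [set w | exists2 n, n \in fac_seq m & A m n w].
have mA m n : measurable (A m n).
  have mt : measurable_fun setT (fun y : R => (delta / cscale alpha m < `|y|)%R%:R : R).
    exact: measurable_exceed.
  pose U w : R := \sum_(j <- full n) (delta / cscale alpha m < `|X j w|)%R%:R.
  have mS : measurable_fun setT U by exact: (measurable_sum_coord indepX (@fullS n) mt).
  rewrite (_ : A m n = setT `&` U @^-1` `[K%:R, +oo[%classic); first exact: mS.
  by rewrite setTI; apply/seteqP; split => w /=; rewrite in_itv/= andbT.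
have mF m : measurable (F m) by have [] := union_bound P (fun n (_ : n \in fac_seq m) => mA m n).
have PF m : (maxn N 1 <= m)%N -> (P (F m) <= (C * m%:R `^ (- ((1 + 1) / gam)))%:E)%E.
  rewrite geq_max => /andP[Nm m0].
  have [_ h] := union_bound P (fun n (_ : n \in fac_seq m) => mA m n).
  apply: le_trans h _.
  have step : (\sum_(n <- fac_seq m) P (A m n) <=
      \sum_(n <- fac_seq m : seq (idx d)) (m%:R `^ (- D))%:E)%E.
    rewrite big_seq_cond [leRHS]big_seq_cond; apply: lee_sum => n /andP[nm _].
    apply: HN => //; [exact: uniq_window|exact: fullS|].
    move: nm; rewrite mem_fac_seq// => /eqP <-.
    by rewrite size_window; exact: idx_size_pow_le.
  apply: le_trans step _.
  rewrite sumEFin lee_fin big_const_seq count_predT size_fac_seq iter_addr_0.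
  rewrite -[X in X <= _]mulr_natl.
  have mR : (0 : R) < m%:R by rewrite ltr0n.
  apply: le_trans (_ : C * m%:R `^ 1 * m%:R `^ (- D) <= _).
    by rewrite ler_wpM2r ?powR_ge0// HC.
  rewrite -mulrA -powRD ?(gt_eqF mR) ?implybT// ler_pM2l//.
  by rewrite le_eqVlt; apply/orP; left; apply/eqP; congr (_ `^ _); rewrite /D; lra.
have := @borel_cantelli_sizes R gam gam1 _ _ P F C 1 (maxn N 1) ltr01 (ltW C0) (fun m _ => mF m) PF.
apply: filterS => w [M HM]; exists (maxn M 1) => i i0 n nb; rewrite geq_max nb => /andP[Mn b0].
rewrite ltNge; apply/negP => h; apply: (HM i i0 Mn).
exists n; first by rewrite mem_fac_seq//; apply/eqP.
by rewrite /A /= .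
Qed.

(** The exceedances in any window with corner k are among those of the full window, fewer than K in
    number, so one event controls all k at once; each exceedance is at most a small multiple of the
    normaliser. *)
Lemma truncation_error (eps delta : R) : 0 < eps -> 0 < delta ->
  {ae P, forall w, exists M : nat, forall i, (0 < i)%N -> forall n : idx d,
     idx_size n = bsize gam i -> (M <= idx_size n)%N ->
     forall k : idx d, (forall l, (k l <= idx_pow n alpha l)%N) ->
     `|Tsum X n k w - tsum alpha X delta (idx_size n) (window n k) w|
       <= eps * nrm alpha (idx_size n)}.
Proof.
move=> eps0 d0.
have [a0 a1] := andP alpha01.
have [K HK] := exceed_count_rare.
pose B : R := (2 ^ d * d.+1)%:R.
have B0 : 0 < B by rewrite ltr0n muln_gt0 expn_gt0.
(* B is the loss in passing from the size of j to that of n; K + 1 keeps the division legitimate and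
   leaves K summands with total at most eps [nrm]. *)
pose delta' := eps / (K.+1%:R * B).
have d'0 : 0 < delta' by rewrite divr_gt0// mulr_gt0.
have [mY _ _ _] := HY.
have H1 := large_jumps alpha01 mY indepX.1 dXY intY d'0.
have H2 := HK _ d0.
have [N3 _ H3] := @near_le_ln R 1.
apply: filterS2 H1 H2 => w [M1 J1] [M2 J2].
exists (maxn M1 (maxn M2 N3)) => i i0 n nb; rewrite !geq_max => /and3P[h1 h2 h3] k kN.
have L1 := H3 _ h3.
have n0 := nrm_gt0 alpha L1.
set m := idx_size n in h1 h2 h3 L1 n0 *.
have pn : pos_idx n by apply/pos_idxP; rewrite nb (leq_trans i0)// bsize_ge.
have jump j : j \in full n -> `|X j w| <= delta' * (B * nrm alpha m).
  move=> jn; have gej : (m <= idx_size j)%N by exact: window_ge jn.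
  have kn l : (idx_pow n alpha l <= n l)%N by apply: idx_pow_le => //; exact: ltW.
  apply: le_trans (J1 j (fullS jn) (leq_trans h1 gej)) _.
  rewrite ler_pM2l//; apply: nrm_window => //; rewrite gej.
  exact: window_le jn.
have sub j : j \in window n k -> j \in full n.
  rewrite !mem_window => /forallP H; apply/forallP => l; have /andP[-> /= jl] := H l.
  by apply: leq_trans jl _; rewrite leq_add2l.
rewrite Tsum_window /tsum -sumrB.
apply: le_trans (ler_norm_sum _ _ _) _.
pose E j : R := (delta / cscale alpha m < `|X j w|)%R%:R.
apply: le_trans (_ : \sum_(j <- window n k) E j * (delta' * (B * nrm alpha m)) <= _).
  rewrite big_seq_cond [leRHS]big_seq_cond; apply: ler_sum => j /andP[/sub jn _].
  rewrite /E /trunc; case: (ltP (delta / cscale alpha m) `|X j w|) => hj.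
    by rewrite subr0 mul1r jump.
  by rewrite subrr normr0 mul0r.
rewrite -mulr_suml.
have cE : \sum_(j <- window n k) E j <= K%:R.
  apply: le_trans (ltW (J2 i i0 n nb h2)); rewrite -/m /full (big_window_diff E n kN).
  by rewrite lerDl sumr_ge0// => j _; rewrite /E ler0n.
apply: le_trans (_ : K%:R * (delta' * (B * nrm alpha m)) <= _).
  by rewrite ler_wpM2r// mulr_ge0 ?(ltW d'0)// mulr_ge0 ?(ltW B0) ?(ltW n0).
have -> : K%:R * (delta' * (B * nrm alpha m)) = (K%:R / K.+1%:R) * (eps * nrm alpha m).
  have dB : delta' * B = eps / K.+1%:R.
    by rewrite /delta' invfM -!mulrA mulVf ?gt_eqF// mulr1.
  by rewrite [delta' * _]mulrA dB; ring.
rewrite ler_piMl ?mulr_ge0 ?(ltW eps0) ?(ltW n0)//.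
by rewrite ler_pdivrMr// mul1r ler_nat.
Qed.

End truncation_error.

(** * The upper bound *)

Section grid.
Context {R : realType} {d : nat}.
Implicit Types n N k : idx d.

(** The successor makes the step positive and larger than N_i/G, so that the multiples of it up to
    N_i have index below G. *)
Definition grid_step (G : nat) N i : nat := (N i %/ G).+1.

(** Capped at N so that every code [g] gives an admissible corner; the cap is inactive on the grid
    points that arise by rounding. *)
Definition grid_point (G : nat) N (g : {ffun 'I_d -> 'I_G}) : idx d :=
  [ffun i => minn (g i * grid_step G N i) (N i)].

Definition grid_floor (G : nat) N k : idx d :=
  [ffun i => (k i %/ grid_step G N i * grid_step G N i)%N].

Lemma grid_point_le G N g i : (@grid_point G N g i <= N i)%N.
Proof. by rewrite ffunE geq_minr. Qed.

Lemma grid_floor_le G N k i : (grid_floor G N k i <= k i)%N.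
Proof. by rewrite ffunE leq_divM. Qed.

Lemma grid_floorP (G : nat) N k : (0 < G)%N -> (forall i, (k i <= N i)%N) ->
  exists g, grid_floor G N k = @grid_point G N g.
Proof.
move=> G0 kN.
have kG i : (k i %/ grid_step G N i < G)%N.
  rewrite ltn_divLR// /grid_step; apply: leq_ltn_trans (kN i) _.
  by rewrite mulnC; exact: ltn_ceil.
exists [ffun i => Ordinal (kG i)]; apply/ffunP => i; rewrite !ffunE /=.
by symmetry; apply/minn_idPl; exact: leq_trans (leq_divM _ _) (kN i).
Qed.

(** Rounding loses a remainder below the step, hence at most N_i/G on each side. *)
Lemma size_grid_diff (G : nat) n N k : (0 < G)%N -> (forall i, (0 < N i)%N) ->
  (forall i, (k i <= N i)%N) ->
  (size (window_diff n k (grid_floor G N k)))%:R <= d%:R / G%:R * (idx_size N)%:R :> R.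
Proof.
move=> G0 N0 kN.
have h := size_window_diff n (grid_floor_le G N k).
have -> : (size (window_diff n k (grid_floor G N k)))%:R =
    (idx_size k)%:R - (idx_size (grid_floor G N k))%:R :> R.
  by rewrite -h natrD addrK.
apply: idx_size_diff_le => // i; first exact: grid_floor_le.
have G0R : (0 : R) < G%:R by rewrite ltr0n.
rewrite -natrB ?grid_floor_le// ffunE mulrC ler_pdivlMr// -natrM ler_nat.
have := divn_eq (k i) (grid_step G N i).
have : (k i %% grid_step G N i < grid_step G N i)%N by rewrite ltn_mod.
rewrite /grid_step ltnS => h1 h2.
rewrite {1}h2 addKn; apply: leq_trans (leq_divM (N i) G).
by rewrite leq_mul2r h1 orbT.
Qed.

End grid.

Section upper.
Context {R : realType} {dT : measure_display} {T : measurableType dT}.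
Context (P : probability T R) (e : nat) (alpha gam p v mp : R) (Y : T -> R).
Let d := e.+1.
Context (X : idx d -> T -> R).
Hypotheses (alpha01 : 0 < alpha < 1) (gam1 : 1 < gam).
Hypotheses (HY : centred_moments P Y p v mp) (p2 : 2 < p).
Hypothesis indepX : mutually_independent P (@pos_idx d) X.
Hypothesis dXY : forall j, pos_idx j -> forall A, measurable A ->
  P (X j @^-1` A) = P (Y @^-1` A).

Lemma tsum_upper_as (x eps : R) : 0 < x -> v / gam < x ^+ 2 -> 0 < eps ->
  exists2 delta : R, 0 < delta &
  {ae P, forall w, exists M : nat, forall i, (0 < i)%N -> forall n : idx d,
     idx_size n = bsize gam i -> (M <= idx_size n)%N ->
     forall k : idx d, (forall l, (k l <= idx_pow n alpha l)%N) ->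
     tsum alpha X delta (idx_size n) (window n k) w <= (x + eps) * nrm alpha (idx_size n)}.
Proof.
move=> x0 vx eps0.
have [a0 a1] := andP alpha01.
have g0 : 0 < gam by apply: lt_trans gam1.
have gi0 : 0 < gam^-1 by rewrite invr_gt0.
have [eta eta0 [delta1 d10 U1]] := tsum_upper_tail HY p2 a0 indepX dXY x0 gi0 vx.
(* The surplus eta/gam of the tail exponent is split: half pays for the number of indices n of a
   given size, half is kept as kappa/gam for summability. *)
pose eta' := eta / 2 / gam.
have eta'0 : 0 < eta' by rewrite !divr_gt0.
pose kappa := eta / 2.
have kappa0 : 0 < kappa by rewrite divr_gt0.
have k0 : 0 <= (1 + kappa) / gam by rewrite divr_ge0 ?(ltW g0)//; lra.
(* The remainders range over all corners, at most (m + 1)^d <= 2^d m^d codes, hence the additional d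
   in the exponent. *)
pose D := d%:R + eta' + (1 + kappa) / gam.
have D0 : 0 < D by rewrite /D; have : (0 : R) <= d%:R by []; lra.
have [delta2 d20 [rho rho0 U2]] := tsum_small_block_tail HY p2 a0 indepX dXY eps0 D0.
pose delta := Num.min delta1 delta2.
have d0 : 0 < delta by rewrite lt_min d10.
exists delta => //.
pose G := (Num.truncn (d%:R / rho)).+1.
have GR : (0 : R) < G%:R by [].
have dG : d%:R / G%:R <= rho.
  by rewrite ler_pdivrMr// mulrC -ler_pdivrMr// ltW// truncnS_gt.
have [N1 _ H1] : \forall m \near \oo, forall J, uniq J -> (forall j, j \in J -> pos_idx j) ->
    (size J)%:R <= m%:R `^ alpha ->
    (P [set w | (x * nrm alpha m <= tsum alpha X delta m J w)%R] <=
     (m%:R `^ (- (gam^-1 * (1 + eta))))%:E)%E.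
  by apply: U1; rewrite d0 ge_min lexx.
have [N2 _ H2] : \forall m \near \oo, forall J, uniq J -> (forall j, j \in J -> pos_idx j) ->
    (size J)%:R <= rho * m%:R `^ alpha ->
    (P [set w | (eps * nrm alpha m <= tsum alpha X delta m J w)%R] <= (m%:R `^ (- D))%:E)%E.
  by apply: U2; rewrite d0 ge_min lexx orbT.
have [C C0 HC] := @card_factorizations_le R d eta' eta'0.
have mE (z : R) (m : nat) (J : seq (idx d)) : (forall j, j \in J -> pos_idx j) ->
    measurable [set w | (z <= tsum alpha X delta m J w)%R].
  move=> JS; have mS := measurable_tsum alpha indepX delta m JS.
  rewrite (_ : [set w | _] = setT `&` tsum alpha X delta m J @^-1` `[z, +oo[%classic).
    exact: mS.
  by rewrite setTI; apply/seteqP; split => w /=; rewrite in_itv/= andbT.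
pose N (n : idx d) : idx d := idx_pow n alpha.
pose A1 (m : nat) (n : idx d) (g : {ffun 'I_d -> 'I_G}) : set T :=
  [set w | (x * nrm alpha m <= tsum alpha X delta m (window n (grid_point (N n) g)) w)%R].
(* Corners are coded by a finite type depending only on m; the cap makes every code admissible, as
   the union bound runs over all of them. *)
pose kt (n : idx d) (m : nat) (t : {ffun 'I_d -> 'I_m.+1}) : idx d := [ffun i => minn (t i) (N n i)].
pose A2 (m : nat) (n : idx d) (t : {ffun 'I_d -> 'I_m.+1}) : set T :=
  [set w | (eps * nrm alpha m <= tsum alpha X delta m
     (window_diff n (kt n m t) (grid_floor G (N n) (kt n m t))) w)%R].
have mA1 m (n : idx d) g : measurable (A1 m n g) by apply: mE; exact: window_pos.
have mA2 m (n : idx d) t : measurable (A2 m n t).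
  by apply: mE => j; rewrite mem_filter => /andP[_]; exact: window_pos.
pose B1 (m : nat) (n : idx d) : set T := [set w | exists2 g, g \in enum {ffun 'I_d -> 'I_G} & A1 m n g w].
pose B2 (m : nat) (n : idx d) : set T := [set w | exists2 t, t \in enum {ffun 'I_d -> 'I_m.+1} & A2 m n t w].
have [mB1 PB1] : (forall m n, measurable (B1 m n)) /\
    (forall m n, (P (B1 m n) <= \sum_(g <- enum {ffun 'I_d -> 'I_G}) P (A1 m n g))%E).
  by split => m n; have [] := union_bound P (fun g (_ : g \in enum {ffun 'I_d -> 'I_G}) => mA1 m n g).
have [mB2 PB2] : (forall m n, measurable (B2 m n)) /\
    (forall m n, (P (B2 m n) <= \sum_(t <- enum {ffun 'I_d -> 'I_m.+1}) P (A2 m n t))%E).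
  by split => m n; have [] := union_bound P (fun t (_ : t \in enum {ffun 'I_d -> 'I_m.+1}) => mA2 m n t).
pose F (m : nat) : set T := [set w | exists2 n, n \in fac_seq m & (B1 m n `|` B2 m n) w].
have mB m n : measurable (B1 m n `|` B2 m n) by exact: measurableU.
have mF m : measurable (F m) by have [] := union_bound P (fun n (_ : n \in fac_seq m) => mB m n).
pose Q : R := G%:R ^+ d + 2 ^+ d.
have Q0 : 0 <= Q by rewrite addr_ge0// exprn_ge0.
have PF m : (maxn (maxn N1 N2) 1 <= m)%N ->
    (P (F m) <= (C * Q * m%:R `^ (- ((1 + kappa) / gam)))%:E)%E.
  rewrite !geq_max -andbA => /and3P[N1m N2m m0].
  have mR : (0 : R) < m%:R by rewrite ltr0n.
  have m1 : (1 : R) <= m%:R by rewrite ler1n.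
  pose q : R := m%:R `^ (- (eta' + (1 + kappa) / gam)).
  have PBn n : n \in fac_seq m -> (P (B1 m n `|` B2 m n) <= (Q * q)%:E)%E.
    rewrite mem_fac_seq// => /eqP nm.
    have pn : pos_idx n by apply/pos_idxP; rewrite nm.
    apply: le_trans (measureU2 _ (mB1 m n) (mB2 m n)) _.
    rewrite mulrDl EFinD; apply: leeD.
      apply: le_trans (PB1 m n) _.
      apply: le_trans (_ : \sum_(g <- enum {ffun 'I_d -> 'I_G}) q%:E <= _)%E.
        apply: lee_sum => g _.
        apply: le_trans (H1 _ N1m _ _ _ _) _; [exact: uniq_window|exact: window_pos| |].
          rewrite size_window -nm; apply: idx_size_pow_le => i; exact: grid_point_le.
        rewrite lee_fin /q ler_powR// lerN2 le_eqVlt; apply/orP; left; apply/eqP.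
        by rewrite /eta' /kappa; field; rewrite gt_eqF.
      rewrite sumEFin lee_fin big_const_seq count_predT -cardE iter_addr_0.
      by rewrite -[X in X <= _]mulr_natl card_ffun !card_ord natrX.
    apply: le_trans (PB2 m n) _.
    apply: le_trans (_ : \sum_(t <- enum {ffun 'I_d -> 'I_m.+1}) (m%:R `^ (- D))%:E <= _)%E.
      apply: lee_sum => t _.
      have kN i : (kt n m t i <= N n i)%N by rewrite ffunE geq_minr.
      apply: H2 => //.
      - by rewrite filter_uniq// uniq_window.
      - by move=> j; rewrite mem_filter => /andP[_]; exact: window_pos.
      apply: le_trans (size_grid_diff n (isT : (0 < G)%N) _ kN) _.
        by move=> i; apply: idx_pow_gt0 => //; exact: ltW.
      apply: ler_pM => //.
      by rewrite -nm; exact: idx_size_pow_le.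
    rewrite sumEFin lee_fin big_const_seq count_predT -cardE iter_addr_0.
    rewrite -[X in X <= _]mulr_natl card_ffun !card_ord natrX.
    apply: le_trans (_ : (2 ^+ d * m%:R `^ d%:R) * m%:R `^ (- D) <= _).
      rewrite ler_wpM2r ?powR_ge0// powR_mulrn// -exprMn lerXn2r ?nnegrE//.
      by rewrite -natr1; lra.
    rewrite -mulrA -powRD ?(gt_eqF mR) ?implybT// ler_pM2l ?exprn_gt0//.
    by rewrite le_eqVlt; apply/orP; left; apply/eqP; congr (_ `^ _); rewrite /D; ring.
  have [_ h] := union_bound P (fun n (_ : n \in fac_seq m) => mB m n).
  apply: le_trans h _.
  have step : (\sum_(n <- fac_seq m) P (B1 m n `|` B2 m n) <=
      \sum_(n <- fac_seq m : seq (idx d)) (Q * q)%:E)%E.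
    by rewrite big_seq_cond [leRHS]big_seq_cond; apply: lee_sum => n /andP[/PBn].
  apply: le_trans step _.
  rewrite sumEFin lee_fin big_const_seq count_predT size_fac_seq iter_addr_0.
  rewrite -[X in X <= _]mulr_natl.
  apply: le_trans (_ : C * m%:R `^ eta' * (Q * q) <= _).
    by rewrite ler_wpM2r ?mulr_ge0 ?powR_ge0// HC.
  have -> : C * m%:R `^ eta' * (Q * q) = C * Q * (m%:R `^ eta' * q) by ring.
  rewrite /q -powRD ?(gt_eqF mR) ?implybT//.
  rewrite le_eqVlt; apply/orP; left; apply/eqP; congr (_ * _ `^ _).
  by rewrite opprD addrA subrr add0r.
have [N3 _ H3] := @near_le_ln R 1.
have := @borel_cantelli_sizes R gam gam1 _ _ P F (C * Q) kappa (maxn (maxn N1 N2) 1)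
  kappa0 (mulr_ge0 (ltW C0) Q0) (fun m _ => mF m) PF.
apply: filterS => w [M HM]; exists (maxn M N3) => i i0 n nb.
rewrite geq_max nb => /andP[Mn N3n] k kN.
set m := bsize gam i in Mn N3n HM nb *.
have m0 : (0 < m)%N by rewrite (leq_trans i0)// bsize_ge.
have L1 := H3 _ N3n; have n0 := nrm_gt0 alpha L1.
have nF : n \in fac_seq m by rewrite mem_fac_seq// nb.
have notB : ~ (B1 m n `|` B2 m n) w.
  by move=> h; apply: (HM i i0 Mn); exists n.
have pn : pos_idx n by apply/pos_idxP; rewrite nb.
have kle l : (k l < m.+1)%N.
  rewrite ltnS; apply: leq_trans (kN l) _.
  apply: leq_trans (idx_pow_le l (ltW a1) pn) _.
  rewrite -nb /idx_size (bigD1 l)//= leq_pmulr// prodn_cond_gt0// => l' _.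
pose t : {ffun 'I_d -> 'I_m.+1} := [ffun l => Ordinal (kle l)].
have ktE : kt n m t = k.
  by apply/ffunP => l; rewrite ffunE /t ffunE /=; apply/minn_idPl; exact: kN.
have [g gE] := grid_floorP (isT : (0 < G)%N) kN.
have h1 : tsum alpha X delta m (window n (grid_floor G (N n) k)) w < x * nrm alpha m.
  rewrite ltNge; apply/negP => h; apply: notB; left; exists g; first by rewrite mem_enum.
  by rewrite /A1 /= -gE.
have h2 : tsum alpha X delta m (window_diff n k (grid_floor G (N n) k)) w < eps * nrm alpha m.
  rewrite ltNge; apply/negP => h; apply: notB; right; exists t; first by rewrite mem_enum.
  by rewrite /A2 /= ktE.
rewrite /tsum (big_window_diff _ n (grid_floor_le G (N n) k)) mulrDl.
by apply: lerD; apply: ltW.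
Qed.

End upper.

(** * The lower bound *)

Lemma leq_max4 (a b c f : nat) : let m := maxn (maxn a b) (maxn c f) in
  [/\ (a <= m)%N, (b <= m)%N, (c <= m)%N & (f <= m)%N].
Proof. by rewrite /=; split; lia. Qed.

Lemma dvdz_floor_powR {R : realType} (gam : R) (q i : nat) :
  (q%:Z %| Num.floor (i%:R `^ gam))%Z = (q %| bsize gam i)%N.
Proof. by rewrite /bsize truncn_floor powR_ge0 /dvdz unfold_in. Qed.

Section lower.
Context {R : realType} {dT : measure_display} {T : measurableType dT}.
Context (P : probability T R) (e : nat) (alpha gam p v mp : R) (Y : T -> R).
Let d := e.+1.
Context (X : idx d -> T -> R).
Hypotheses (alpha01 : 0 < alpha < 1) (gam1 : 1 < gam).
Hypothesis gamA : 1 < gam * (1 - alpha).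
Hypotheses (HY : centred_moments P Y p v mp) (p2 : 2 < p).
Hypothesis indepX : mutually_independent P (@pos_idx d) X.
Hypothesis dXY : forall j, pos_idx j -> forall A, measurable A ->
  P (X j @^-1` A) = P (Y @^-1` A).

(** When n_l^alpha >= z, taking the integer part loses at most the factor 1 - 1/z; Bernoulli's
    inequality handles the d factors. *)
Lemma idx_size_pow_ge (rho : R) : rho < 1 ->
  exists M0 : nat, forall n : idx d, pos_idx n -> (forall l, (M0 <= n l)%N) ->
    rho * (idx_size n)%:R `^ alpha <= (idx_size (idx_pow n alpha))%:R.
Proof.
move=> rho1; have [a0 a1] := andP alpha01.
have r0 : 0 < 1 - rho by lra.
pose z : R := Num.max 1 (d%:R / (1 - rho)).
have z1 : 1 <= z by rewrite le_max lexx.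
have zr : d%:R <= z * (1 - rho).
  by rewrite -ler_pdivrMr// le_max lexx orbT.
have [M0 _ HM] := @near_le_powR R alpha z a0.
exists M0 => n pn nM.
rewrite -prod_powR /idx_size natr_prod.
pose y : R := 1 - z^-1.
have zi : z^-1 <= 1 by rewrite invf_le1//; lra.
have zi0 : 0 < z^-1 by rewrite invr_gt0; lra.
have y0 : 0 <= y by rewrite /y; lra.
have yd (m : nat) : 1 - m%:R * z^-1 <= y ^+ m.
  elim: m => [|m IH]; first by rewrite mul0r subr0 expr0.
  rewrite exprS; apply: le_trans (ler_wpM2l y0 IH).
  have : 0 <= m%:R * z^-1 * z^-1 by rewrite !mulr_ge0// ltW.
  by rewrite /y -natr1; lra.
have ry : rho <= y ^+ d.
  apply: le_trans (yd d); rewrite lerBrDr -lerBrDl ler_pdivrMr; last by lra.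
  by rewrite mulrC.
apply: le_trans (_ : y ^+ d * \prod_(i < d) (n i)%:R `^ alpha <= _).
  by rewrite ler_wpM2r// prodr_ge0// => i _; exact: powR_ge0.
rewrite -[X in y ^+ X](card_ord d) -prodr_const -big_split /=.
apply: ler_prod => i _; rewrite mulr_ge0 ?powR_ge0//=.
have /andP[_ h] := idx_pow_itv alpha n i.
have hz : z <= (n i)%:R `^ alpha := HM _ (nM i).
have : 1 <= z^-1 * (n i)%:R `^ alpha.
  by rewrite mulrC ler_pdivlMr ?mul1r//; lra.
by rewrite -natr1 in h; rewrite /y; lra.
Qed.

(* Keeping all but one side equal to [M] makes the windows disjoint along the first axis,
   so the corresponding events are independent. *)
Definition slab (M i : nat) : idx d :=
  [ffun l => if l == ord0 then (bsize gam i %/ M ^ e)%N else M].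

Lemma slab_size M i : (M ^ e %| bsize gam i)%N -> idx_size (slab M i) = bsize gam i.
Proof.
move=> q; rewrite /idx_size big_ord_recl ffunE eqxx.
rewrite (eq_bigr (fun=> M)); last by move=> l _; rewrite ffunE.
by rewrite prod_nat_const card_ord divnK.
Qed.

(** By the mean value theorem consecutive sizes differ by at least about i^(gam-1), while q a^alpha
    is at most q i^(gam alpha), which is smaller because gam (1 - alpha) > 1. Requiring only
    [bsize gam i.+1 <= a' * q] covers all later slabs; the + 1 matches the strict lower end of a
    window. *)
Lemma near_bsize_gap (q : nat) : (0 < q)%N -> \forall i \near \oo,
  forall a a' : nat, (a * q = bsize gam i)%N -> (bsize gam i.+1 <= a' * q)%N ->
    (a%:R : R) + a%:R `^ alpha < a'%:R + 1.
Proof.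
move=> q0; have [a0 a1] := andP alpha01.
have g0 : 0 < gam by apply: lt_trans gam1.
have c0 : 0 < gam * (1 - alpha) - 1 by rewrite subr_gt0.
have h := @near_le_powR R (gam * (1 - alpha) - 1) (1 + q%:R) c0.
near=> i => a a' aq a'q.
have i0 : (0 < i)%N by near: i; exists 1%N.
have hi : 1 + q%:R <= i%:R `^ (gam * (1 - alpha) - 1) :> R by near: i; exact: h.
have iR : (0 : R) < i%:R by rewrite ltr0n.
have i1 : (1 : R) <= i%:R by rewrite ler1n.
have qR : (1 : R) <= q%:R by rewrite ler1n.
have [xi /andP[xi1 _]] := @iter_fdiff_powR R 1 gam i%:R iR.
rewrite big_ord1 subr0 /= /fdiff => E.
have /andP[b1 _] := bsize_itv gam i.
have /andP[_ b2] := bsize_itv gam i.+1.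
have x1 : i%:R `^ (gam - 1) <= gam * xi `^ (gam - 1).
  apply: le_trans (_ : xi `^ (gam - 1) <= _).
    apply: ge0_ler_powR; rewrite ?nnegrE ?(ltW iR)//; first by rewrite subr_ge0 ltW.
    exact: le_trans (ltW iR) xi1.
  by rewrite ler_peMl ?powR_ge0// ltW.
have aR : a%:R * q%:R <= i%:R `^ gam :> R by rewrite -natrM aq.
have a'R : i.+1%:R `^ gam < a'%:R * q%:R + 1 :> R.
  by apply: lt_le_trans b2 _; rewrite -natr1 lerD2r -natrM ler_nat.
have aa : a%:R `^ alpha <= i%:R `^ (gam * alpha) :> R.
  rewrite powRrM; apply: ge0_ler_powR; rewrite ?nnegrE ?powR_ge0 ?(ltW a0)//.
  by apply: le_trans aR; rewrite ler_peMr.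
have ia : 1 <= (i%:R : R) `^ (gam * alpha).
  have : (i%:R : R) `^ 0 <= i%:R `^ (gam * alpha).
    by apply: ler_powR => //; rewrite mulr_ge0// ltW.
  by rewrite powRr0.
have ii : i%:R `^ (gam - 1) = i%:R `^ (gam * (1 - alpha) - 1) * i%:R `^ (gam * alpha) :> R.
  by rewrite -powRD ?(gt_eqF iR) ?implybT//; congr (_ `^ _); ring.
have k1 : (1 + q%:R) * i%:R `^ (gam * alpha) <= i%:R `^ (gam - 1) :> R.
  by rewrite ii ler_wpM2r ?powR_ge0.
have k2 : q%:R * a%:R `^ alpha <= q%:R * i%:R `^ (gam * alpha) :> R.
  by rewrite ler_wpM2l.
rewrite natr1 in E.
have key : q%:R * (a%:R + a%:R `^ alpha) < q%:R * (a'%:R + 1) :> R by lra.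
by rewrite ltr_pM2l in key => //; lra.
Unshelve. all: by end_near. Qed.

Lemma tsum_lower_as (theta eps : R) : 0 < theta -> 0 < v -> theta ^+ 2 = v / gam ->
  0 < eps < 1 / 2 ->
  exists2 delta : R, 0 < delta & exists M0 : nat, forall M, (M0 <= M)%N ->
  {ae P, forall w, forall N0 : nat, exists i : nat, exists n : idx d,
     [/\ (0 < i)%N, idx_size n = bsize gam i, (N0 <= i)%N, (forall l, (M <= n l)%N) &
       theta * (1 - 2 * eps) * nrm alpha (idx_size n) <
       tsum alpha X delta (idx_size n) (window n (idx_pow n alpha)) w]}.
Proof.
move=> th0 v0 thv heps; have [a0 a1] := andP alpha01.
have [eps0 eps1] := andP heps.
have g0 : 0 < gam by apply: lt_trans gam1.
have [delta d0 [rho /andP[rho0 rho1] LT]] :=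
  tsum_lower_tail HY p2 a0 indepX dXY th0 v0 thv heps.
have [M1 HM1] := idx_size_pow_ge rho1.
exists delta => //; exists (maxn M1 1) => M; rewrite geq_max => /andP[M1M M0].
have [N1 _ H1] : \forall m \near \oo, forall J, uniq J -> (forall j, j \in J -> pos_idx j) ->
    rho * m%:R `^ alpha <= (size J)%:R <= m%:R `^ alpha ->
    ((m%:R `^ (- (gam^-1 * (1 - eps / 2))))%:E <=
     P [set w | (theta * (1 - 2 * eps) * nrm alpha m < tsum alpha X delta m J w)%R])%E.
  by apply: LT; rewrite d0 lexx.
pose q := (M ^ e)%N.
have q0 : (0 < q)%N by rewrite expn_gt0 M0.
have [N2 _ H2] := near_bsize_gap q0.
(* The bound M q makes the first coordinate of the slab, [bsize gam i] divided by q, at least M. *)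
pose I0 := maxn (maxn N1 N2) (maxn (M * q) 1).
pose Q i := (I0 <= i)%N /\ (q %| bsize gam i)%N.
pose J i : seq (idx d) := window (slab M i) (idx_pow (slab M i) alpha).
have Qi i : Q i -> [/\ (N1 <= i)%N, (N2 <= i)%N, (M * q <= i)%N & (0 < i)%N].
  by move=> [+ _]; rewrite !geq_max -!andbA => /and4P[].
have Qs i : Q i -> idx_size (slab M i) = bsize gam i by case=> _; exact: slab_size.
have Qpos i : Q i -> pos_idx (slab M i).
  move=> Hi; apply/pos_idxP; rewrite Qs//; have [_ _ _ i0] := Qi i Hi.
  by rewrite (leq_trans i0)// bsize_ge.
have QM i : Q i -> forall l, (M <= slab M i l)%N.
  move=> Hi l; rewrite ffunE; case: ifP => // _.
  have [_ _ Mq i0] := Qi i Hi.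
  by rewrite leq_divRL//; apply: leq_trans Mq (bsize_ge gam1 i0).
pose E i : set T := [set w | (theta * (1 - 2 * eps) * nrm alpha (bsize gam i) <
  tsum alpha X delta (bsize gam i) (J i) w)%R].
have JS i j : j \in J i -> pos_idx j by exact: window_pos.
have sE i : <<s rectangles X (J i) >> (E i).
  have mt : measurable_fun setT (trunc (delta / cscale alpha (bsize gam i)) : R -> R).
    exact: measurable_trunc.
  have mS := @measurable_coord_sum _ _ _ _ X (J i) (fun=> trunc (delta / cscale alpha (bsize gam i)))
    (fun=> mt).
  have := mS measurableT `]theta * (1 - 2 * eps) * nrm alpha (bsize gam i), +oo[%classic
    (measurable_itv _).
  rewrite setTI; congr (<<s _ >> _); apply/seteqP; split => w /=.
    by rewrite in_itv/= andbT.
  by rewrite in_itv/= andbT.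
have mE i : measurable (E i).
  exact: (measurable_sigma_rectangles indepX (@JS i)) (sE i).
have PE i : Q i -> ((i%:R `^ (- (1 - eps / 2)))%:E <= P (E i))%E.
  move=> Hi; have [N1i _ _ i0] := Qi i Hi.
  have b0 : (0 < bsize gam i)%N by rewrite (leq_trans i0)// bsize_ge.
  apply: le_trans (H1 (bsize gam i) _ (J i) _ _ _).
  - rewrite lee_fin; have iR : (0 : R) < i%:R by rewrite ltr0n.
    have bR : (0 : R) < (bsize gam i)%:R by rewrite ltr0n.
    have -> : i%:R `^ (- (1 - eps / 2)) = (i%:R `^ gam) `^ (- (gam^-1 * (1 - eps / 2))) :> R.
      by rewrite -powRrM mulrN mulrA divff ?gt_eqF// mul1r.
    rewrite !powRN lef_pV2 ?posrE ?powR_gt0//.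
    have /andP[h _] := bsize_itv gam i.
    apply: ge0_ler_powR; rewrite ?nnegrE ?powR_ge0// mulr_ge0 ?invr_ge0 ?(ltW g0)//.
    by lra.
  - by apply: leq_trans N1i _; exact: bsize_ge.
  - exact: uniq_window.
  - exact: JS.
  - rewrite size_window -Qs//; apply/andP; split.
      by apply: HM1; [exact: Qpos|move=> l; apply: leq_trans M1M (QM i Hi l)].
    exact: idx_size_pow_le.
have memJ i j : j \in J i ->
    (slab M i ord0 < j ord0 <= slab M i ord0 + idx_pow (slab M i) alpha ord0)%N.
  by rewrite /J mem_window => /forallP; apply.
have dJ i k j : Q i -> Q k -> j \in J i -> j \in J k -> i = k.
  have lt i' k' : Q i' -> Q k' -> (i' < k')%N -> j \in J i' -> j \in J k' -> False.
    move=> Hi Hk ik ji jk.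
    have /andP[_ j1] := memJ _ _ ji; have /andP[j2 _] := memJ _ _ jk.
    have [_ N2i _ i0] := Qi i' Hi.
    have si : slab M i' ord0 = (bsize gam i' %/ q)%N by rewrite ffunE eqxx.
    have sk : slab M k' ord0 = (bsize gam k' %/ q)%N by rewrite ffunE eqxx.
    have h := H2 i' N2i (slab M i' ord0) (slab M k' ord0).
    have {}h : ((slab M i' ord0)%:R : R) + (slab M i' ord0)%:R `^ alpha < (slab M k' ord0)%:R + 1.
      apply: h; first by rewrite si divnK//; exact: Hi.2.
      by rewrite sk divnK ?bsize_mono//; exact: Hk.2.
    have /andP[h1 _] := idx_pow_itv alpha (slab M i') ord0.
    have : ((slab M k' ord0).+1%:R : R) <= (slab M i' ord0 + idx_pow (slab M i') alpha ord0)%:R.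
      by rewrite ler_nat; exact: leq_trans j2 j1.
    by rewrite natrD -natr1; lra.
  move=> Hi Hk ji jk; case: (ltngtP i k) => // ik.
    by have := lt i k Hi Hk ik ji jk.
  by have := lt k i Hk Hi ik jk ji.
have := @borel_cantelli_indep R _ _ P Q E (fun i _ => mE i).
move=> BC.
have {BC} : {ae P, forall w N, exists i, [/\ (N <= i)%N, Q i & E i w]}.
  apply: BC => N C.
  have [cc [N3 [cc0 Hh]]] := floor_powR_divisible gam1 q0.
  have e20 : 0 < eps / 2 by rewrite divr_gt0.
  (* On [n0, 2 n0) at least cc n0 indices qualify, each with probability at least (2 n0)^(-(1 -
     eps/2)); the total grows like n0^(eps/2), and [N4] makes it at least C. *)
  have [N4 _ H4] := @near_le_powR R (eps / 2) (C * 2 `^ (1 - eps / 2) / cc) e20.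
  pose n0 := maxn (maxn N I0) (maxn N3 N4).
  have n0E : [/\ (N <= n0)%N, (I0 <= n0)%N, (N3 <= n0)%N & (N4 <= n0)%N].
    exact: leq_max4.
  have [Nn In N3n N4n] := n0E.
  have n00 : (0 < n0)%N.
    by have [_ _ _ i0] := leq_max4 N1 N2 (M * q) 1; exact: leq_trans i0 In.
  exists [seq i <- index_iota n0 (n0 + n0) | (q %| bsize gam i)%N].
  have sQ i : i \in [seq i <- index_iota n0 (n0 + n0) | (q %| bsize gam i)%N] ->
      [/\ (n0 <= i)%N, (i < n0 + n0)%N & Q i].
    rewrite mem_filter mem_index_iota => /and3P[qi n0i i2]; split => //; split => //.
    exact: leq_trans In n0i.
  split.
  - by move=> i /sQ[n0i _ Hi]; split => //; exact: leq_trans Nn n0i.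
  - apply: (indep_blocks indepX (J := J)).
    + by rewrite filter_uniq// iota_uniq.
    + by move=> i _; exact: uniq_window.
    + by move=> i _ j; exact: JS.
    + by move=> i k j /sQ[_ _ Hi] /sQ[_ _ Hk]; exact: dJ.
    + by move=> i _; rewrite -setTD; apply: sigma_algebraCD; exact: sE.
  have n0R : (0 : R) < n0%:R by rewrite ltr0n.
  apply: le_trans (_ : (\sum_(i <- [seq i <- index_iota n0 (n0 + n0) | (q %| bsize gam i)%N])
      ((2 * n0%:R) `^ (- (1 - eps / 2)))%:E <= _)%E); last first.
    rewrite big_seq_cond [leRHS]big_seq_cond; apply: lee_sum => i /andP[/sQ[n0i i2 Hi] _].
    apply: le_trans (PE i Hi); rewrite lee_fin !powRN.
    have iR : (0 : R) < i%:R by rewrite ltr0n (leq_trans n00).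
    rewrite lef_pV2 ?posrE ?powR_gt0 ?mulr_gt0//; apply: ge0_ler_powR.
    + by lra.
    + by rewrite nnegrE ltW.
    + by rewrite nnegrE mulr_ge0// ltW.
    by rewrite -natrM ler_nat; apply: ltnW; rewrite mul2n -addnn.
  rewrite sumEFin lee_fin big_const_seq count_predT size_filter iter_addr_0.
  rewrite -[X in _ <= X]mulr_natl.
  have := Hh n0 N3n.
  have -> : hits (fun i => (q%:Z %| Num.floor ((i%:R : R) `^ gam))%Z) n0 n0 =
      count (fun i => (q %| bsize gam i)%N) (index_iota n0 (n0 + n0)).
    rewrite /hits -sum1_count [RHS]big_mkcond /=; apply: eq_bigr => i _.
    by rewrite dvdz_floor_powR; case: (_ %| _)%N.
  move=> hc; apply: le_trans (_ : cc * n0%:R * (2 * n0%:R) `^ (- (1 - eps / 2)) <= _); last first.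
    by rewrite ler_wpM2r ?powR_ge0.
  rewrite powRN ler_pdivlMr ?powR_gt0 ?mulr_gt0// powRM ?(ltW n0R)//.
  have := H4 n0 N4n; rewrite ler_pdivrMr// => h.
  have nn : n0%:R = n0%:R `^ (eps / 2) * n0%:R `^ (1 - eps / 2) :> R.
    by rewrite -powRD ?(gt_eqF n0R) ?implybT// [eps / 2 + _]addrC subrK powRr1 ?(ltW n0R).
  rewrite [X in _ <= cc * X]nn mulrA mulrA ler_wpM2r ?powR_ge0//.
  by rewrite [cc * _]mulrC.
apply: filterS => w HE N0; have [i [N0i Hi Ei]] := HE N0.
have [_ _ _ i0] := Qi i Hi.
exists i, (slab M i); rewrite Qs//; split => //.
exact: QM.
Qed.

End lower.

(** * The upper limit *)

Section moments.
Context {R : realType}.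

(* For [y >= 1], [log y <= y ^ (1 - alpha) / (1 - alpha)]; at exponent [- 1 / alpha] this
   costs exactly the gap between [2 / alpha] and [1 + 1 / alpha]. *)
Lemma powR_le_moment_weight (alpha : R) (e : nat) : 0 < alpha < 1 ->
  exists2 C : R, 0 <= C & forall y : R, 0 <= y ->
    y `^ (1 + 1 / alpha) <= 1 + C * (y `^ (2 / alpha) * logp y `^ (e.+1%:R - 1 - 1 / alpha)).
Proof.
move=> /andP[a0 a1].
pose kap := 1 - alpha.
have k0 : 0 < kap by rewrite subr_gt0.
have k1 : 1 <= kap^-1 by rewrite invf_ge1// /kap; lra.
have ai0 : 0 < 1 / alpha by rewrite divr_gt0.
exists (kap^-1 `^ (1 / alpha)); first exact: powR_ge0.
move=> y y0.
have W0 : 0 <= kap^-1 `^ (1 / alpha) * (y `^ (2 / alpha) * logp y `^ (e.+1%:R - 1 - 1 / alpha)).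
  by rewrite !mulr_ge0 ?powR_ge0.
have [y1|y1] := leP y 1.
  rewrite -[leLHS]addr0; apply: lerD => //.
  have : y `^ (1 + 1 / alpha) <= 1 `^ (1 + 1 / alpha).
    by apply: ge0_ler_powR; rewrite ?nnegrE// addr_ge0// ltW.
  by rewrite powR1.
have yp : 0 < y by lra.
have yk1 : 1 <= y `^ kap.
  by have : y `^ 0 <= y `^ kap by [apply: ler_powR; rewrite ltW]; rewrite powRr0.
have lnk : ln y <= kap^-1 * y `^ kap.
  rewrite mulrC ler_pdivlMr// mulrC -ln_powR; apply: le_trans (_ : y `^ kap - 1 <= _).
    by have := @le_ln1Dx R (y `^ kap - 1); rewrite [1 + _]addrC subrK; apply; lra.
  by lra.
have lk : logp y <= kap^-1 * y `^ kap.
  rewrite /logp ge_max lnk /=; apply: le_trans yk1 _.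
  by rewrite ler_peMl// powR_ge0.
have h1 : logp y `^ (- (1 / alpha)) <= logp y `^ (e.+1%:R - 1 - 1 / alpha).
  apply: ler_powR; first exact: logp_ge1.
  by rewrite -natr1 addrK lerDr.
have h2 : (kap^-1 * y `^ kap) `^ (- (1 / alpha)) <= logp y `^ (- (1 / alpha)).
  rewrite !powRN lef_pV2 ?posrE ?powR_gt0 ?logp_gt0 ?mulr_gt0 ?invr_gt0 ?powR_gt0//.
  by apply: ge0_ler_powR; rewrite ?nnegrE ?(ltW ai0) ?(ltW (logp_gt0 _)) ?mulr_ge0 ?powR_ge0 ?invr_ge0 ?(ltW k0).
apply: le_trans (_ : kap^-1 `^ (1 / alpha) *
  (y `^ (2 / alpha) * (kap^-1 * y `^ kap) `^ (- (1 / alpha))) <= _); last first.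
  rewrite -[leLHS]add0r; apply: lerD => //; rewrite ler_wpM2l ?powR_ge0//.
  by rewrite ler_wpM2l ?powR_ge0//; exact: le_trans h2 h1.
rewrite powRM ?powR_ge0 ?invr_ge0 ?(ltW k0)// mulrCA !mulrA mulrAC -!mulrA.
rewrite [X in _ <= X](_ : _ = (kap^-1 `^ (1 / alpha) * kap^-1 `^ (- (1 / alpha))) *
  (y `^ (2 / alpha) * (y `^ kap) `^ (- (1 / alpha)))); last by ring.
have ki : kap^-1 != 0 by rewrite invr_eq0 gt_eqF.
rewrite -powRD ?ki ?implybT// subrr powRr0 -powRrM -powRD ?(gt_eqF yp) ?implybT// !mul1r.
rewrite le_eqVlt; apply/orP; left; apply/eqP; congr (_ `^ _).
by rewrite /kap; field; rewrite gt_eqF.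
Qed.

(** The order 1 + 1/alpha lies strictly between 2 and 2/alpha: above 2 as the exponential bounds
    need, below 2/alpha so that a negative power of the logarithm in the weight does no harm. *)
Lemma centred_moments_of_weight {dT : measure_display} {T : measurableType dT}
    (P : probability T R) (Y : T -> R) (e : nat) (alpha sigma : R) : 0 < alpha < 1 ->
  Y \in Lfun P 2%:E -> ('E_P[Y] = 0)%E -> ('V_P[Y] = (sigma ^+ 2)%:E)%E ->
  (\int[P]_w ((`|Y w| `^ (2 / alpha)) *
              (logp `|Y w|) `^ (e.+1%:R - 1 - 1 / alpha))%:E < +oo)%E ->
  exists mp : R, centred_moments P Y (1 + 1 / alpha) (sigma ^+ 2) mp.
Proof.
move=> alpha01 L2 EY VY intY.
have mY : measurable_fun setT Y.
  by have := sub_Lfun_mfun L2; rewrite inE.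
have fP : P [set: T] \is a fin_num by exact: fin_num_measure.
have iY : P.-integrable setT (EFin \o Y).
  by apply/Lfun1_integrable; exact: Lfun_subset12.
have iY2 : P.-integrable setT (EFin \o (fun w => Y w ^+ 2)) by exact: Lfun2_integrable_sqr.
have [C C0 HC] := powR_le_moment_weight e alpha01.
pose h w : R := (`|Y w| `^ (2 / alpha)) * (logp `|Y w|) `^ (e.+1%:R - 1 - 1 / alpha).
have mh : measurable_fun setT h by exact: measurable_moment_weight.
have h0 w : 0 <= h w by rewrite mulr_ge0 ?powR_ge0.
have mp : measurable_fun setT (fun w => `|Y w| `^ (1 + 1 / alpha)).
  apply: (@measurableT_comp _ _ _ _ _ _ (@powR R ^~ (1 + 1 / alpha))).
    exact: measurable_powR.
  by apply: measurableT_comp => //; exact: normr_measurable.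
have ip : P.-integrable setT (EFin \o (fun w => `|Y w| `^ (1 + 1 / alpha))).
  apply/integrableP; split; first exact/measurable_EFinP.
  apply: le_lt_trans (_ : (\int[P]_w (1 + C * h w)%:E < +oo)%E).
    apply: ge0_le_integral => //.
    - by do 2 apply: measurableT_comp => //.
    - apply/measurable_EFinP; apply: measurable_funD => //.
      by apply: measurable_funM.
    by move=> w _ /=; rewrite lee_fin ger0_norm ?powR_ge0// HC.
  under eq_integral do rewrite EFinD EFinM.
  rewrite ge0_integralD//; last 2 first.
  - by move=> w _; rewrite -EFinM lee_fin mulr_ge0.
  - by apply: emeasurable_funM => //; exact/measurable_EFinP.
  rewrite ge0_integralZl//; last 2 first.
  - exact/measurable_EFinP.
  - by move=> w _; rewrite lee_fin.
  rewrite integral_cst// mul1e; apply: lte_add_pinfty; first by rewrite ltey_eq fP.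
  by apply: lte_mul_pinfty; rewrite ?lee_fin.
exists (fine (\int[P]_w (`|Y w| `^ (1 + 1 / alpha))%:E)); split => //.
- by split => //; rewrite -EY unlock.
- split => //; have := varianceE L2; rewrite VY EY expe2 mul0e sube0 => ->.
  by rewrite unlock; apply: eq_integral => w _.
- by split => //; rewrite fineK//; exact: integrable_fin_num.
Qed.

End moments.

Section limit.
Context {R : realType}.

Lemma limsup_in_eq d (S : set (idx d)) (f : idx d -> R) (l : R) :
  (forall r : nat, exists M : nat, forall n, S n -> (forall i, (M <= n i)%N) ->
     f n <= l + r.+1%:R^-1) ->
  (forall (r M : nat), exists n, [/\ S n, (forall i, (M <= n i)%N) & l - r.+1%:R^-1 <= f n]) ->
  limsup_in S f = l%:E.
Proof.
move=> U L; apply/eqP; rewrite eq_le; apply/andP; split.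
  apply/lee_addgt0Pr => x x0.
  have [r rx] := ltr_add_invr x0; rewrite add0r in rx.
  have [M HM] := U r.
  apply: le_trans (_ : ereal_sup [set (f n)%:E | n in
      [set n | S n /\ forall i, (M <= n i)%N]] <= _)%E.
    by apply: ereal_inf_lbound; exists M.
  apply: ge_ereal_sup => _ [n [Sn Mn] <-]; rewrite -EFinD lee_fin.
  by apply: le_trans (HM n Sn Mn) _; rewrite lerD2l ltW.
apply: le_ereal_inf_tmp => _ [M _ <-]; apply/lee_subgt0Pr => x x0.
have [r rx] := ltr_add_invr x0; rewrite add0r in rx.
have [n [Sn Mn fn]] := L r M.
apply: le_trans (_ : (f n)%:E <= _)%E; last by apply: ereal_sup_ubound; exists n.
by rewrite -EFinB lee_fin; apply: le_trans fn; rewrite lerD2l lerN2 ltW.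
Qed.

Lemma bsize_floor (gam : R) i : (bsize gam i)%:R = (Num.floor (i%:R `^ gam))%:~R :> R.
Proof.
by rewrite /bsize truncn_floor powR_ge0 natr_absz ger0_norm// floor_ge0 powR_ge0.
Qed.

(** Serves the degenerate case of limit 0: the maximum is nonnegative, and it remains that B has
    points with all coordinates large, since an empty supremum would be minus infinity. *)
Lemma slab_frequently (gam : R) (e : nat) : 1 < gam -> forall M N0 : nat,
  exists i : nat, exists n : idx e.+1,
    [/\ (0 < i)%N, idx_size n = bsize gam i, (N0 <= i)%N & forall l, (M <= n l)%N].
Proof.
move=> gam1 M N0; pose M' := M.+1; pose q := (M' ^ e)%N.
have q0 : (0 < q)%N by rewrite expn_gt0.
have [c [N3 [c0 Hh]]] := floor_powR_divisible gam1 q0.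
have [hN h0 h3 hM] := leq_max4 N0 1 N3 (M' * q).
set N := maxn (maxn N0 1) (maxn N3 (M' * q)) in hN h0 h3 hM.
have := Hh N h3; rewrite leNgt => hpos.
have [i [Ni qi]] : exists i, (N <= i)%N /\ (q %| bsize gam i)%N.
  apply: contrapT => H; move/negP: hpos; apply.
  rewrite /hits big_nat_cond big1; first by rewrite mulr_gt0// ltr0n.
  move=> i /andP[/andP[Ni _] _]; rewrite dvdz_floor_powR.
  by case: (boolP (_ %| _)%N) => // qi; case: H; exists i.
have i0 := leq_trans h0 Ni.
exists i, (slab e gam M' i); split => //; [exact: slab_size|exact: leq_trans hN Ni|].
move=> l; rewrite ffunE; case: ifP => // _.
apply: leq_trans (leqnSn M) _; rewrite leq_divRL//.
by apply: leq_trans (bsize_ge gam1 i0); exact: leq_trans hM Ni.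
Qed.

End limit.

Section assembly.
Context {R : realType} {dT : measure_display} {T : measurableType dT}.
Context (P : probability T R) (e : nat) (alpha gam p v mp : R) (Y : T -> R).
Let d := e.+1.
Context (X : idx d -> T -> R).
Hypotheses (alpha01 : 0 < alpha < 1) (gam1 : 1 < gam).
Hypothesis gamA : 1 < gam * (1 - alpha).
Hypotheses (HY : centred_moments P Y p v mp) (p2 : 2 < p).
Hypothesis indepX : mutually_independent P (@pos_idx d) X.
Hypothesis dXY : forall j, pos_idx j -> forall A, measurable A ->
  P (X j @^-1` A) = P (Y @^-1` A).
Hypothesis intY : (\int[P]_w ((`|Y w| `^ (2 / alpha)) *
              (logp `|Y w|) `^ (d%:R - 1 - 1 / alpha))%:E < +oo)%E.
Variable theta : R.
Hypotheses (th0 : 0 <= theta) (thv : theta ^+ 2 = v / gam).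

Lemma coord_le_size (n : idx d) l : pos_idx n -> (n l <= idx_size n)%N.
Proof.
move=> pn; rewrite /idx_size (bigD1 l)//= leq_pmulr// prodn_cond_gt0// => l' _.
Qed.

Lemma maxT_upper_as (x : R) : 0 < x ->
  {ae P, forall w, exists M : nat, forall i, (0 < i)%N -> forall n : idx d,
     idx_size n = bsize gam i -> (M <= idx_size n)%N ->
     maxT X n (idx_pow n alpha) w / nrm alpha (idx_size n) <= theta + x}.
Proof.
move=> x0.
have x3 : 0 < x / 3 by rewrite divr_gt0.
have t0 : 0 < theta + x / 3 by rewrite ltr_wpDl.
have vx : v / gam < (theta + x / 3) ^+ 2.
  by rewrite -thv ltrXn2r// ?ltrDl// ltW.
have [delta d0 H1] := tsum_upper_as alpha01 gam1 HY p2 indepX dXY t0 vx x3.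
have H2 := truncation_error alpha01 gam1 HY p2 indepX dXY intY x3 d0.
have [N3 _ H3] := @near_le_ln R 1.
apply: filterS2 H1 H2 => w [M1 J1] [M2 J2].
exists (maxn M1 (maxn M2 N3)) => i i0 n nb; rewrite !geq_max => /and3P[h1 h2 h3].
have n0 := nrm_gt0 alpha (H3 _ h3).
rewrite ler_pdivrMr//; apply: maxT_le.
  by rewrite mulr_ge0 ?(ltW n0)// addr_ge0// ltW.
move=> k kN.
have a1 := J1 i i0 n nb h1 k kN.
have := J2 i i0 n nb h2 k kN; rewrite ler_norml => /andP[_ a2].
have E : (theta + x) * nrm alpha (idx_size n) =
  (theta + x / 3 + x / 3) * nrm alpha (idx_size n) + x / 3 * nrm alpha (idx_size n) by field.
by rewrite E -lerBlDl; apply: le_trans a2; rewrite lerB.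
Qed.

Lemma maxT_lower_as (x : R) (M : nat) : 0 < x ->
  {ae P, forall w, exists i : nat, exists n : idx d,
     [/\ (0 < i)%N, idx_size n = bsize gam i, (forall l, (M <= n l)%N) &
       theta - x <= maxT X n (idx_pow n alpha) w / nrm alpha (idx_size n)]}.
Proof.
move=> x0; have [tE|tN] := eqVneq theta 0.
  apply: nearW => w; have [i [n [i0 nb _ nM]]] := slab_frequently e gam1 M 0.
  exists i, n; split => //; rewrite tE; apply: le_trans (_ : 0 <= _).
    by rewrite sub0r oppr_le0 ltW.
  by rewrite divr_ge0 ?maxT_ge0// sqrtr_ge0.
have tp : 0 < theta by rewrite lt_neqAle eq_sym tN.
have g0 : 0 < gam by apply: lt_trans gam1.
have v0 : 0 < v.
  have : 0 < v / gam by rewrite -thv exprn_gt0.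
  by rewrite pmulr_lgt0 ?invr_gt0.
have D0 : 0 < 4 * (theta + x) by rewrite mulr_gt0// addr_gt0.
(* Makes 2 eps theta <= x/2 and eps < 1/2; the other x/2 is left for the truncation error. *)
pose eps := x / (4 * (theta + x)).
have eps0 : 0 < eps by rewrite divr_gt0.
have eE : eps * (4 * (theta + x)) = x by rewrite /eps divfK// gt_eqF.
have ex : 0 < eps * x by rewrite mulr_gt0.
have et : 0 < eps * theta by rewrite mulr_gt0.
have epsb : 0 < eps < 1 / 2.
  rewrite eps0 /= /eps ltr_pdivrMr//; lra.
have x2 : 0 < x / 2 by rewrite divr_gt0.
have [delta d0 [M0 H1]] := tsum_lower_as alpha01 gam1 gamA HY p2 indepX dXY tp v0 thv epsb.
have {}H1 := H1 (maxn M0 M) (leq_maxl _ _).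
have H2 := truncation_error alpha01 gam1 HY p2 indepX dXY intY x2 d0.
have [N3 _ H3] := @near_le_ln R 1.
apply: filterS2 H1 H2 => w J1 [M2 J2].
have [i [n [i0 nb]]] := J1 (maxn M2 N3).
rewrite geq_max => /andP[Mi Ni] nM hl.
have ib : (i <= idx_size n)%N by rewrite nb; exact: bsize_ge.
have n0 := nrm_gt0 alpha (H3 _ (leq_trans Ni ib)).
exists i, n; split => //.
  by move=> l; apply: leq_trans (nM l); exact: leq_maxr.
rewrite ler_pdivlMr//; apply: le_trans (Tsum_le_maxT _ _ _ _).
have := J2 i i0 n nb (leq_trans Mi ib) (idx_pow n alpha) (fun=> leqnn _).
rewrite ler_norml => /andP[a2 _].
have E : (theta - x) * nrm alpha (idx_size n) <=
  theta * (1 - 2 * eps) * nrm alpha (idx_size n) - x / 2 * nrm alpha (idx_size n).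
  by rewrite -mulrBl ler_pM2r//; lra.
apply: le_trans E _; lra.
Qed.

Lemma limsup_maxT_as (B : set (idx d)) :
  (forall n, B n <-> pos_idx n /\ exists i, (0 < i)%N /\ idx_size n = bsize gam i) ->
  {ae P, forall w, limsup_in B
     (fun n => maxT X n (idx_pow n alpha) w / nrm alpha (idx_size n)) = theta%:E}.
Proof.
move=> BE.
have U : {ae P, forall w, forall r, exists M : nat, forall i, (0 < i)%N -> forall n : idx d,
     idx_size n = bsize gam i -> (M <= idx_size n)%N ->
     maxT X n (idx_pow n alpha) w / nrm alpha (idx_size n) <= theta + r.+1%:R^-1}.
  by apply: ae_foralln => r; apply: maxT_upper_as; rewrite invr_gt0.
have L : {ae P, forall w, forall r M, exists i : nat, exists n : idx d,
     [/\ (0 < i)%N, idx_size n = bsize gam i, (forall l, (M <= n l)%N) &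
       theta - r.+1%:R^-1 <= maxT X n (idx_pow n alpha) w / nrm alpha (idx_size n)]}.
  apply: ae_foralln => r; apply: ae_foralln => M; apply: maxT_lower_as.
  by rewrite invr_gt0.
apply: filterS2 U L => w HU HL; apply: limsup_in_eq => [r|r M].
  have [M HM] := HU r; exists M => n /BE[pn [i [i0 nb]]] Mn; apply: (HM i i0 n nb).
  exact: leq_trans (Mn ord0) (coord_le_size _ pn).
have [i [n [i0 nb nM hn]]] := HL r M.
exists n; split => //; apply/BE; split; last by exists i.
by apply/pos_idxP; rewrite nb (leq_trans i0)// bsize_ge.
Qed.

End assembly.

Theorem theorem7p2 (R : realType) (dT : measure_display) (T : measurableType dT)
    (P : probability T R) (d : nat) (alpha beta : R)
    (X : idx d -> T -> R) (Y : T -> R) (sigma : R) :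
  (2 <= d)%N -> 0 < alpha < 1 -> 1 < beta ->
  iid_copies P (@pos_idx d) X Y ->
  Y \in Lfun P 2%:E ->
  ('E_P[Y] = 0)%E ->
  0 <= sigma -> ('V_P[Y] = (sigma ^+ 2)%:E)%E ->
  (\int[P]_w ((`|Y w| `^ (2 / alpha)) *
              (logp `|Y w|) `^ (d%:R - 1 - 1 / alpha))%:E < +oo)%E ->
  let B := [set n : idx d | pos_idx n /\
              exists i : nat, (0 < i)%N /\
                ((idx_size n)%:R : R) = (Num.floor (i%:R `^ (beta / (1 - alpha))))%:~R] in
  {ae P, forall w,
    limsup_in B (fun n => maxT X n (idx_pow n alpha) w /
                   Num.sqrt (2 * (idx_size n)%:R `^ alpha * ln ((idx_size n)%:R)))
    = (sigma * Num.sqrt ((1 - alpha) / beta))%:E}.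
Proof.
case: d X => // e X _ alpha01 beta1 [mX dXY prodX] L2 EY sigma0 VY intY B.
have [a0 a1] := andP alpha01.
have c0 : 0 < 1 - alpha by rewrite subr_gt0.
have b0 : 0 < beta by apply: lt_trans beta1.
have [mp HY] := centred_moments_of_weight alpha01 L2 EY VY intY.
have p2 : 2 < 1 + 1 / alpha.
  have : 1 < 1 / alpha by rewrite ltr_pdivlMr// mul1r.
  by move=> h; lra.
have gamA : 1 < beta / (1 - alpha) * (1 - alpha) by rewrite divfK// gt_eqF.
have gam1 : 1 < beta / (1 - alpha).
  by apply: lt_trans beta1 _; rewrite ltr_pdivlMr// gtr_pMr// ltrBlDr ltrDl.
apply: (@limsup_maxT_as R dT T P e alpha (beta / (1 - alpha)) _ _ mp Y X alpha01 gam1 gamA HY p2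
  (conj mX prodX) dXY intY).
- by rewrite mulr_ge0// sqrtr_ge0.
- rewrite exprMn sqr_sqrtr; last by rewrite divr_ge0// ltW.
  by rewrite invfM invrK [_^-1 * _]mulrC.
move=> n; rewrite /B /=; split=> -[pn [i [i0 nE]]]; split => //; exists i; split => //.
  by apply/eqP; rewrite -(eqr_nat R) nE bsize_floor.
by rewrite nE bsize_floor.
Qed.
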